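(* The semi-discrete HDG method (S1)-(S10) for the incompressible MHD equations, written out in the context, is consistent provided the exact solution $(\mathbf{u},p,\mathbf{B},r)$ of the strong form (E1)-(E10) of the incompressible MHD equations, also written out in the context, is sufficiently smooth. That is, if $(\mathbf{u},p,\mathbf{B},r)$ is a sufficiently smooth solution of (E1)-(E10), then equations (S1)-(S10) all hold (for all the test functions and times indicated there) when $(\mathbf{u}^h,\hat{\mathbf{u}}^h,p^h,\hat p^h,\mathbf{B}^h,\hat{\mathbf{B}}^h,r^h,\hat r^h)$ is replaced by $(\mathbf{u},\mathbf{u}|_{\tilde\Gamma},p,p|_{\tilde\Gamma},\mathbf{B},\mathbf{B}|_{\tilde\Gamma},r,r|_{\tilde\Gamma})$ (including in the definition of the inflow indicator $\lambda$).
   Context: **Conventions.** $(\mathbf a\otimes\mathbf b)_{ij}=a_ib_j$; $(\nabla\mathbf a)_{ij}=\partial a_j/\partial x_i$; $(\nabla\cdot\mathbf A)_j=\sum_i\partial A_{ij}/\partial x_i$; $(\mathbf n\cdot\mathbf A)_j=\sum_i n_iA_{ij}$; $\mathbf C:\mathbf D=\sum_{i,j}C_{ij}D_{ij}$; $\nabla^s\mathbf a=\frac12(\nabla\mathbf a+(\nabla\mathbf a)^T)$; $\nabla^a\mathbf a=\frac12(\nabla\mathbf a-(\nabla\mathbf a)^T)$; $\mathbb 1$ is the $d\times d$ identity. **Data.** $\Omega\subset\mathbb R^d$, $d\in\{2,3\}$, is a bounded domain with outward unit normal $\mathbf n$; $\partial\Omega=\overline{\Gamma_D\cup\Gamma_N}$,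 $\Gamma_D\cap\Gamma_N=\emptyset$. $\rho>0$ (density) and $\mu_0>0$ (permeability of free space) are constants; $\nu,\eta:\Omega\times(0,\infty)\to\mathbb R^+$; $\mathbf f_v,\mathbf f_m:\Omega\times(0,\infty)\to\mathbb R^d$; $\mathbf g_v,\mathbf g_m:\Gamma_D\times(0,\infty)\to\mathbb R^d$; $\mathbf h_v,\mathbf h_m:\Gamma_N\times(0,\infty)\to\mathbb R^d$; $\mathbf u_0,\mathbf B_0:\Omega\to\mathbb R^d$. **Strong form.** $\mathbf u,\mathbf B:\bar\Omega\times[0,\infty)\to\mathbb R^d$ and $p,r:\Omega\times(0,\infty)\to\mathbb R$ satisfy, in $\Omega\times(0,\infty)$ for (E1)-(E4): (E1) $\partial_t\mathbf u+\nabla\cdot(\mathbf u\otimes\mathbf u)+\frac1\rho\nabla p-\nabla\cdot(2\nu\nabla^s\mathbf u)-\nabla\cdot\big(\frac1{\rho\mu_0}(\mathbf B\otimes\mathbf B-\frac12|\mathbf B|^2\mathbb 1)\big)=\mathbf f_v$; (E2) $\nabla\cdot\mathbf u=0$; (E3) $\partial_t\mathbf B+\nabla\cdot(\mathbf u\otimes\mathbf B)-\nabla\cdot(\mathbf B\otimes\mathbf u)-\nabla\cdot(2\frac{\eta}{\mu_0}\nabla^a\mathbf B)+\nabla r=\mathbf f_m$; (E4) $\nabla\cdot\mathbf B=0$; (E5) $\mathbf u=\mathbf g_v$ on $\Gamma_D\times(0,\infty)$; (E6) $\mathbf n\cdot\big(-\frac1\rho p\mathbb 1+2\nu\nabla^s\mathbf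 u+\frac1{\rho\mu_0}(\mathbf B\otimes\mathbf B-\frac12|\mathbf B|^2\mathbb 1)\big)-\min(\mathbf u\cdot\mathbf n,0)\mathbf u=\mathbf h_v$ on $\Gamma_N\times(0,\infty)$; (E7) $\mathbf B=\mathbf g_m$ on $\Gamma_D\times(0,\infty)$; (E8) $\mathbf n\cdot(-r\mathbb 1+2\frac{\eta}{\mu_0}\nabla^a\mathbf B)-\min(\mathbf u\cdot\mathbf n,0)\mathbf B=\mathbf h_m$ on $\Gamma_N\times(0,\infty)$; (E9) $\mathbf u(\cdot,0)=\mathbf u_0$ in $\Omega$; (E10) $\mathbf B(\cdot,0)=\mathbf B_0$ in $\Omega$. The phrase ''sufficiently smooth'' is used informally, with no specific regularity class prescribed; for a sufficiently smooth exact solution the strong equations hold pointwise. **Mesh and spaces.** $\mathcal T=\{\Omega_e\}$ is a (finite) triangulation of $\Omega$, $\bar\Omega=\overline{\cup_e\Omega_e}$; $\Gamma_{e_i}$ is the $i$-th facet of $\Omega_e$ and $\mathbf n$ on $\Gamma_{e_i}$ is the outward unit normal to $\Omega_e$; $h_e$ is the diameter of $\Omega_e$. $\mathcal F$ is the set of all facets, $\tilde\Gamma=\overline{\cup_{F\in\mathcal F}F}$. Each interior facet (not on $\partial\Omega$) is shared by two adjacent elements. With $P_k(D)$ the space of polynomials of degree $k$ (i.e. at most $k$) on $D$ and $k\ge1$: $V^h=W^h=\{\mathbf v\in[L^2(\Omega)]^d:\mathbf v|_{\Omega_e}\in[P_k(\Omega_e)]^d\ \forall\Omega_e\in\mathcal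 T\}$; $\hat V^h=\hat W^h=\{\hat{\mathbf v}\in[L^2(\tilde\Gamma)]^d:\hat{\mathbf v}|_F\in[P_k(F)]^d\ \forall F\in\mathcal F\}$; $Q^h_v=Q^h_m=\{q\in L^2(\Omega):q|_{\Omega_e}\in P_{k-1}(\Omega_e)\ \forall\Omega_e\in\mathcal T\}$; $\hat Q^h_v=\hat Q^h_m=\{\hat q\in L^2(\tilde\Gamma):\hat q|_F\in P_k(F)\ \forall F\in\mathcal F\}$; $\hat V^h_0,\hat W^h_0$ are the subspaces of $\hat V^h,\hat W^h$ of functions vanishing on $\Gamma_D$; $\hat V^h_g(t),\hat W^h_g(t)$ are the subsets of $\hat V^h,\hat W^h$ of functions equal on $\Gamma_D$ to $\mathbf g_v(\cdot,t)$, $\mathbf g_m(\cdot,t)$ respectively. **Semi-discrete HDG method.** The unknowns are $(\mathbf u^h,\hat{\mathbf u}^h,p^h,\hat p^h,\mathbf B^h,\hat{\mathbf B}^h,r^h,\hat r^h)(t)\in V^h\times\hat V^h_g(t)\times Q^h_v\times\hat Q^h_v\times W^h\times\hat W^h_g(t)\times Q^h_m\times\hat Q^h_m$. $C_{\rm pen}$ is a penalty constant. On each $\Gamma_{e_i}$, $\lambda=1$ where $\mathbf u^h\cdot\mathbf n<0$ and $\lambda=0$ where $\mathbf u^h\cdot\mathbf n\ge0$ ($\mathbf u^h$ and other element fields are evaluated from inside $\Omega_e$). Write $\mathbf M(\mathbf b)=\frac1{\rho\mu_0}(\mathbf b\otimes\mathbf b-\frac12|\mathbf b|^2\mathbb 1)$.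 The equations, for all $t>0$ in (S1)-(S8), are: (S1) for all $\mathbf v^h\in V^h$: $\sum_e\int_{\Omega_e}\big[\partial_t\mathbf u^h\cdot\mathbf v^h-(\mathbf u^h\otimes\mathbf u^h):\nabla\mathbf v^h-\frac1\rho p^h\mathbb 1:\nabla\mathbf v^h+2\nu\nabla^s\mathbf u^h:\nabla^s\mathbf v^h+\mathbf M(\mathbf B^h):\nabla\mathbf v^h-\mathbf f_v\cdot\mathbf v^h\big]$ $+\sum_e\sum_i\int_{\Gamma_{e_i}}\big[(1-\lambda)(\mathbf u^h\otimes\mathbf u^h)+\lambda(\mathbf u^h\otimes\hat{\mathbf u}^h)+\frac1\rho\hat p^h\mathbb 1-2\nu\nabla^s\mathbf u^h+2\frac{C_{\rm pen}}{h_e}\nu\,\mathbf n\otimes(\mathbf u^h-\hat{\mathbf u}^h)-\mathbf M(\hat{\mathbf B}^h)\big]:(\mathbf n\otimes\mathbf v^h)$ $-\sum_e\sum_i\int_{\Gamma_{e_i}}2\nu\big(\mathbf n\otimes(\mathbf u^h-\hat{\mathbf u}^h)\big):\nabla^s\mathbf v^h=0$. (S2) for all $\hat{\mathbf v}^h\in\hat V^h_0$: $\sum_e\sum_i\int_{\Gamma_{e_i}}\big[(1-\lambda)(\mathbf u^h\otimes\mathbf u^h)+\lambda(\mathbf u^h\otimes\hat{\mathbf u}^h)+\frac1\rho\hat p^h\mathbb 1-2\nu\nabla^s\mathbf u^h+2\frac{C_{\rm pen}}{h_e}\nu\,\mathbf n\otimes(\mathbf u^h-\hat{\mathbf u}^h)-\mathbf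 M(\hat{\mathbf B}^h)\big]:(\mathbf n\otimes\hat{\mathbf v}^h)$ $-\sum_e\sum_i\int_{\Gamma_N\cap\Gamma_{e_i}}(1-\lambda)(\mathbf u^h\otimes\hat{\mathbf u}^h):(\mathbf n\otimes\hat{\mathbf v}^h)+\sum_e\sum_i\int_{\Gamma_N\cap\Gamma_{e_i}}\mathbf h_v\cdot\hat{\mathbf v}^h=0$. (S3) for all $q^h_v\in Q^h_v$: $\sum_e\int_{\Omega_e}\frac1\rho(\nabla\cdot\mathbf u^h)q^h_v=0$. (S4) for all $\hat q^h_v\in\hat Q^h_v$: $\sum_e\sum_i\int_{\Gamma_{e_i}}\frac1\rho(\mathbf u^h-\hat{\mathbf u}^h)\cdot\mathbf n\,\hat q^h_v=0$. (S5) for all $\mathbf w^h\in W^h$: $\sum_e\int_{\Omega_e}\big[\partial_t\mathbf B^h\cdot\mathbf w^h-(\mathbf u^h\otimes\mathbf B^h):\nabla\mathbf w^h-r^h\mathbb 1:\nabla\mathbf w^h+2\frac{\eta}{\mu_0}\nabla^a\mathbf B^h:\nabla^a\mathbf w^h-(\mathbf B^h\otimes\mathbf w^h):\nabla\mathbf u^h-\mathbf f_m\cdot\mathbf w^h\big]$ $+\sum_e\sum_i\int_{\Gamma_{e_i}}\big[(1-\lambda)(\mathbf u^h\otimes\mathbf B^h)+\lambda(\mathbf u^h\otimes\hat{\mathbf B}^h)+\hat r^h\mathbb 1-2\frac{\eta}{\mu_0}\nabla^a\mathbf B^h+2\frac{\eta}{\mu_0}\frac{C_{\rm pen}}{h_e}\mathbf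 n\otimes(\mathbf B^h-\hat{\mathbf B}^h)\big]:(\mathbf n\otimes\mathbf w^h)$ $-\sum_e\sum_i\int_{\Gamma_{e_i}}2\frac{\eta}{\mu_0}\big(\mathbf n\otimes(\mathbf B^h-\hat{\mathbf B}^h)\big):\nabla^a\mathbf w^h=0$. (S6) for all $\hat{\mathbf w}^h\in\hat W^h_0$: $\sum_e\sum_i\int_{\Gamma_{e_i}}\big[(1-\lambda)(\mathbf u^h\otimes\mathbf B^h)+\lambda(\mathbf u^h\otimes\hat{\mathbf B}^h)+\hat r^h\mathbb 1-2\frac{\eta}{\mu_0}\nabla^a\mathbf B^h+2\frac{\eta}{\mu_0}\frac{C_{\rm pen}}{h_e}\mathbf n\otimes(\mathbf B^h-\hat{\mathbf B}^h)\big]:(\mathbf n\otimes\hat{\mathbf w}^h)$ $-\sum_e\sum_i\int_{\Gamma_{e_i}}\big(\hat{\mathbf B}^h\otimes\hat{\mathbf w}^h-\frac12(\hat{\mathbf B}^h\cdot\hat{\mathbf w}^h)\mathbb 1\big):\big(\mathbf n\otimes(\mathbf u^h-\hat{\mathbf u}^h)\big)$ $-\sum_e\sum_i\int_{\Gamma_N\cap\Gamma_{e_i}}(1-\lambda)(\mathbf u^h\otimes\hat{\mathbf B}^h):(\mathbf n\otimes\hat{\mathbf w}^h)+\sum_e\sum_i\int_{\Gamma_N\cap\Gamma_{e_i}}\mathbf h_m\cdot\hat{\mathbf w}^h=0$. (S7) for all $q^h_m\in Q^h_m$: $\sum_e\int_{\Omega_e}q^h_m\nabla\cdot\mathbf B^h=0$.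 (S8) for all $\hat q^h_m\in\hat Q^h_m$: $\sum_e\sum_i\int_{\Gamma_{e_i}}(\mathbf B^h-\hat{\mathbf B}^h)\cdot\mathbf n\,\hat q^h_m=0$. (S9) for all $\mathbf v^h\in V^h$: $\sum_e\int_{\Omega_e}(\mathbf u^h(\cdot,0)-\mathbf u_0)\cdot\mathbf v^h=0$. (S10) for all $\mathbf w^h\in W^h$: $\sum_e\int_{\Omega_e}(\mathbf B^h(\cdot,0)-\mathbf B_0)\cdot\mathbf w^h=0$.
   Formalization: The Dirichlet and Neumann parts are assumed Borel and to cover the boundary up to a surface-null set (the closure condition alone lets (S2) fail when a fat Cantor set is left out), and the outward normal of the domain is assumed to exist almost everywhere on the boundary. *)

(* Defs.v *)
From HB Require Import structures.
From mathcomp Require Import all_boot all_order all_algebra.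
From mathcomp Require Import all_classical all_reals all_analysis.

Set Implicit Arguments.
Unset Strict Implicit.
Unset Printing Implicit Defensive.

Import Order.TTheory GRing.Theory Num.Theory.
Import numFieldNormedType.Exports.

Local Open Scope classical_set_scope.
Local Open Scope ring_scope.

(* The library has the product sigma-algebra on [n.-tuple R] but no Lebesgue
   measure on it. [leb n] is the n-fold product of [lebesgue_measure], built
   by transporting [lebesgue_measure \x leb n] along (x, t) |-> x :: t. *)

Section LebesgueMeasure.
Context {R : realType}.

Definition tcons n (z : R * n.-tuple R) : n.+1.-tuple R := [tuple of z.1 :: z.2].

Lemma measurable_tcons n : measurable_fun [set: R * n.-tuple R] (@tcons n).
Proof. exact: measurable_cons. Qed.

Section succ.
Context (n : nat) (mu : {sigma_finite_measure set (n.-tuple R) -> \bar R}).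

Definition leb_succ : set (n.+1.-tuple R) -> \bar R :=
  pushforward (@lebesgue_measure R \x mu)%E (@tcons n).

Let leb_succ0 : leb_succ set0 = 0%E.
Proof. by rewrite /leb_succ /pushforward preimage_set0 measure0. Qed.

Let leb_succ_ge0 A : (0 <= leb_succ A)%E.
Proof. by rewrite /leb_succ /pushforward; exact: measure_ge0. Qed.

Let leb_succ_sigma_additive : semi_sigma_additive leb_succ.
Proof.
move=> F mF tF mUF; rewrite /leb_succ /pushforward preimage_bigcup.
have mt A : measurable A -> measurable (@tcons n @^-1` A).
  by move=> mA; rewrite -[X in measurable X]setTI; exact: measurable_tcons.
apply: measure_semi_sigma_additive.
- by move=> i; exact: mt.
- apply/trivIsetP => /= i j _ _ ij; rewrite -preimage_setI.
  by move/trivIsetP : tF => /(_ _ _ _ _ ij) ->//; rewrite preimage_set0.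
- by rewrite -preimage_bigcup; exact: mt.
Qed.

HB.instance Definition _ := isMeasure.Build _ _ _
  leb_succ leb_succ0 leb_succ_ge0 leb_succ_sigma_additive.

Let leb_succ_sigma_finite : sigma_finite setT leb_succ.
Proof.
have /sigma_finiteP[F [TF ndF Foo]] := sigma_finiteT (@lebesgue_measure R).
have /sigma_finiteP[G [TG ndG Goo]] := sigma_finiteT mu.
pose g (t : n.+1.-tuple R) := (thead t, [tuple of behead t]).
have mg : measurable_fun setT g.
  apply/measurable_fun_pair; first exact: measurable_tnth.
  exact: measurable_behead.
have gK z : g (tcons z) = z.
  case: z => x t; rewrite /g /tcons /= theadE; congr pair.
  by apply: val_inj.
exists (fun k => g @^-1` (F k `*` G k)).
  apply/seteqP; split => // t _.
  have [i _ Fi] : (\bigcup_i F i) (g t).1 by rewrite -TF.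
  have [j _ Gj] : (\bigcup_i G i) (g t).2 by rewrite -TG.
  exists (maxn i j) => //; split.
  - by move: Fi; exact/subsetPset/ndF/leq_maxl.
  - by move: Gj; exact/subsetPset/ndG/leq_maxr.
move=> k; have [mF Fk] := Foo k; have [mG Gk] := Goo k; split.
  rewrite -[X in measurable X]setTI; apply: mg => //.
  exact: measurableX.
rewrite /leb_succ /pushforward -comp_preimage.
rewrite (_ : g \o _ = id); last by apply/funext => z; exact: gK.
by rewrite preimage_id product_measure1E// lte_mul_pinfty// ge0_fin_numE.
Qed.

HB.instance Definition _ := Measure_isSigmaFinite.Build _ _ _
  leb_succ leb_succ_sigma_finite.

End succ.

Fixpoint leb (n : nat) : {sigma_finite_measure set (n.-tuple R) -> \bar R} :=
  match n with
  | 0 => @dirac _ (0.-tuple R) [tuple] R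
  | n'.+1 => leb_succ (leb n')
  end.

End LebesgueMeasure.

Section VectorCalculus.
Context {R : realType} {d : nat}.
Implicit Types (a b x n w : 'rV[R]_d) (C D : 'M[R]_d) (A : set 'rV[R]_d).

Definition vec {k : nat} (t : k.-tuple R) : 'rV[R]_k := \row_i tnth t i.

Definition vol_int A (f : 'rV[R]_d -> R) : R :=
  \int[leb d]_(t in vec @^-1` A) f (vec t).

Definition dot a b : R := \sum_i a 0 i * b 0 i.
Definition tens a b : 'M[R]_d := \matrix_(i, j) (a 0 i * b 0 j).
Definition ddot C D : R := \sum_i \sum_j C i j * D i j.

(* Euclidean norm; the library norm on ['rV_d] is the sup norm. *)
Definition enorm x : R := Num.sqrt (dot x x).
Definition diam A : R :=
  sup [set r | exists x y, [/\ A x, A y & r = enorm (x - y)]].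

Definition pd (i : 'I_d) (f : 'rV[R]_d -> R) x : R := 'D_(delta_mx 0 i) f x.
Definition sgrad (f : 'rV[R]_d -> R) x : 'rV[R]_d := \row_i pd i f x.
Definition grad (a : 'rV[R]_d -> 'rV[R]_d) x : 'M[R]_d :=
  \matrix_(i, j) pd i (fun y => a y 0 j) x.
Definition grads (a : 'rV[R]_d -> 'rV[R]_d) x : 'M[R]_d :=
  2^-1 *: (grad a x + (grad a x)^T).
Definition grada (a : 'rV[R]_d -> 'rV[R]_d) x : 'M[R]_d :=
  2^-1 *: (grad a x - (grad a x)^T).
Definition divv (a : 'rV[R]_d -> 'rV[R]_d) x : R :=
  \sum_i pd i (fun y => a y 0 i) x.
Definition divm (T : 'rV[R]_d -> 'M[R]_d) x : 'rV[R]_d :=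
  \row_j \sum_i pd i (fun y => T y i j) x.

(* Value at [x] (typically a boundary point of [A]) "from inside [A]". *)
Definition trace (V : ptopologicalType) A (f : 'rV[R]_d -> V) x : V :=
  lim (f @ within A (nbhs x)).

Definition bdry A : set 'rV[R]_d := closure A `\` interior A.

(* [n] is the outward unit normal to [A] at [x]: every ray from [x] with
   direction in the open half-space w.n < 0 starts inside [A], every ray with
   w.n > 0 starts outside. Such an [n] is unique, and there is none at edges
   and corners, nor on a slit of [A]. *)
Definition outward_normal A x n :=
  [/\ dot n n = 1,
      forall w, dot w n < 0 -> \forall t \near (0 : R)^'+, A (x + t *: w) &
      forall w, 0 < dot w n -> \forall t \near (0 : R)^'+, ~ A (x + t *: w)].

Definition normal_at A x : 'rV[R]_d := get (outward_normal A x).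

Definition domain A :=
  [/\ open A, connected A, bounded_set A & A !=set0].

(* C^1 up to the boundary: [f] and its first partial derivatives in [A] extend
   continuously to the closure of [A]. *)
Definition C1_closure (V : normedModType R) A (f : 'rV[R]_d -> V) :=
  [/\ forall x, A x -> differentiable f x,
      forall x, closure A x -> cvg (f @ within A (nbhs x)) &
      forall x (i : 'I_d), closure A x ->
        cvg ((fun y => 'D_(delta_mx 0 i) f y) @ within A (nbhs x))].

(* polynomial functions of total degree at most [k]; no exponent exceeds [k] *)
Definition polyfun (k : nat) (f : 'rV[R]_d -> R) :=
  exists c : {ffun 'I_d -> 'I_k.+1} -> R, forall x,
    f x = \sum_(m : {ffun 'I_d -> 'I_k.+1} | (\sum_i m i <= k)%N)
            c m * \prod_i x 0 i ^+ m i.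

End VectorCalculus.

(* A simplicial mesh: an element is the set of its d+1 vertex indices; the facets of an element are its subsets of d indices, so
   that a facet common to two elements is the same index set. *)

Record mesh (R : realType) (d : nat) := Mesh {
  nvtx : nat;
  vtx : 'I_nvtx -> 'rV[R]_d;
  elts : {set {set 'I_nvtx}}
}.

Arguments vtx {R d} m _.

Section Mesh.
Context {R : realType} {d : nat} (M : mesh R d).
Implicit Types K F S : {set 'I_(nvtx M)}.

(* relative interior of the convex hull of the vertices in [S] *)
Definition cell S : set 'rV[R]_d :=
  [set x | exists b : 'I_(nvtx M) -> R,
    [/\ forall i, i \in S -> 0 < b i,
        \sum_(i in S) b i = 1 &
        x = \sum_(i in S) b i *: vtx M i]].

Definition facet K F : bool := (F \subset K) && (#|F| == d).

Definition vpt S (j : nat) : 'rV[R]_d := nth 0 [seq vtx M i | i <- enum S] j.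

Definition edges S (m : nat) : 'M[R]_(m, d) :=
  \matrix_(j < m) (vpt S j.+1 - vpt S 0).

Definition refsimplex (m : nat) : set 'rV[R]_m :=
  [set s | (forall j, 0 < s 0 j) /\ \sum_j s 0 j < 1].

(* affine parametrization of the facet [F] by the reference (d-1)-simplex *)
Definition fmap F (s : 'rV[R]_d.-1) : 'rV[R]_d := vpt F 0 + s *m edges F d.-1.

(* Surface integral over [F `&` A] and surface-a.e. on [F]; the square root of
   the Gram determinant is the surface area element. *)
Definition facet_int F (A : set 'rV[R]_d) (f : 'rV[R]_d -> R) : R :=
  Num.sqrt (\det (edges F d.-1 *m (edges F d.-1)^T)) *
  \int[leb d.-1]_(t in [set t | @refsimplex d.-1 (vec t) /\ A (fmap F (vec t))])
     f (fmap F (vec t)).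

Definition ae_facet F (P : 'rV[R]_d -> Prop) :=
  {ae leb d.-1, forall t, @refsimplex d.-1 (vec t) -> P (fmap F (vec t))}.

(* surface-a.e. on the skeleton, the union of all facets *)
Definition ae_skeleton (P : 'rV[R]_d -> Prop) :=
  forall K F, K \in elts M -> facet K F -> ae_facet F P.

Definition triangulation (Omega : set 'rV[R]_d) :=
  [/\ injective (vtx M),
      forall K, K \in elts M -> #|K| = d.+1 /\ \det (edges K d) != 0,
      (forall K, K \in elts M -> cell K `<=` Omega) /\
      (forall K K', K \in elts M -> K' \in elts M -> K != K' ->
        cell K `&` cell K' = set0),
      closure Omega = closure (\bigcup_(K in [set K | K \in elts M]) cell K) &
      forall K F, K \in elts M -> facet K F -> ~ (cell F `<=` bdry Omega) ->
        #|[pred K' in elts M | F \subset K']| = 2].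

(* Functions are taken as pointwise representatives: only the values on the
   open elements, resp. open facets, are constrained (and ever integrated). *)
Definition Vh (k : nat) (v : 'rV[R]_d -> 'rV[R]_d) :=
  forall K (j : 'I_d), K \in elts M ->
    exists2 q, polyfun k q & forall x, cell K x -> v x 0 j = q x.
Definition Qh (k : nat) (q : 'rV[R]_d -> R) :=
  forall K, K \in elts M ->
    exists2 q', polyfun k.-1 q' & forall x, cell K x -> q x = q' x.
Definition Vhhat (k : nat) (v : 'rV[R]_d -> 'rV[R]_d) :=
  forall K F (j : 'I_d), K \in elts M -> facet K F ->
    exists2 q, polyfun k q & forall x, cell F x -> v x 0 j = q x.
Definition Qhhat (k : nat) (q : 'rV[R]_d -> R) :=
  forall K F, K \in elts M -> facet K F ->
    exists2 q', polyfun k q' & forall x, cell F x -> q x = q' x.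
Definition Vhhat0 (k : nat) (GammaD : set 'rV[R]_d) v :=
  Vhhat k v /\ ae_skeleton (fun x => GammaD x -> v x = 0).

Definition sum_vol (f : 'rV[R]_d -> R) : R :=
  \sum_(K in elts M) vol_int (cell K) f.
(* The integrand may depend on the element [K] the facet is seen from. *)
Definition sum_facets (A : set 'rV[R]_d)
    (f : {set 'I_(nvtx M)} -> 'rV[R]_d -> R) : R :=
  \sum_(K in elts M) \sum_(F | facet K F) facet_int F A (f K).

End Mesh.

Arguments cell {R d} M S _.
Arguments sum_facets {R d} M A f.

(* Fields take a point, then a time. All functions are total; only their values
   on the sets where they are meaningful are used. *)
Record mhd_data (R : realType) (d : nat) := MhdData {
  Omega : set 'rV[R]_d;
  GammaD : set 'rV[R]_d;
  GammaN : set 'rV[R]_d;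
  rho : R;
  mu0 : R;
  nu : 'rV[R]_d -> R -> R;
  eta : 'rV[R]_d -> R -> R;
  fv : 'rV[R]_d -> R -> 'rV[R]_d;
  fm : 'rV[R]_d -> R -> 'rV[R]_d;
  gv : 'rV[R]_d -> R -> 'rV[R]_d;
  gm : 'rV[R]_d -> R -> 'rV[R]_d;
  hv : 'rV[R]_d -> R -> 'rV[R]_d;
  hm : 'rV[R]_d -> R -> 'rV[R]_d;
  u0 : 'rV[R]_d -> 'rV[R]_d;
  B0 : 'rV[R]_d -> 'rV[R]_d
}.

Definition admissible_data (R : realType) (d : nat) (D : mhd_data R d) :=
  [/\ domain (Omega D),
      bdry (Omega D) = closure (GammaD D `|` GammaN D) /\
        GammaD D `&` GammaN D = set0,
      0 < rho D /\ 0 < mu0 D,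
      (forall x t, Omega D x -> 0 < t -> 0 < nu D x t) &
      (forall x t, Omega D x -> 0 < t -> 0 < eta D x t)].

(* Regularity of the boundary relative to surface measure, which is carried by
   the facets of [M]: the outward unit normal to [Omega] exists a.e. on the
   boundary, Gamma_D and Gamma_N are Borel and cover it up to a null set. *)
Definition admissible_boundary (R : realType) (d : nat)
    (D : mhd_data R d) (M : mesh R d) :=
  [/\ measurable (@vec R d @^-1` GammaD D),
      measurable (@vec R d @^-1` GammaN D),
      ae_skeleton M (fun x => bdry (Omega D) x -> GammaD D x \/ GammaN D x) &
      ae_skeleton M (fun x => bdry (Omega D) x ->
        exists n, outward_normal (Omega D) x n)].

Section MHD.
Context {R : realType} {d : nat} (D : mhd_data R d).
Implicit Types (x n : 'rV[R]_d) (t : R).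
Local Notation Om := (Omega D).

Definition Maxwell (b : 'rV[R]_d) : 'M[R]_d :=
  (rho D * mu0 D)^-1 *: (tens b b - (2^-1 * dot b b)%:M).

Definition visc (u : 'rV[R]_d -> R -> 'rV[R]_d) x t : 'M[R]_d :=
  (2 * nu D x t) *: grads (u ^~ t) x.
Definition resist (B : 'rV[R]_d -> R -> 'rV[R]_d) x t : 'M[R]_d :=
  (2 * (eta D x t / mu0 D)) *: grada (B ^~ t) x.

(* Gradients and pressures on Gamma_N are traces from Omega. *)
Record strong_form (u : 'rV[R]_d -> R -> 'rV[R]_d) (p : 'rV[R]_d -> R -> R)
    (B : 'rV[R]_d -> R -> 'rV[R]_d) (r : 'rV[R]_d -> R -> R) : Prop := {
  E1 : forall x t, Om x -> 0 < t ->
    derive1 (u x) t + divm (fun y => tens (u y t) (u y t)) x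
    + (rho D)^-1 *: sgrad (p ^~ t) x - divm (visc u ^~ t) x
    - divm (fun y => Maxwell (B y t)) x = fv D x t;
  E2 : forall x t, Om x -> 0 < t -> divv (u ^~ t) x = 0;
  E3 : forall x t, Om x -> 0 < t ->
    derive1 (B x) t + divm (fun y => tens (u y t) (B y t)) x
    - divm (fun y => tens (B y t) (u y t)) x - divm (resist B ^~ t) x
    + sgrad (r ^~ t) x = fm D x t;
  E4 : forall x t, Om x -> 0 < t -> divv (B ^~ t) x = 0;
  E5 : forall x t, GammaD D x -> 0 < t -> u x t = gv D x t;
  E6 : forall x t n, GammaN D x -> 0 < t -> outward_normal Om x n ->
    n *m (- ((rho D)^-1 * trace Om (p ^~ t) x)%:M + trace Om (visc u ^~ t) x
          + Maxwell (B x t))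
    - Num.min (dot (u x t) n) 0 *: u x t = hv D x t;
  E7 : forall x t, GammaD D x -> 0 < t -> B x t = gm D x t;
  E8 : forall x t n, GammaN D x -> 0 < t -> outward_normal Om x n ->
    n *m (- (trace Om (r ^~ t) x)%:M + trace Om (resist B ^~ t) x)
    - Num.min (dot (u x t) n) 0 *: B x t = hm D x t;
  E9 : forall x, Om x -> u x 0 = u0 D x;
  E10 : forall x, Om x -> B x 0 = B0 D x
}.

(* Smoothness needed for the strong form to hold classically up to the
   boundary; the viscous and resistive fluxes are C^1 e.g. when u, B are C^2
   and nu, eta are C^1 up to the boundary. *)
Record smooth_solution (u : 'rV[R]_d -> R -> 'rV[R]_d) (p : 'rV[R]_d -> R -> R)
    (B : 'rV[R]_d -> R -> 'rV[R]_d) (r : 'rV[R]_d -> R -> R) : Prop := {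
  u_derivable : forall x t, Om x -> 0 < t -> derivable (u x) t 1;
  B_derivable : forall x t, Om x -> 0 < t -> derivable (B x) t 1;
  u_continuous : forall t, 0 < t -> {within closure Om, continuous (u ^~ t)};
  B_continuous : forall t, 0 < t -> {within closure Om, continuous (B ^~ t)};
  u_C1 : forall t, 0 < t -> C1_closure Om (u ^~ t);
  B_C1 : forall t, 0 < t -> C1_closure Om (B ^~ t);
  p_C1 : forall t, 0 < t -> C1_closure Om (p ^~ t);
  r_C1 : forall t, 0 < t -> C1_closure Om (r ^~ t);
  visc_C1 : forall t, 0 < t -> C1_closure Om (visc u ^~ t);
  resist_C1 : forall t, 0 < t -> C1_closure Om (resist B ^~ t)
}.

End MHD.

(* Suffix [h]: element fields; suffix [t]: facet (hatted) fields. *)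
Record hdg_fields (R : realType) (d : nat) := HdgFields {
  uh : 'rV[R]_d -> R -> 'rV[R]_d;
  ut : 'rV[R]_d -> R -> 'rV[R]_d;
  ph : 'rV[R]_d -> R -> R;
  pt : 'rV[R]_d -> R -> R;
  Bh : 'rV[R]_d -> R -> 'rV[R]_d;
  Bt : 'rV[R]_d -> R -> 'rV[R]_d;
  rh : 'rV[R]_d -> R -> R;
  rt : 'rV[R]_d -> R -> R
}.

Section HDG.
Context {R : realType} {d : nat} (D : mhd_data R d) (M : mesh R d).
Context (Cpen : R) (k : nat) (X : hdg_fields R d).
Implicit Types (K : {set 'I_(nvtx M)}) (x : 'rV[R]_d) (t : R).

(* element fields on a facet are evaluated from inside the element [K] *)
Local Notation tr K := (trace (cell M K)).
Local Notation n_ K x := (normal_at (cell M K) x).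
Local Notation h_ K := (diam (cell M K)).
Local Notation u_ K x t := (tr K (uh X ^~ t) x).
Local Notation B_ K x t := (tr K (Bh X ^~ t) x).

Definition inflow K x t : R := if dot (u_ K x t) (n_ K x) < 0 then 1 else 0.

Definition flux_v K x t : 'M[R]_d :=
  (1 - inflow K x t) *: tens (u_ K x t) (u_ K x t)
  + inflow K x t *: tens (u_ K x t) (ut X x t)
  + ((rho D)^-1 * pt X x t)%:M
  - tr K (visc D (uh X) ^~ t) x
  + (2 * (Cpen / h_ K) * tr K (nu D ^~ t) x)
      *: tens (n_ K x) (u_ K x t - ut X x t)
  - Maxwell D (Bt X x t).

Definition flux_m K x t : 'M[R]_d :=
  (1 - inflow K x t) *: tens (u_ K x t) (B_ K x t)
  + inflow K x t *: tens (u_ K x t) (Bt X x t)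
  + (rt X x t)%:M
  - tr K (resist D (Bh X) ^~ t) x
  + (2 * (tr K (eta D ^~ t) x / mu0 D) * (Cpen / h_ K))
      *: tens (n_ K x) (B_ K x t - Bt X x t).

Definition S1 t := forall v, Vh M k v ->
  sum_vol M (fun x =>
    dot (derive1 (uh X x) t) (v x)
    - ddot (tens (uh X x t) (uh X x t)) (grad v x)
    - ddot ((rho D)^-1 * ph X x t)%:M (grad v x)
    + ddot (visc D (uh X) x t) (grads v x)
    + ddot (Maxwell D (Bh X x t)) (grad v x)
    - dot (fv D x t) (v x))
  + sum_facets M setT (fun K x =>
      ddot (flux_v K x t) (tens (n_ K x) (tr K v x)))
  - sum_facets M setT (fun K x =>
      ddot ((2 * tr K (nu D ^~ t) x) *: tens (n_ K x) (u_ K x t - ut X x t))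
           (tr K (grads v) x)) = 0.

Definition S2 t := forall vt, Vhhat0 M k (GammaD D) vt ->
  sum_facets M setT (fun K x =>
    ddot (flux_v K x t) (tens (n_ K x) (vt x)))
  - sum_facets M (GammaN D) (fun K x =>
      (1 - inflow K x t)
      * ddot (tens (u_ K x t) (ut X x t)) (tens (n_ K x) (vt x)))
  + sum_facets M (GammaN D) (fun=> fun x => dot (hv D x t) (vt x)) = 0.

Definition S3 t := forall q, Qh M k q ->
  sum_vol M (fun x => (rho D)^-1 * divv (uh X ^~ t) x * q x) = 0.

Definition S4 t := forall q, Qhhat M k q ->
  sum_facets M setT (fun K x =>
    (rho D)^-1 * dot (u_ K x t - ut X x t) (n_ K x) * q x) = 0.

Definition S5 t := forall w, Vh M k w ->
  sum_vol M (fun x =>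
    dot (derive1 (Bh X x) t) (w x)
    - ddot (tens (uh X x t) (Bh X x t)) (grad w x)
    - ddot (rh X x t)%:M (grad w x)
    + ddot (resist D (Bh X) x t) (grada w x)
    - ddot (tens (Bh X x t) (w x)) (grad (uh X ^~ t) x)
    - dot (fm D x t) (w x))
  + sum_facets M setT (fun K x =>
      ddot (flux_m K x t) (tens (n_ K x) (tr K w x)))
  - sum_facets M setT (fun K x =>
      ddot ((2 * (tr K (eta D ^~ t) x / mu0 D))
              *: tens (n_ K x) (B_ K x t - Bt X x t))
           (tr K (grada w) x)) = 0.

Definition S6 t := forall wt, Vhhat0 M k (GammaD D) wt ->
  sum_facets M setT (fun K x =>
    ddot (flux_m K x t) (tens (n_ K x) (wt x)))
  - sum_facets M setT (fun K x =>
      ddot (tens (Bt X x t) (wt x) - (2^-1 * dot (Bt X x t) (wt x))%:M)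
           (tens (n_ K x) (u_ K x t - ut X x t)))
  - sum_facets M (GammaN D) (fun K x =>
      (1 - inflow K x t)
      * ddot (tens (u_ K x t) (Bt X x t)) (tens (n_ K x) (wt x)))
  + sum_facets M (GammaN D) (fun=> fun x => dot (hm D x t) (wt x)) = 0.

Definition S7 t := forall q, Qh M k q ->
  sum_vol M (fun x => q x * divv (Bh X ^~ t) x) = 0.

Definition S8 t := forall q, Qhhat M k q ->
  sum_facets M setT (fun K x => dot (B_ K x t - Bt X x t) (n_ K x) * q x) = 0.

Definition S9 := forall v, Vh M k v ->
  sum_vol M (fun x => dot (uh X x 0 - u0 D x) (v x)) = 0.

Definition S10 := forall w, Vh M k w ->
  sum_vol M (fun x => dot (Bh X x 0 - B0 D x) (w x)) = 0.

Definition hdg_equations : Prop :=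
  (forall t, 0 < t ->
     [/\ S1 t, S2 t, S3 t & S4 t] /\ [/\ S5 t, S6 t, S7 t & S8 t]) /\
  (S9 /\ S10).

End HDG.

(* The facet pressures are the traces of p, r from Omega (p, r live in Omega);
   u, B are defined up to the boundary and restrict to the facets. *)
Definition exact_fields (R : realType) (d : nat) (D : mhd_data R d)
    (u : 'rV[R]_d -> R -> 'rV[R]_d) (p : 'rV[R]_d -> R -> R)
    (B : 'rV[R]_d -> R -> 'rV[R]_d) (r : 'rV[R]_d -> R -> R) : hdg_fields R d :=
  {| uh := u; ut := u;
     ph := p; pt := fun x t => trace (Omega D) (p ^~ t) x;
     Bh := B; Bt := B;
     rh := r; rt := fun x t => trace (Omega D) (r ^~ t) x |}.

(* Main.v *)
(** On each simplex K, the exact solution turns (S1) and (S5) into the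
    divergence formula for the C^1 fluxes of the momentum and induction
    equations, contracted with polynomial test functions: the penalty and
    symmetrization terms vanish because u and B have no jumps, and the inflow
    weights 1 - lambda and lambda add up to 1. In (S2) and (S6) an interior
    facet is seen from two elements with opposite normals, so its two
    contributions cancel, while boundary facets are handled almost everywhere
    by (E6), (E8) and the identity max(a, 0) = a - min(a, 0).

    The divergence formula on a simplex is obtained direction by direction: for
    an edge direction a - b, the fundamental theorem of calculus along the
    segments parallel to the edge, Fubini in barycentric coordinates, and a Gram
    determinant give the two facets opposite to a and b; all other facets are
    parallel to a - b. The edges at a vertex span all directions. *)

(* Three obstacles shape the development. The integrals refer to arbitrary choices: [leb] is an
   iterated product, and [edges] and [fmap] use whatever order [enum] gives the vertices. Once [leb]
   is known to scale by the absolute value of the determinant under linear maps, integrals over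
   cells and facets no longer depend on that order, and any edge can be placed at the vertices 0 and
   1. Next, the fields are differentiable only in the open domain and reach the facets as limits.
   Facet integrands are therefore treated as traces, and [bcont], continuity together with a bound
   on an open simplex, is the class in which linearity and Fubini are justified. Finally, the
   Neumann data are arbitrary functions, tied to the solution only where an outward normal of the
   domain exists. Their integrals are evaluated by replacing them, almost everywhere, with
   continuous expressions. The normals also settle the facets shared by two elements that touch the
   boundary: no outward normal exists there, so Gamma_N meets such a facet in a null set. *)
Require Import Defs.
From mathcomp Require Import all_boot all_order all_algebra.
From mathcomp Require Import all_classical all_reals all_analysis.
From mathcomp Require Import perm measurable_realfun ring lra.

Set Implicit Arguments.
Unset Strict Implicit.
Unset Printing Implicit Defensive.
Import Order.TTheory GRing.Theory Num.Theory.
Import numFieldNormedType.Exports.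
Local Open Scope classical_set_scope.
Local Open Scope ring_scope.

(** * Lebesgue measure under linear maps *)

Section LinearChange.
Context {R : realType}.
Implicit Types (n : nat).
Local Notation mu := (@lebesgue_measure R).

(** The left side is a scaled pushforward of [mu], so uniqueness of Lebesgue measure reduces the
    claim to half-open intervals. A negative [a] exchanges the closed and the open end, hence the
    two cases. *)
Lemma lebesgue_measure_affine (a c : R) (A : set R) : a != 0 -> measurable A ->
  (`|a|%:E * mu ((fun x => (a * x + c)%R) @^-1` A) = mu A)%E.
Proof.
move=> a0 mA.
pose phi : measurableTypeR R -> measurableTypeR R := fun x => a * x + c.
have mphi : measurable_fun [set: measurableTypeR R] phi.
  by apply: measurable_funD => //; exact: mulrl_measurable.
pose m : {measure set (measurableTypeR R) -> \bar R} :=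
  mscale (NngNum (normr_ge0 a)) (pushforward mu phi).
rewrite [RHS](@lebesgue_measure_unique R (m mphi))//.
move=> _ [[p q] _ <-].
rewrite lebesgue_measure_itv/= lte_fin.
transitivity (`|a|%:E * mu (phi @^-1` `]p, q]))%E; last by [].
have [a1|a1|a1] := ltgtP a 0; last by rewrite a1 eqxx in a0.
- have -> : phi @^-1` `]p, q] = `[(q - c) / a, (p - c) / a[%classic.
    apply/seteqP; split=> x /=; rewrite !in_itv/= /phi => /andP[h1 h2].
      rewrite ler_ndivrMr// ltr_ndivlMr// mulrC; apply/andP; split; lra.
    move: h1 h2; rewrite ler_ndivrMr// ltr_ndivlMr// => h1 h2.
    by rewrite [a * x]mulrC; apply/andP; split; lra.
  rewrite lebesgue_measure_itv/= lte_fin ltr_nM2r ?invr_lt0// ltrD2r.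
  case: ifP => _; last by rewrite mule0.
  by rewrite -!EFinD -EFinM ltr0_norm//; congr EFin; field.
- have -> : phi @^-1` `]p, q] = `](p - c) / a, (q - c) / a]%classic.
    apply/seteqP; split=> x /=; rewrite !in_itv/= /phi => /andP[h1 h2].
      rewrite ltr_pdivrMr// ler_pdivlMr// mulrC; apply/andP; split; lra.
    move: h1 h2; rewrite ltr_pdivrMr// ler_pdivlMr// => h1 h2.
    by rewrite [a * x]mulrC; apply/andP; split; lra.
  rewrite lebesgue_measure_itv/= lte_fin ltr_pM2r ?invr_gt0// ltrD2r.
  case: ifP => _; last by rewrite mule0.
  by rewrite -!EFinD -EFinM gtr0_norm//; congr EFin; field.
Qed.

Lemma integral_affine (a c : R) (f : R -> \bar R) : a != 0 ->
  measurable_fun [set: measurableTypeR R] f -> (forall x, 0 <= f x)%E ->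
  (`|a|%:E * \int[mu]_x f (a * x + c)%R = \int[mu]_x f x)%E.
Proof.
move=> a0 mf f0.
pose phi : measurableTypeR R -> measurableTypeR R := fun x => a * x + c.
have mphi : measurable_fun [set: measurableTypeR R] phi.
  by apply: measurable_funD => //; exact: mulrl_measurable.
pose m : {measure set (measurableTypeR R) -> \bar R} :=
  mscale (NngNum (normr_ge0 a)) (pushforward mu phi).
transitivity (\int[m mphi]_x f x)%E.
  rewrite ge0_integral_mscale//= ge0_integral_pushforward//.
apply: eq_measure_integral => A mA _.
by rewrite -[RHS](lebesgue_measure_affine c a0 mA).
Qed.

Definition tup n (v : 'rV[R]_n) : n.-tuple R := [tuple v 0 i | i < n].

Lemma tupK n : cancel (@tup n) vec.
Proof. by move=> v; apply/rowP => i; rewrite mxE tnth_mktuple. Qed.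

Lemma measurable_affine m n (E : 'M[R]_(m, n)) (b : 'rV[R]_n) :
  measurable_fun [set: m.-tuple R] (fun t => tup (vec t *m E + b)).
Proof.
apply/measurable_fun_tnthP => i.
rewrite (_ : _ \o _ = fun t : m.-tuple R =>
    \sum_k tnth t k * E k i + b 0 i); last first.
  apply/funext => t /=; rewrite tnth_mktuple !mxE; congr (_ + _).
  by apply: eq_bigr => k _; rewrite mxE.
apply: measurable_funD => //; apply: measurable_sum => k.
by apply: measurable_funM => //; exact: measurable_tnth.
Qed.

(* Measurability of functions of row vectors refers to the product
   sigma-algebra of tuples. *)
Definition vmeas d' (T : measurableType d') n (f : 'rV[R]_n -> T) :=
  measurable_fun [set: n.-tuple R] (f \o vec).

Lemma vmeas_affine d' (T : measurableType d') m n (f : 'rV[R]_n -> T)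
    (E : 'M[R]_(m, n)) (b : 'rV[R]_n) :
  vmeas f -> vmeas (fun v => f (v *m E + b)).
Proof.
move=> mf; rewrite /vmeas.
rewrite (_ : _ \o _ = (f \o vec) \o (fun t => tup (vec t *m E + b))).
  by apply: measurableT_comp => //; exact: measurable_affine.
by apply/funext => t /=; rewrite tupK.
Qed.

(** A [row_mx] of widths 1 and n, so that products with a matrix of size [1 + n] follow the block
    rules, as in [vcons_block]. *)
Definition vcons n (x : R) (v : 'rV[R]_n) : 'rV[R]_n.+1 := row_mx (x%:M : 'rV[R]_1) v.

Lemma vec_tcons n (z : R * n.-tuple R) : vec (tcons z) = vcons z.1 (vec z.2).
Proof.
case: z => x t; apply/rowP => i; rewrite !mxE.
case: splitP => j /= ij.
  rewrite ord1 in ij *; rewrite mxE eqxx mulr1n.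
  by rewrite (_ : i = ord0) ?tnth0//; apply/val_inj.
by rewrite mxE (_ : i = lift ord0 j) ?tnthS//; apply/val_inj; exact: ij.
Qed.

Lemma vmeas_vcons n (f : 'rV[R]_n.+1 -> \bar R) : vmeas f ->
  measurable_fun [set: R * n.-tuple R] (fun z => f (vcons z.1 (vec z.2))).
Proof.
move=> mf; rewrite (_ : (fun _ => _) = (f \o vec) \o @tcons R n).
  by apply: measurableT_comp => //; exact: measurable_tcons.
by apply/funext => z /=; rewrite vec_tcons.
Qed.

Lemma leb_succE n (f : 'rV[R]_n.+1 -> \bar R) : vmeas f ->
  (forall v, 0 <= f v)%E ->
  (\int[leb n.+1]_t f (vec t) =
   \int[mu \x leb n]_z f (vcons z.1 (vec z.2)))%E.
Proof.
move=> mf f0; rewrite /= /leb_succ.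
transitivity (\int[pushforward (mu \x leb n)%E (@tcons R n)]_t (f (vec t)))%E.
  by [].
rewrite ge0_integral_pushforward//=; last exact: measurable_tcons.
by apply: eq_integral => z _; rewrite vec_tcons.
Qed.

(** Both orders of Tonelli are needed below: a shear translates one block by an amount that depends
    on the other, and the translated block has to be the inner variable. *)
Lemma leb_succ1 n (f : 'rV[R]_n.+1 -> \bar R) : vmeas f ->
  (forall v, 0 <= f v)%E ->
  (\int[leb n.+1]_t f (vec t) =
   \int[mu]_x \int[leb n]_t f (vcons x (vec t)))%E.
Proof.
move=> mf f0; rewrite leb_succE//.
by rewrite (fubini_tonelli1 (m1 := mu) (m2 := leb n) _ (vmeas_vcons mf)).
Qed.

Lemma leb_succ2 n (f : 'rV[R]_n.+1 -> \bar R) : vmeas f ->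
  (forall v, 0 <= f v)%E ->
  (\int[leb n.+1]_t f (vec t) =
   \int[leb n]_t \int[mu]_x f (vcons x (vec t)))%E.
Proof.
move=> mf f0; rewrite leb_succE//.
by rewrite (fubini_tonelli2 (m1 := mu) (m2 := leb n) _ (vmeas_vcons mf)).
Qed.

Lemma vmeas_vcons1 n (f : 'rV[R]_n.+1 -> \bar R) x : vmeas f ->
  vmeas (fun v => f (vcons x v)).
Proof.
move=> /vmeas_vcons mf.
exact: (measurableT_comp mf (pair1_measurable x)).
Qed.

Lemma vmeas_vcons2 n (f : 'rV[R]_n.+1 -> \bar R) v : vmeas f ->
  measurable_fun [set: measurableTypeR R] (fun x => f (vcons x v)).
Proof.
move=> /vmeas_vcons mf.
have := measurableT_comp mf (pair2_measurable (tup v)).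
by rewrite /comp/= tupK.
Qed.

Lemma vcons_surj n (b : 'rV[R]_n.+1) : exists x v, b = vcons x v.
Proof.
exists (b 0 0), (rsubmx (b : 'rV_(1 + n))).
rewrite /vcons -[LHS](@hsubmxK _ _ 1 n) (_ : lsubmx _ = (b 0 0)%:M) //.
apply/rowP => i; rewrite ord1 !mxE eqxx mulr1n; congr (b _ _).
exact: val_inj.
Qed.

Lemma vconsD n x y (v w : 'rV[R]_n) :
  vcons x v + vcons y w = vcons (x + y) (v + w).
Proof. by rewrite /vcons [LHS](@add_row_mx _ 1 1 n) -(raddfD (@scalar_mx R 1)). Qed.

Lemma vcons_block n x (v : 'rV[R]_n) a b c (E : 'M[R]_n) :
  vcons x v *m (block_mx a%:M b c E : 'M[R]_(1 + n)) =
  vcons (x * a + (v *m c) 0 0) (x *: b + v *m E).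
Proof.
rewrite /vcons [LHS](@mul_row_block _ 1 1 n 1 n) -scalar_mxM mul_scalar_mx.
by rewrite [v *m c]mx11_scalar -(raddfD (@scalar_mx R 1)) [in RHS]mxE eqxx.
Qed.

Lemma leb_translate n (f : 'rV[R]_n -> \bar R) b : vmeas f ->
  (forall v, 0 <= f v)%E ->
  (\int[leb n]_t f (vec t + b)%R = \int[leb n]_t f (vec t))%E.
Proof.
elim: n f b => [|n IH] f b mf f0.
  by apply: eq_integral => t _; rewrite [b]thinmx0 addr0.
have mfb c : vmeas (fun v => f (v + c)).
  by have := vmeas_affine 1%:M c mf; under eq_fun do rewrite mulmx1.
rewrite (leb_succ1 (mfb b) (fun v => f0 (v + b))) (leb_succ1 mf f0).
have [y [w ->]] := vcons_surj b.
transitivity (\int[mu]_x \int[leb n]_t f (vcons (x + y)%R (vec t)))%E.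
  apply: eq_integral => x _; under eq_integral do rewrite vconsD.
  by rewrite (IH (fun v => f (vcons (x + y) v)))//; exact: vmeas_vcons1.
have mg : measurable_fun [set: measurableTypeR R]
    (fun x => \int[leb n]_t f (vcons x (vec t)))%E.
  exact: (measurable_fun_fubini_tonelli_F (m2 := leb n) _ (vmeas_vcons mf)).
have := @integral_affine 1 y _ (oner_neq0 _) mg.
rewrite normr1 mul1e => <-.
  by apply: eq_integral => x _; rewrite mul1r.
by move=> x; apply: integral_ge0.
Qed.

Lemma vmeas_lin m n (E : 'M[R]_(m, n)) (f : 'rV[R]_n -> \bar R) :
  vmeas f -> vmeas (fun v => f (v *m E)).
Proof. by move=> /(vmeas_affine E 0); under eq_fun do rewrite addr0. Qed.

(** Restricted to nonnegative functions, so that Tonelli applies without integrability. As a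
    property of [E] it is multiplicative, which reduces it to the factors of an elimination. *)
Definition det_scaling n (E : 'M[R]_n) := forall f : 'rV[R]_n -> \bar R, vmeas f ->
  (forall v, 0 <= f v)%E ->
  (`|\det E|%:E * \int[leb n]_t f (vec t *m E)%R = \int[leb n]_t f (vec t))%E.

Lemma det_scaling_mul n (E E' : 'M[R]_n) :
  det_scaling E -> det_scaling E' -> det_scaling (E *m E').
Proof.
move=> hE hE' f mf f0; rewrite -hE'//.
rewrite -(hE (fun v => f (v *m E')))//; last exact: vmeas_lin.
rewrite det_mulmx normrM mulrC EFinM muleA; congr (_ * _)%E.
by apply: eq_integral => t _; rewrite mulmxA.
Qed.

Lemma det_scaling_lshear n (c : 'cV[R]_n) :
  det_scaling (block_mx 1%:M 0 c 1%:M : 'M[R]_(1 + n)).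
Proof.
move=> f mf f0; rewrite det_lblock !det1 mulr1 normr1 mul1e.
rewrite (leb_succ2 (vmeas_lin _ mf) (fun v => f0 (v *m _))) (leb_succ2 mf f0).
apply: eq_integral => t _.
under eq_integral do rewrite vcons_block scaler0 add0r mulmx1.
have := @integral_affine 1 ((vec t *m c) 0 0) _ (oner_neq0 _)
  (vmeas_vcons2 (vec t) mf).
rewrite normr1 mul1e => <-//.
by apply: eq_integral => x _; rewrite mul1r mulr1.
Qed.

Lemma det_scaling_ushear n (b : 'rV[R]_n) :
  det_scaling (block_mx 1%:M b 0 1%:M : 'M[R]_(1 + n)).
Proof.
move=> f mf f0; rewrite det_ublock !det1 mulr1 normr1 mul1e.
rewrite (leb_succ1 (vmeas_lin _ mf) (fun v => f0 (v *m _))) (leb_succ1 mf f0).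
apply: eq_integral => x _.
under eq_integral do rewrite vcons_block mulmx0 mxE addr0 mulmx1 addrC mulr1.
by rewrite (leb_translate (f := fun v => f (vcons x v)))//; exact: vmeas_vcons1.
Qed.

Lemma det_scaling_diag n (a : R) (E : 'M[R]_n) : a != 0 -> det_scaling E ->
  det_scaling (block_mx a%:M 0 0 E : 'M[R]_(1 + n)).
Proof.
move=> a0 hE f mf f0; rewrite det_lblock det_scalar1 normrM.
rewrite (leb_succ2 (vmeas_lin _ mf) (fun v => f0 (v *m _))) (leb_succ2 mf f0).
have mg : vmeas (fun v => \int[mu]_x f (vcons x v))%E.
  exact: (measurable_fun_fubini_tonelli_G (m1 := mu) _ (vmeas_vcons mf)).
have g0 v : (0 <= \int[mu]_x f (vcons x v))%E by apply: integral_ge0.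
rewrite -(hE (fun v => \int[mu]_x f (vcons x v))%E mg g0) mulrC EFinM -muleA.
congr (_ * _)%E.
rewrite -ge0_integralZl//; first last.
- by move=> t _; apply: integral_ge0.
- have := vmeas_lin (block_mx a%:M 0 0 E : 'M[R]_(1 + n)) mf => /vmeas_vcons mf'.
  exact: (measurable_fun_fubini_tonelli_G (m1 := mu) _ mf').
apply: eq_integral => t _.
under eq_integral do rewrite vcons_block mulmx0 mxE addr0 scaler0 add0r.
rewrite -(integral_affine 0 a0)//; last exact: vmeas_vcons2.
congr (_ * _)%E.
by apply: eq_integral => x _; rewrite addr0 mulrC.
Qed.

(** Gaussian elimination: with a nonzero pivot, the matrix is a lower shear times a block diagonal
    matrix times an upper shear. The lower diagonal block is the Schur complement
    [D - a^-1 *: (c *m b)], to which the induction hypothesis applies. *)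
Lemma det_scaling_unit n (E : 'M[R]_n) : \det E != 0 -> det_scaling E.
Proof.
elim: n E => [|n IH] E dE.
  move=> f mf f0; rewrite det_mx00 normr1 mul1e.
  by apply: eq_integral => t _; congr f; apply/rowP => -[].
have pivot (a : R) b c (D : 'M[R]_n) : a != 0 ->
    \det (block_mx a%:M b c D : 'M[R]_(1 + n)) != 0 ->
    det_scaling (block_mx a%:M b c D : 'M[R]_(1 + n)).
  move=> a0.
  have -> : block_mx a%:M b c D =
      block_mx 1%:M 0 (a^-1 *: c) 1%:M *m
      (block_mx a%:M 0 0 (D - a^-1 *: (c *m b)) *m
       block_mx 1%:M (a^-1 *: b) 0 1%:M) :> 'M[R]_(1 + n).
    rewrite !mulmx_block !(mul1mx, mulmx1, mul0mx, mulmx0, addr0, add0r).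
    rewrite mul_scalar_mx scalerA divff// scale1r mul_mx_scalar scalerA divff//.
    by rewrite scale1r -scalemxAl addrC subrK.
  rewrite !det_mulmx !det_lblock det_ublock !det1 !(mulr1, mul1r) det_scalar1.
  rewrite mulf_eq0 negb_or => /andP[_ hD].
  apply: det_scaling_mul; first exact: det_scaling_lshear.
  apply: det_scaling_mul; last exact: det_scaling_ushear.
  by apply: det_scaling_diag => //; exact: IH.
set E1 : 'M[R]_(1 + n) := E.
have EE : E1 = block_mx (E1 0 0)%:M (ursubmx E1) (dlsubmx E1) (drsubmx E1).
  rewrite -[LHS]submxK; congr block_mx.
  apply/matrixP => i j; rewrite !ord1 !mxE eqxx mulr1n.
  by congr (E1 _ _); apply: val_inj.
have [E00|E00] := eqVneq (E1 0 0) 0.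
  2: by have := pivot _ (ursubmx E1) (dlsubmx E1) (drsubmx E1) E00;
        rewrite -EE; exact.
(* If the rest of the first row vanished together with the pivot, the determinant would be zero. *)
have [j Ej] : exists j, ursubmx E1 0 j != 0.
  apply: contrapT => h; case/eqP: dE.
  rewrite (_ : \det E = \det E1)// EE E00.
  rewrite (_ : ursubmx E1 = 0); first by rewrite det_lblock det_scalar1 mul0r.
  apply/rowP => j; rewrite [RHS]mxE; apply: contrapT => /eqP Ej.
  by apply: h; exists j.
(* A zero pivot is made nonzero by adding column j to the first column. *)
pose S : 'M[R]_(1 + n) := block_mx 1%:M 0 (delta_mx j 0) 1%:M.
pose S' : 'M[R]_(1 + n) := block_mx 1%:M 0 (- delta_mx j 0) 1%:M.
have SS' : S *m S' = 1%:M.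
  rewrite /S /S' mulmx_block !(mul1mx, mulmx1, mul0mx, mulmx0, addr0, add0r).
  by rewrite subrr -scalar_mx_block.
suff: det_scaling (E1 *m S *m S') by rewrite -mulmxA SS' mulmx1.
apply: det_scaling_mul; last exact: det_scaling_lshear.
have dES : \det (E1 *m S) != 0.
  by rewrite det_mulmx det_lblock !det1 !mulr1.
move: dES; rewrite {1 2}EE /S mulmx_block E00 raddf0.
rewrite !(mul1mx, mulmx1, mul0mx, mulmx0, addr0, add0r).
rewrite [ursubmx _ *m _]mx11_scalar => dES; apply: pivot => //.
rewrite mxE (bigD1 j)//= big1; last by move=> i /negPf ij; rewrite !mxE ij mulr0.
by rewrite [delta_mx _ _ _ _]mxE !eqxx mulr1 addr0.
Qed.

Theorem leb_affine n (E : 'M[R]_n) b (f : 'rV[R]_n -> \bar R) : \det E != 0 ->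
  vmeas f -> (forall v, 0 <= f v)%E ->
  (`|\det E|%:E * \int[leb n]_t f (vec t *m E + b)%R =
   \int[leb n]_t f (vec t))%E.
Proof.
move=> dE mf f0; rewrite (det_scaling_unit dE (f := fun v => f (v + b)))//.
  exact: leb_translate.
by have := vmeas_affine 1%:M b mf; under eq_fun do rewrite mulmx1.
Qed.

End LinearChange.

(** * Integrals of bounded continuous functions over bounded open sets *)

Section VolumeIntegral.
Context {R : realType}.
Implicit Types (n : nat).
Local Notation mu := (@lebesgue_measure R).

(** The topology lives on row vectors and the sigma-algebra on tuples. The bridge is that an open
    set is the union of the countably many boxes with rational corners that it contains. *)
Lemma measurable_vec_open n (A : set 'rV[R]_n) : open A ->
  measurable (@vec R n @^-1` A).
Proof.
move=> oA.
pose Q (i : 'rV[rat]_n * 'rV[rat]_n) : set (n.-tuple R) :=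
  \bigcap_(j in [set: 'I_n]) ((@tnth n R ^~ j) @^-1`
     [set` `]ratr (i.1 0 j) : R, ratr (i.2 0 j)[]).
pose J := [set i | Q i `<=` @vec R n @^-1` A].
have -> : @vec R n @^-1` A = \bigcup_i (if i \in J then Q i else set0).
  apply/seteqP; split => [t At|t [i _]]; last by case: ifPn => // /set_mem; apply.
  have /nbhs_ballP[e /= e0 eA] : nbhs (vec t) A by exact: open_nbhs_nbhs.
  have lo j : {q : rat | ratr q \in `]tnth t j - e, tnth t j[}.
    by apply/cid/rat_in_itvoo; rewrite ltrBlDr ltrDl.
  have hi j : {q : rat | ratr q \in `]tnth t j, tnth t j + e[}.
    by apply/cid/rat_in_itvoo; rewrite ltrDl.
  exists (\row_j sval (lo j), \row_j sval (hi j)) => //.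
  rewrite mem_set.
    move=> j _ /=; rewrite !mxE in_itv/=.
    have := svalP (lo j); rewrite in_itv/= => /andP[_ ->].
    by have := svalP (hi j); rewrite in_itv/= => /andP[-> _].
  move=> s Qs; apply: eA; split => // i j; rewrite ord1 !mxE.
  have := Qs j I; rewrite /= !mxE in_itv/= => /andP[h1 h2].
  have := svalP (lo j); rewrite in_itv/= => /andP[h3 _].
  have := svalP (hi j); rewrite in_itv/= => /andP[_ h4].
  by rewrite /ball/= ltr_distlC; apply/andP; split; lra.
apply: countable_bigcupT_measurable => // i.
case: ifP => // _; apply: fin_bigcap_measurable => // j _.
rewrite -[X in measurable X]setTI.
by apply: measurable_tnth => //; exact: measurable_itv.
Qed.

Lemma measurable_vec_fun n (A : set 'rV[R]_n) (f : 'rV[R]_n -> R) : open A ->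
  (forall x, A x -> {for x, continuous f}) ->
  measurable_fun (@vec R n @^-1` A) (f \o vec).
Proof.
move=> oA cf; apply: (measurability _ (RGenOpens.measurableE R)).
move=> _ [_ [a [b ->] <-]].
rewrite (_ : _ `&` _ = @vec R n @^-1` (A `&` f @^-1` [set` `]a, b[])) //.
apply: measurable_vec_open; rewrite openE => x [Ax fx].
apply: filterI; first exact: open_nbhs_nbhs.
by apply: cf => //; apply: open_nbhs_nbhs; split => //; exact: interval_open.
Qed.

Lemma measurable_box n (m : R) :
  measurable [set t : n.-tuple R | forall i, `|tnth t i| <= m].
Proof.
rewrite (_ : [set t | _] =
    \bigcap_(i in [set: 'I_n]) (@tnth n R ^~ i) @^-1` `[- m, m]%classic).
  apply: fin_bigcap_measurable => // j _; rewrite -[X in measurable X]setTI.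
  by apply: measurable_tnth => //; exact: measurable_itv.
apply/seteqP; split => t /= h i.
  by move=> _; rewrite /= in_itv/= -ler_norml.
by have := h i I; rewrite /= in_itv/= -ler_norml.
Qed.

Lemma leb_box n (m : R) :
  (leb n [set t : n.-tuple R | forall i, (`|tnth t i| <= m)%R] < +oo)%E.
Proof.
elim: n => [|n IH].
  rewrite (_ : [set t | _] = setT) /= ?diracT ?ltry//.
  by apply/seteqP; split => // t _ [].
rewrite /= /leb_succ /pushforward.
rewrite (_ : _ @^-1` _ =
    `[- m, m]%classic `*` [set t : n.-tuple R | forall i, `|tnth t i| <= m]).
  rewrite product_measure1E//; last exact: measurable_box.
  have := lebesgue_measure_itv `[- m, m]; set x := (lebesgue_measure _) => xE.
  rewrite lte_mul_pinfty ?measure_ge0//.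
  by rewrite [X in X \is a _](_ : _ = x)// xE/=; case: ifP.
apply/seteqP; split => -[x t] /=.
  move=> h; split => /=; first by have := h ord0; rewrite tnth0 in_itv/= ler_norml.
  by move=> i; have := h (lift ord0 i); rewrite tnthS.
move=> [hx ht] i; have [j ->|->] := unliftP ord0 i; first by rewrite tnthS.
by rewrite tnth0 ler_norml; move: hx; rewrite in_itv.
Qed.

Lemma leb_bounded n (A : set 'rV[R]_n) : measurable (@vec R n @^-1` A) ->
  bounded_set A -> (leb n (@vec R n @^-1` A) < +oo)%E.
Proof.
move=> mA [M [_ AM]]; apply: le_lt_trans (leb_box n (M + 1)).
apply: le_measure; rewrite ?inE//; first exact: measurable_box.
move=> t At i; have := AM (M + 1); rewrite ltrDl ltr01 => /(_ isT _ At).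
apply: le_trans; rewrite [leRHS]/Num.Def.normr/= mx_normrE.
by apply: le_trans (le_bigmax _ _ (0, i)); rewrite mxE.
Qed.

(** Continuity at the points of an open set says nothing about growth near its boundary; the added
    bound gives integrability when the set is also bounded. *)
Definition bcont n (A : set 'rV[R]_n) (f : 'rV[R]_n -> R) :=
  (forall x, A x -> {for x, continuous f}) /\
  exists M, forall x, A x -> `|f x| <= M.

Definition open_bounded n (A : set 'rV[R]_n) := open A /\ bounded_set A.

Lemma bcont_integrable n (A : set 'rV[R]_n) f : open_bounded A -> bcont A f ->
  (leb n).-integrable (@vec R n @^-1` A) (EFin \o (f \o vec)).
Proof.
move=> [oA bA] [cf [M fM]]; apply: measurable_bounded_integrable.
- exact: measurable_vec_open.
- by apply: leb_bounded => //; exact: measurable_vec_open.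
- exact: measurable_vec_fun.
- exists M; split; first exact: num_real.
  by move=> y My t At /=; apply: le_trans (ltW My); exact: fM.
Qed.

Lemma bcont_cst n (A : set 'rV[R]_n) c : bcont A (cst c).
Proof. by split=> [x _|]; [exact: cst_continuous|exists `|c|]. Qed.

Lemma bcontD n (A : set 'rV[R]_n) f g : bcont A f -> bcont A g ->
  bcont A (fun x => f x + g x).
Proof.
move=> [cf [M fM]] [cg [N gN]]; split=> [x Ax|]; first exact: cvgD (cf x Ax) (cg x Ax).
by exists (M + N) => x Ax; rewrite (le_trans (ler_normD _ _))// lerD ?fM ?gN.
Qed.

Lemma bcontM n (A : set 'rV[R]_n) f g : bcont A f -> bcont A g ->
  bcont A (fun x => f x * g x).
Proof.
move=> [cf [M fM]] [cg [N gN]]; split=> [x Ax|]; first exact: cvgM (cf x Ax) (cg x Ax).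
by exists (M * N) => x Ax; rewrite normrM ler_pM ?fM ?gN.
Qed.

Lemma bcont_comp n m (A : set 'rV[R]_n) (B : set 'rV[R]_m) f phi :
  continuous phi -> (forall s, B s -> A (phi s)) -> bcont A f ->
  bcont B (fun s => f (phi s)).
Proof.
move=> cphi BA [cf [M fM]]; split=> [s Bs|]; last by exists M => s /BA; exact: fM.
exact: (cvg_comp phi f (cphi s) (cf _ (BA s Bs))).
Qed.

Lemma bcont_sum n (A : set 'rV[R]_n) (I : Type) (r : seq I) (P : pred I) f :
  (forall i, P i -> bcont A (f i)) -> bcont A (fun x => \sum_(i <- r | P i) f i x).
Proof.
move=> h; elim: r => [|i r IH].
  by under eq_fun do rewrite big_nil; exact: bcont_cst.
have [Pi|/negbTE Pi] := boolP (P i).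
  by under eq_fun do rewrite big_cons Pi; apply: bcontD => //; exact: h.
by under eq_fun do rewrite big_cons Pi.
Qed.

Lemma eq_vol_int n (A : set 'rV[R]_n) f g : (forall x, A x -> f x = g x) ->
  vol_int A f = vol_int A g.
Proof. by move=> fg; apply: eq_Rintegral => t /set_mem; exact: fg. Qed.

Lemma vol_int0 n (A : set 'rV[R]_n) f : (forall x, A x -> f x = 0) ->
  vol_int A f = 0.
Proof.
move=> /eq_vol_int ->; rewrite /vol_int/= /Rintegral.
by rewrite integral0_eq.
Qed.

Lemma vol_intD n (A : set 'rV[R]_n) f g : open_bounded A -> bcont A f -> bcont A g ->
  vol_int A (fun x => f x + g x) = vol_int A f + vol_int A g.
Proof.
move=> gA bf bg; rewrite /vol_int RintegralD//; [|exact: bcont_integrable..].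
by case: gA => oA _; exact: measurable_vec_open.
Qed.

Lemma vol_intZ n (A : set 'rV[R]_n) c f : open_bounded A -> bcont A f ->
  vol_int A (fun x => c * f x) = c * vol_int A f.
Proof.
move=> gA bf; rewrite /vol_int RintegralZl//; last exact: bcont_integrable.
by case: gA => oA _; exact: measurable_vec_open.
Qed.

Lemma vol_int_sum n (A : set 'rV[R]_n) (I : Type) (r : seq I) (P : pred I) f :
  open_bounded A -> (forall i, P i -> bcont A (f i)) ->
  vol_int A (fun x => \sum_(i <- r | P i) f i x) =
  \sum_(i <- r | P i) vol_int A (f i).
Proof.
move=> gA h; elim: r => [|i r IH].
  by rewrite big_nil vol_int0// => x _; rewrite big_nil.
rewrite big_cons -IH; have [Pi|/negbTE Pi] := boolP (P i).
  rewrite -vol_intD//; [|exact: h|exact: bcont_sum].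
  by apply: eq_vol_int => x _; rewrite big_cons Pi.
by apply: eq_vol_int => x _; rewrite big_cons Pi.
Qed.

(** [fine] sends both infinities to 0, a value that multiplication by [a] preserves, so infinite
    integrals need no separate treatment later. *)
Lemma fine_pmul (a : R) (x y : \bar R) : 0 < a -> (0 <= x)%E -> (0 <= y)%E ->
  fine (a%:E * x - a%:E * y)%E = a * fine (x - y)%E.
Proof.
move=> a0; case: x => [x| |]; case: y => [y| |] // x0 y0;
  rewrite ?gt0_muley ?lte_fin//= ?mulr0//.
by rewrite mulrBr.
Qed.

(** The function is extended by zero to the whole space, and [leb_affine] is applied to the positive
    and negative parts of the extension. *)
Lemma vol_int_affine n (E : 'M[R]_n) b (A : set 'rV[R]_n) f : \det E != 0 ->
  measurable (@vec R n @^-1` A) ->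
  measurable_fun (@vec R n @^-1` A) (f \o vec) ->
  vol_int A f = `|\det E| *
    vol_int [set s | A (s *m E + b)] (fun s => f (s *m E + b)).
Proof.
move=> dE mA mf; pose g (x : 'rV[R]_n) : \bar R := if x \in A then (f x)%:E else 0%E.
have gE (B : set 'rV[R]_n) (h : 'rV[R]_n -> R) :
    (\int[leb n]_(t in @vec R n @^-1` B) (h (vec t))%:E =
     \int[leb n]_t (if vec t \in B then (h (vec t))%:E else 0))%E.
  rewrite integral_mkcond; apply: eq_integral => t _; rewrite patchE.
  by rewrite (_ : (t \in _) = (vec t \in B))//; apply/idP/idP; rewrite !inE.
have mg : vmeas g by move/measurable_EFinP/(measurable_restrictT _ mA) : mf.
rewrite /vol_int /Rintegral gE.
rewrite (gE [set s | A (s *m E + b)] (fun s => f (s *m E + b))).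
rewrite [X in _ = _ * fine X](_ : _ = \int[leb n]_t g (vec t *m E + b)%R)%E.
  2: by apply: eq_integral => t _; rewrite /g; congr (if _ then _ else _);
       apply/idP/idP; rewrite !inE.
have mgp : vmeas (g^\+)%E.
  by rewrite /vmeas -funepos_comp; exact: measurable_funepos.
have mgn : vmeas (g^\-)%E.
  by rewrite /vmeas -funeneg_comp; exact: measurable_funeneg.
have intE (phi : n.-tuple R -> 'rV[R]_n) : (\int[leb n]_t g (phi t) =
    \int[leb n]_t (g^\+ (phi t)) - \int[leb n]_t (g^\- (phi t)))%E.
  rewrite integralE; congr (_ - _)%E; apply: eq_integral => t _.
    by rewrite !funeposE.
  by rewrite !funenegE.
rewrite (intE vec) (intE (fun t => vec t *m E + b)).
rewrite -(leb_affine b dE mgp (fun v => funepos_ge0 _ _)).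
rewrite -(leb_affine b dE mgn (fun v => funeneg_ge0 _ _)).
rewrite fine_pmul ?normr_gt0//; apply: integral_ge0 => t _.
  exact: funepos_ge0.
exact: funeneg_ge0.
Qed.

End VolumeIntegral.

(** * Traces and functions smooth up to the boundary *)

Section Trace.
Context {R : realType} {d : nat}.
Implicit Types (A : set 'rV[R]_d) (x : 'rV[R]_d).

(** At a point of A the limit is forced to be the value, by [trace_in]; the predicate thus contains
    continuity inside A as well as the existence of boundary traces. *)
Definition extendable (V : normedModType R) A (f : 'rV[R]_d -> V) :=
  forall x, closure A x -> cvg (f @ within A (nbhs x)).

Lemma trace_lim (V : normedModType R) A (f : 'rV[R]_d -> V) x l :
  closure A x -> f @ within A (nbhs x) --> l -> trace A f x = l.
Proof.
move=> Ax fl; have pf : ProperFilter (within A (nbhs x)) := within_nbhs_proper Ax.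
exact: cvg_lim.
Qed.

Lemma trace_cvg (V : normedModType R) A (f : 'rV[R]_d -> V) x :
  extendable A f -> closure A x -> f @ within A (nbhs x) --> trace A f x.
Proof. by move=> fA Ax; exact: fA. Qed.

Lemma trace_subset (V : normedModType R) A B (f : 'rV[R]_d -> V) x :
  A `<=` B -> closure A x -> extendable B f -> trace A f x = trace B f x.
Proof.
move=> AB Ax fB; apply: trace_lim => //.
apply: cvg_trans (trace_cvg fB (closureS AB Ax)).
by apply: cvg_app; exact: within_subset.
Qed.

Lemma extendable_subset (V : normedModType R) A B (f : 'rV[R]_d -> V) :
  A `<=` B -> extendable B f -> extendable A f.
Proof.
move=> AB fB x Ax; apply/cvg_ex; exists (trace B f x).
have := fB x (closureS AB Ax); apply: cvg_trans.
by apply: cvg_app; exact: within_subset.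
Qed.

Lemma trace_in (V : normedModType R) A (f : 'rV[R]_d -> V) x :
  A x -> extendable A f -> trace A f x = f x.
Proof.
move=> Ax fA; have cAx := subset_closure Ax; have fl := trace_cvg fA cAx.
apply/esym/eqP; rewrite -subr_eq0 -normr_le0; apply/ler_addgt0Pr => e e0.
rewrite add0r; have : \forall t \near within A (nbhs x), `|trace A f x - f t| <= e.
  exact: cvgr_dist_le fl _ e0.
by rewrite near_withinE => /nbhs_singleton/(_ Ax); rewrite distrC.
Qed.

Lemma extendable_in (V : normedModType R) A (f : 'rV[R]_d -> V) x :
  A x -> extendable A f -> f @ within A (nbhs x) --> f x.
Proof.
by move=> Ax fA; have := trace_cvg fA (subset_closure Ax); rewrite (trace_in Ax fA).
Qed.

Lemma extendable_continuous (V : normedModType R) A (f : 'rV[R]_d -> V) x :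
  open A -> A x -> extendable A f -> {for x, continuous f}.
Proof.
move=> oA Ax fA; have := extendable_in Ax fA.
suff -> : within A (nbhs x) = nbhs x by [].
have nA : nbhs x A by exact: open_nbhs_nbhs.
apply/seteqP; split => P PA.
  have PA' : nbhs x (fun y => A y -> P y) := PA.
  by apply: filterS (filterI PA' nA) => y [h]; exact: h.
have : nbhs x (fun y => A y -> P y); last by [].
by apply: filterS PA => y Py _.
Qed.

Lemma extendable_eq (V : normedModType R) A (f g : 'rV[R]_d -> V) :
  (forall x, A x -> f x = g x) -> extendable A f -> extendable A g.
Proof.
move=> fg fA x Ax; apply/cvg_ex; exists (trace A f x).
apply: cvg_trans (trace_cvg fA Ax); apply: near_eq_cvg.
by rewrite near_withinE; apply: filterE => y Ay; rewrite fg.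
Qed.

Lemma trace_within_continuous (V : normedModType R) A B (f : 'rV[R]_d -> V) x :
  {within closure B, continuous f} -> A `<=` B -> closure A x ->
  trace A f x = f x.
Proof.
move=> /subspace_continuousP cf AB Ax; apply: trace_lim => //.
apply: cvg_trans (cf x (closureS AB Ax)); apply: cvg_app; apply: within_subset.
by apply: subset_trans AB _; exact: subset_closure.
Qed.

(** Continuity of the trace on the closure: the estimate [|trace A f x - f y| <= e], valid for y in
    A near x, survives the limit of y to [phi s]. The general filter covers neighbourhoods,
    neighbourhoods within the closure, and the one-sided limits at the ends of a segment. *)
Lemma trace_comp_cvg (V : normedModType R) A (f : 'rV[R]_d -> V)
    (T : Type) (F : set_system T) (phi : T -> 'rV[R]_d) x : Filter F ->
  extendable A f -> closure A x -> phi @ F --> x ->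
  (\forall s \near F, closure A (phi s)) ->
  (fun s => trace A f (phi s)) @ F --> trace A f x.
Proof.
move=> FF fA Ax phix Aphi; apply/cvgrPdist_le => e e0.
have : \forall t \near within A (nbhs x), `|trace A f x - f t| <= e.
  exact: cvgr_dist_le (trace_cvg fA Ax) _ e0.
rewrite near_withinE => /nbhs_ballP[r /= r0 rA].
have Br : \forall s \near F, ball x r (phi s).
  by apply: phix; exact: nbhsx_ballx.
apply: filterS (filterI Aphi Br) => s [As Bs].
have pf : ProperFilter (within A (nbhs (phi s))) := within_nbhs_proper As.
have cvgn : (fun y => `|trace A f x - f y|) @ within A (nbhs (phi s)) -->
    `|trace A f x - trace A f (phi s)|.
  by apply: cvg_norm; apply: cvgB; [exact: cvg_cst|exact: trace_cvg].
have := @closed_cvg _ _ _ pf _ _ (@closed_le R e) _ _ cvgn; apply.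
rewrite near_withinE.
have /open_nbhs_nbhs : open_nbhs (phi s) (ball x r) by split => //; exact: ball_open.
by apply: filterS => y; exact: rA.
Qed.

Lemma bounded_set_closure A : bounded_set A -> bounded_set (closure A).
Proof.
move=> [M [_ hM]]; exists (M + 1); split; first exact: num_real.
move=> y My x Ax; apply: le_trans (ltW My).
have clB : closed ((fun z : 'rV[R]_d => `|z|) @^-1` [set r | r <= M + 1]).
  by apply: preimage_closed => [z _|]; [exact: norm_continuous|exact: closed_le].
have /closureS/(_ x Ax) : A `<=` (fun z : 'rV[R]_d => `|z|) @^-1` [set r | r <= M + 1].
  by move=> z Az; apply: hM => //; rewrite ltrDl.
by move/clB.
Qed.

(** The trace is continuous on the closure, which is compact. *)
Lemma bounded_trace A (f : 'rV[R]_d -> R) : bounded_set A ->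
  extendable A f -> exists M, forall x, closure A x -> `|trace A f x| <= M.
Proof.
move=> bA fA.
have cf : {within closure A, continuous (trace A f)}.
  apply/subspace_continuousP => x Ax; apply: trace_comp_cvg => //.
    by apply: cvg_within.
  by rewrite near_withinE; exact: filterE.
have cA : compact (closure A).
  by apply: bounded_closed_compact; [exact: bounded_set_closure|exact: closed_closure].
have [M [_ hM]] := compact_bounded (continuous_compact cf cA).
by exists (M + 1) => x Ax; apply: hM; [rewrite ltrDl|exists x].
Qed.

Lemma extendable_bcont A (f : 'rV[R]_d -> R) : open_bounded A -> extendable A f ->
  bcont A f.
Proof.
move=> [oA bA] fA; split => [x Ax|]; first exact: extendable_continuous fA.
have [M hM] := bounded_trace bA fA; exists M => x Ax.
by rewrite -(trace_in Ax fA); apply: hM; exact: subset_closure.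
Qed.

Lemma bcont_trace_comp A (f : 'rV[R]_d -> R) m (B : set 'rV[R]_m)
    (phi : 'rV[R]_m -> 'rV[R]_d) : bounded_set A -> open B ->
  continuous phi -> (forall s, B s -> closure A (phi s)) -> extendable A f ->
  bcont B (fun s => trace A f (phi s)).
Proof.
move=> bA oB cphi Bphi fA; split => [s Bs|].
  suff : (fun s => trace A f (phi s)) @ nbhs s --> trace A f (phi s) by [].
  apply: (trace_comp_cvg _ fA (Bphi s Bs)); first exact: cphi.
  have nB : nbhs s B by exact: open_nbhs_nbhs.
  by apply: filterS nB => t; exact: Bphi.
by have [M hM] := bounded_trace bA fA; exists M => s /Bphi; exact: hM.
Qed.

End Trace.

(** * Algebra of functions that are C^1 up to the boundary *)

Section C1.
Context {R : realType} {d : nat}.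
Implicit Types (A : set 'rV[R]_d) (f g : 'rV[R]_d -> R).

Lemma C1_extendable (V : normedModType R) A (f : 'rV[R]_d -> V) :
  C1_closure A f -> extendable A f.
Proof. by case. Qed.

Lemma C1_pd_extendable A f i : C1_closure A f -> extendable A (pd i f).
Proof. by case=> _ _ h x Ax; exact: h. Qed.

Lemma C1_intro A f : (forall x, A x -> differentiable f x) -> extendable A f ->
  (forall i, extendable A (pd i f)) -> C1_closure A f.
Proof. by move=> df ef pf; split => // x i Ax; exact: (pf i). Qed.

Lemma C1_derivable (V : normedModType R) A (f : 'rV[R]_d -> V) x v :
  C1_closure A f -> A x -> derivable f x v.
Proof. by case=> df _ _ Ax; apply: diff_derivable; exact: df. Qed.

Lemma extendableD A f g : extendable A f -> extendable A g ->
  extendable A (fun x => f x + g x).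
Proof. by move=> fA gA x Ax; apply: is_cvgD; [exact: fA|exact: gA]. Qed.

Lemma extendableM A f g : extendable A f -> extendable A g ->
  extendable A (fun x => f x * g x).
Proof. by move=> fA gA x Ax; apply: is_cvgM; [exact: fA|exact: gA]. Qed.

Lemma extendable_cst (V : normedModType R) A (c : V) : extendable A (cst c).
Proof. by move=> x Ax; exact: is_cvg_cst. Qed.

Lemma traceD A f g x : closure A x -> extendable A f -> extendable A g ->
  trace A (fun y => f y + g y) x = trace A f x + trace A g x.
Proof.
move=> Ax fA gA; apply: trace_lim => //.
exact: (cvgD (trace_cvg fA Ax) (trace_cvg gA Ax)).
Qed.

Lemma traceM A f g x : closure A x -> extendable A f -> extendable A g ->
  trace A (fun y => f y * g y) x = trace A f x * trace A g x.
Proof.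
move=> Ax fA gA; apply: trace_lim => //.
exact: (cvgM (trace_cvg fA Ax) (trace_cvg gA Ax)).
Qed.

Lemma trace_cst (V : normedModType R) A (c : V) x : closure A x ->
  trace A (cst c) x = c.
Proof. by move=> Ax; apply: trace_lim => //; exact: cvg_cst. Qed.

Lemma extendable_sum A (I : Type) (r : seq I) (P : pred I) (F : I -> 'rV[R]_d -> R) :
  (forall i, P i -> extendable A (F i)) ->
  extendable A (fun x => \sum_(i <- r | P i) F i x).
Proof.
move=> h; elim: r => [|i r IH].
  by under eq_fun do rewrite big_nil; exact: extendable_cst.
have [Pi|/negbTE Pi] := boolP (P i).
  by under eq_fun do rewrite big_cons Pi; exact: (extendableD (h i Pi) IH).
by under eq_fun do rewrite big_cons Pi.
Qed.

Lemma trace_sum A (I : Type) (r : seq I) (P : pred I) (F : I -> 'rV[R]_d -> R) x :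
  closure A x ->
  (forall i, P i -> extendable A (F i)) ->
  trace A (fun y => \sum_(i <- r | P i) F i y) x =
  \sum_(i <- r | P i) trace A (F i) x.
Proof.
move=> Ax h; elim: r => [|i r IH].
  by rewrite big_nil; under eq_fun do rewrite big_nil; exact: trace_cst.
rewrite big_cons; have [Pi|/negbTE Pi] := boolP (P i).
  under eq_fun do rewrite big_cons Pi.
  by rewrite traceD ?IH//; [exact: h|exact: extendable_sum].
by under eq_fun do rewrite big_cons Pi.
Qed.

Lemma C1_cst A (c : R) : C1_closure A (cst c : 'rV[R]_d -> R).
Proof.
split=> [x _|x _|x i _]; first exact: differentiable_cst.
  exact: is_cvg_cst.
by under eq_fun do rewrite derive_cst; exact: is_cvg_cst.
Qed.

Lemma pdD A f g i x : C1_closure A f -> C1_closure A g -> A x ->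
  pd i (fun y => f y + g y) x = pd i f x + pd i g x.
Proof.
move=> Cf Cg Ax; rewrite /pd -(deriveD (C1_derivable (v := delta_mx 0 i) Cf Ax)
  (C1_derivable (v := delta_mx 0 i) Cg Ax)).
by [].
Qed.

Lemma pdM A f g i x : C1_closure A f -> C1_closure A g -> A x ->
  pd i (fun y => f y * g y) x = f x * pd i g x + g x * pd i f x.
Proof.
move=> Cf Cg Ax; rewrite /pd -(deriveM (C1_derivable (v := delta_mx 0 i) Cf Ax)
  (C1_derivable (v := delta_mx 0 i) Cg Ax)).
by [].
Qed.

Lemma C1D A f g : C1_closure A f -> C1_closure A g ->
  C1_closure A (fun x => f x + g x).
Proof.
move=> Cf Cg; have [df ef _] := Cf; have [dg eg _] := Cg; apply: C1_intro.
- by move=> x Ax; exact: (differentiableD (df x Ax) (dg x Ax)).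
- exact: (extendableD ef eg).
- move=> i.
  have h := extendableD (C1_pd_extendable (i := i) Cf) (C1_pd_extendable (i := i) Cg).
  exact: (extendable_eq (fun y Ay => esym (pdD i Cf Cg Ay)) h).
Qed.

Lemma C1M A f g : C1_closure A f -> C1_closure A g ->
  C1_closure A (fun x => f x * g x).
Proof.
move=> Cf Cg; have [df ef _] := Cf; have [dg eg _] := Cg; apply: C1_intro.
- by move=> x Ax; exact: (differentiableM (df x Ax) (dg x Ax)).
- exact: (extendableM ef eg).
- move=> i; have h := extendableD (extendableM ef (C1_pd_extendable (i := i) Cg))
    (extendableM eg (C1_pd_extendable (i := i) Cf)).
  exact: (extendable_eq (fun y Ay => esym (pdM i Cf Cg Ay)) h).
Qed.

Lemma C1_coord A j : C1_closure A (fun x : 'rV[R]_d => x 0 j).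
Proof.
split=> [x _|x _|x i _]; first exact: differentiable_coord.
  apply/cvg_ex; exists (x 0 j).
  by apply: cvg_within_filter; exact: coord_continuous.
rewrite (_ : (fun _ => _) = cst ((delta_mx 0 i : 'rV[R]_d) 0 j)).
  exact: is_cvg_cst.
apply/funext => y /=.
have : derivable (id : 'rV[R]_d -> 'rV[R]_d) y (delta_mx 0 i).
  exact: derivable_id.
move=> /derive_mx.
by rewrite derive_id => /matrixP/(_ 0 j); rewrite [RHS]mxE => ->.
Qed.

Lemma C1_sum A (I : Type) (r : seq I) (P : pred I) (F : I -> 'rV[R]_d -> R) :
  (forall i, P i -> C1_closure A (F i)) ->
  C1_closure A (fun x => \sum_(i <- r | P i) F i x).
Proof.
move=> h; elim: r => [|i r IH].
  by under eq_fun do rewrite big_nil; exact: C1_cst.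
have [Pi|/negbTE Pi] := boolP (P i).
  by under eq_fun do rewrite big_cons Pi; exact: (C1D (h i Pi) IH).
by under eq_fun do rewrite big_cons Pi.
Qed.

Lemma pd_sum A (I : Type) (r : seq I) (P : pred I) (F : I -> 'rV[R]_d -> R) i x :
  (forall i, P i -> C1_closure A (F i)) -> A x ->
  pd i (fun x => \sum_(j <- r | P j) F j x) x = \sum_(j <- r | P j) pd i (F j) x.
Proof.
move=> h Ax; elim: r => [|j r IH].
  rewrite big_nil; under eq_fun do rewrite big_nil; exact: derive_cst.
rewrite big_cons; have [Pj|/negbTE Pj] := boolP (P j).
  under eq_fun do rewrite big_cons Pj.
  by rewrite (pdD _ (h _ Pj) (C1_sum _ h) Ax) IH.
by under eq_fun do rewrite big_cons Pj.
Qed.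

Lemma C1_prod A (I : Type) (r : seq I) (P : pred I) (F : I -> 'rV[R]_d -> R) :
  (forall i, P i -> C1_closure A (F i)) ->
  C1_closure A (fun x => \prod_(i <- r | P i) F i x).
Proof.
move=> h; elim: r => [|i r IH].
  by under eq_fun do rewrite big_nil; exact: C1_cst.
have [Pi|/negbTE Pi] := boolP (P i).
  by under eq_fun do rewrite big_cons Pi; exact: (C1M (h i Pi) IH).
by under eq_fun do rewrite big_cons Pi.
Qed.

Lemma C1_exp A f n : C1_closure A f -> C1_closure A (fun x => f x ^+ n).
Proof.
move=> Cf; elim: n => [|n IH]; first by under eq_fun do rewrite expr0; exact: C1_cst.
by under eq_fun do rewrite exprS; exact: C1M.
Qed.

Lemma C1_polyfun A k f : polyfun k f -> C1_closure A f.
Proof.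
move=> [c fc]; rewrite (funext fc); apply: C1_sum => m _; apply: C1M.
  exact: C1_cst.
by apply: C1_prod => i _; apply: C1_exp; exact: C1_coord.
Qed.

Lemma pd_eq A f g i x : open A -> (forall y, A y -> f y = g y) -> A x ->
  pd i f x = pd i g x.
Proof.
move=> oA fg Ax; apply: near_eq_derive.
  have nA : nbhs x A by exact: open_nbhs_nbhs.
  by apply: filterS nA => y; exact: fg.
Qed.

Lemma C1_subset (V : normedModType R) A B (f : 'rV[R]_d -> V) :
  A `<=` B -> C1_closure B f -> C1_closure A f.
Proof.
move=> AB [df ef pf]; split.
- by move=> x /AB; exact: df.
- exact: extendable_subset AB ef.
- by move=> x i; apply: (extendable_subset AB) => y By; exact: pf.
Qed.

Lemma extendable_entry A m n (F : 'rV[R]_d -> 'M[R]_(m, n)) i j :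
  extendable A F -> extendable A (fun x => F x i j).
Proof.
move=> eF x Ax; apply/cvg_ex; exists (trace A F x i j).
exact: (cvg_comp F (fun N : 'M[R]_(m, n) => N i j) (trace_cvg eF Ax)
  (@coord_continuous R m n i j (trace A F x))).
Qed.

Lemma trace_entry A m n (F : 'rV[R]_d -> 'M[R]_(m, n)) i j x :
  extendable A F -> closure A x -> trace A (fun x => F x i j) x = trace A F x i j.
Proof.
move=> eF Ax; apply: trace_lim => //.
exact: (cvg_comp F (fun N : 'M[R]_(m, n) => N i j) (trace_cvg eF Ax)
  (@coord_continuous R m n i j (trace A F x))).
Qed.

Lemma C1_entry A m n (F : 'rV[R]_d -> 'M[R]_(m, n)) i j :
  C1_closure A F -> C1_closure A (fun x => F x i j).
Proof.
move=> CF; have [dF eF pF] := CF; split.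
- move=> x Ax; apply: (@differentiable_comp _ _ _ _ F (fun M : 'M[R]_(m, n) => M i j)).
    exact: dF.
  exact: differentiable_coord.
- exact: extendable_entry.
- move=> x k; apply: (extendable_eq (f := fun y => 'D_(delta_mx 0 k) F y i j)).
    move=> y Ay; rewrite (derive_mx (C1_derivable CF Ay)) mxE//.
  by apply: extendable_entry => z Az; exact: pF.
Qed.

End C1.

(** * Simplices and their facets *)

Section Simplex.
Context {R : realType}.

Lemma affine_continuous m d (E : 'M[R]_(m, d)) b :
  continuous (fun s : 'rV[R]_m => s *m E + b).
Proof.
move=> s; suff : (fun s : 'rV[R]_m => s *m E) @ nbhs s --> s *m E.
  by move=> h; exact: (cvgD h (cvg_cst b)).
rewrite mulmx_sum_row; under eq_fun do rewrite mulmx_sum_row.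
apply: (cvg_big (@add_continuous 'rV[R]_d)) => j _.
by apply: cvgZr_tmp; exact: coord_continuous.
Qed.

Section OnePoint.
Context {d m : nat}.
Implicit Types (p : 'I_m.+1 -> 'rV[R]_d) (s : 'rV[R]_m).

(** The counterpart of [edges] for an arbitrary ordered list of vertices, so that the vertices of a
    cell can be reordered at will. *)
Definition sedges p : 'M[R]_(m, d) :=
  \matrix_(j < m) (p (lift ord0 j) - p ord0).

Definition amap p s : 'rV[R]_d := p ord0 + s *m sedges p.

(** Barycentric coordinates. Index [ord0] carries the complement to 1 because [amap] takes the
    vertex [p ord0] as its origin. *)
Definition bar s (i : 'I_m.+1) : R :=
  if unlift ord0 i is Some j then s 0 j else 1 - \sum_j s 0 j.

Lemma bar0 s : bar s ord0 = 1 - \sum_j s 0 j.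
Proof. by rewrite /bar unlift_none. Qed.

Lemma bar_lift s j : bar s (lift ord0 j) = s 0 j.
Proof. by rewrite /bar liftK. Qed.

Lemma sum_bar s : \sum_i bar s i = 1.
Proof.
rewrite big_ord_recl bar0; under [X in _ + X]eq_bigr do rewrite bar_lift.
by rewrite subrK.
Qed.

Lemma amap_bar p s : amap p s = \sum_i bar s i *: p i.
Proof.
rewrite /amap big_ord_recl bar0 scalerBl scale1r mulmx_sum_row.
have -> : \sum_j bar s (lift ord0 j) *: p (lift ord0 j) =
    \sum_j s 0 j *: p (lift ord0 j) by apply: eq_bigr => j _; rewrite bar_lift.
under eq_bigr do rewrite rowK scalerBr.
by rewrite sumrB -scaler_suml addrA addrAC.
Qed.

Lemma bar_row (b : 'I_m.+1 -> R) : \sum_i b i = 1 ->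
  bar (\row_j b (lift ord0 j)) =1 b.
Proof.
rewrite big_ord_recl => b1 i; have [j ->|->] := unliftP ord0 i.
  by rewrite bar_lift mxE.
by rewrite bar0; under eq_bigr do rewrite mxE; rewrite -b1 addrK.
Qed.

Lemma refsimplexE s : refsimplex s <-> forall i, 0 < bar s i.
Proof.
split=> [[s0 s1] i|h].
  have [j ->|->] := unliftP ord0 i; first by rewrite bar_lift.
  by rewrite bar0 subr_gt0.
split=> [j|]; first by have := h (lift ord0 j); rewrite bar_lift.
by have := h ord0; rewrite bar0 subr_gt0.
Qed.

Lemma amap_continuous p : continuous (amap p).
Proof.
by rewrite /amap; under eq_fun do rewrite addrC; exact: affine_continuous.
Qed.

Lemma bar_continuous i : continuous (bar ^~ i).
Proof.
rewrite /bar; case: unlift => [j|] s; first exact: coord_continuous.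
suff h : (fun s : 'rV[R]_m => \sum_j s 0 j) @ nbhs s --> \sum_j s 0 j.
  by exact: (cvgB (cvg_cst (1 : R)) h).
apply: (cvg_big (@add_continuous R^o)) => j _.
exact: coord_continuous.
Qed.

Lemma open_bounded_refsimplex : open_bounded (@refsimplex R m).
Proof.
split.
  rewrite openE => s /refsimplexE s0.
  have : \forall t \near s, forall i, 0 < bar t i.
    apply: (@filter_forall _ _ (fun i t => 0 < bar t i) (nbhs s) _) => i.
    by apply: (cvgr_gt (bar s i)); [exact: bar_continuous|exact: s0].
  by apply: filterS => t /refsimplexE.
exists 1; split => // y y1 s [s0 s1] /=.
rewrite [leLHS]/Num.Def.normr/= mx_normrE bigmax_le ?(le_trans ler01 (ltW y1))//.
move=> [i j] _ /=; rewrite ord1 gtr0_norm// (le_trans _ (ltW y1))//.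
rewrite (le_trans _ (ltW s1))// (bigD1 j)//= lerDl sumr_ge0// => k _.
exact: ltW.
Qed.

End OnePoint.

Section Perm.
Context {m : nat}.
Implicit Types (pi : 'I_m.+1 -> 'I_m.+1).

(** The vertices of the reference simplex. A reordering [pi] of the vertices of any simplex amounts
    to precomposing [amap] with the affine self-map [amap (refpt \o pi)] of the reference
    simplex. *)
Definition refpt (i : 'I_m.+1) : 'rV[R]_m :=
  if unlift ord0 i is Some j then delta_mx 0 j else 0.

Lemma refpt0 : refpt ord0 = 0. Proof. by rewrite /refpt unlift_none. Qed.

Lemma refpt_lift j : refpt (lift ord0 j) = delta_mx 0 j.
Proof. by rewrite /refpt liftK. Qed.

Lemma amap_refpt d (p : 'I_m.+1 -> 'rV[R]_d) i : amap p (refpt i) = p i.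
Proof.
rewrite /amap; have [j ->|->] := unliftP ord0 i.
  by rewrite refpt_lift -rowE rowK addrC subrK.
by rewrite refpt0 mul0mx addr0.
Qed.

Lemma sedges_refpt : sedges refpt = 1%:M.
Proof.
apply/row_matrixP => j.
by rewrite rowK refpt_lift refpt0 subr0 rowE mulmx1.
Qed.

Lemma sedges_perm d (p : 'I_m.+1 -> 'rV[R]_d) pi :
  sedges (p \o pi) = sedges (refpt \o pi) *m sedges p.
Proof.
apply/row_matrixP => j; rewrite row_mul !rowK/= mulmxBl.
by rewrite -!(amap_refpt p) /amap opprD addrACA subrr add0r.
Qed.

Lemma amap_perm d (p : 'I_m.+1 -> 'rV[R]_d) pi s :
  amap (p \o pi) s = amap p (amap (refpt \o pi) s).
Proof.
rewrite {1}/amap sedges_perm /= -(amap_refpt p (pi ord0)) /amap/=.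
by rewrite mulmxDl mulmxA addrA.
Qed.

Lemma amap_refptK s : amap refpt s = s.
Proof. by rewrite /amap sedges_refpt mulmx1 refpt0 add0r. Qed.

(** The matrices attached to [pi] and to its inverse multiply to the identity. *)
Lemma det_sedges_perm pi : injective pi -> \det (sedges (refpt \o pi)) != 0.
Proof.
move=> /injF_bij[pi' piK pi'K]; apply/eqP => d0.
have := sedges_perm (refpt \o pi) pi'.
rewrite (_ : (refpt \o pi) \o pi' = refpt).
  2: by apply/funext => i /=; rewrite pi'K.
rewrite sedges_refpt => /(congr1 determinant).
by rewrite det1 det_mulmx d0 mulr0 => /eqP; rewrite oner_eq0.
Qed.

Lemma bar_perm pi s i : injective pi ->
  bar (amap (refpt \o pi) s) (pi i) = bar s i.
Proof.
move=> ipi; have [pi' piK pi'K] := injF_bij ipi.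
rewrite amap_bar (reindex_inj (can_inj pi'K))/=.
under eq_bigr do rewrite pi'K.
have b1 : \sum_j bar s (pi' j) = 1.
  by rewrite -(sum_bar s) [RHS](reindex_inj (can_inj pi'K)).
rewrite -[in RHS](piK i) -(bar_row b1); congr bar.
rewrite -[RHS]amap_refptK amap_bar; apply: eq_bigr => j _.
by rewrite (bar_row b1).
Qed.

Lemma refsimplex_perm pi s : injective pi ->
  refsimplex (amap (refpt \o pi) s) <-> refsimplex s.
Proof.
move=> ipi; rewrite !refsimplexE; split=> h i.
  by rewrite -(bar_perm s i ipi).
have [pi' piK pi'K] := injF_bij ipi.
by rewrite -(pi'K i) bar_perm.
Qed.

Definition surf d (p : 'I_m.+1 -> 'rV[R]_d) (f : 'rV[R]_d -> R) : R :=
  Num.sqrt (\det (sedges p *m (sedges p)^T)) *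
  vol_int (@refsimplex R m) (fun s => f (amap p s)).

(** Reordering multiplies the Gram determinant by the square of [\det (sedges (refpt \o pi))]; its
    square root supplies exactly the Jacobian of the change of variables. *)
Lemma surf_perm d (p : 'I_m.+1 -> 'rV[R]_d) pi f : injective pi ->
  bcont (@refsimplex R m) (fun s => f (amap p s)) ->
  surf (p \o pi) f = surf p f.
Proof.
move=> ipi bf; have [oS _] := @open_bounded_refsimplex m.
rewrite /surf sedges_perm.
have -> : \det (sedges (refpt \o pi) *m sedges p *m
      (sedges (refpt \o pi) *m sedges p)^T) =
    \det (sedges (refpt \o pi)) ^+ 2 * \det (sedges p *m (sedges p)^T).
  by rewrite trmx_mul mulmxA -(mulmxA (sedges (refpt \o pi))) !det_mulmx det_tr; ring.
rewrite sqrtrM ?sqr_ge0// sqrtr_sqr [_ * Num.sqrt _]mulrC -mulrA; congr (_ * _).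
rewrite [RHS](vol_int_affine (refpt (pi ord0)) (det_sedges_perm ipi)).
- congr (_ * _); rewrite (_ : [set s | _] = @refsimplex R m).
    by apply: eq_vol_int => s _; rewrite amap_perm [in RHS]addrC.
  by apply/seteqP; split=> s /=; rewrite addrC => /(refsimplex_perm s ipi).
- exact: measurable_vec_open.
- by case: bf => cf _; exact: measurable_vec_fun.
Qed.

End Perm.
End Simplex.

(** * Cells and facets of a mesh under any ordering of their vertices *)

Section MeshSimplex.
Context {R : realType} {d : nat} (M : mesh R d).
Implicit Types (S K F : {set 'I_(nvtx M)}).

Definition enumerates m (tau : 'I_m.+1 -> 'I_(nvtx M)) S :=
  injective tau /\ S = (tau @: [set: 'I_m.+1])%SET.

Lemma enumerates_vpt m S : #|S| = m.+1 -> exists tau : 'I_m.+1 -> 'I_(nvtx M),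
  enumerates tau S /\ forall j : 'I_m.+1, vpt S j = vtx M (tau j).
Proof.
move=> Sm; exists (fun j => enum_val (cast_ord (esym Sm) j)); split; first split.
- by move=> i j /enum_val_inj /cast_ord_inj.
- apply/setP => i; apply/idP/imsetP => [iS|[j _ ->]]; last exact: enum_valP.
  exists (cast_ord Sm (enum_rank_in iS i)); first by rewrite inE.
  by rewrite cast_ordK enum_rankK_in.
- move=> j; rewrite /vpt (nth_map (enum_val (cast_ord (esym Sm) j))).
    by rewrite [in RHS](enum_val_nth (enum_val (cast_ord (esym Sm) j))).
  by rewrite -cardE Sm.
Qed.

Lemma enumerates_perm m (tau tau' : 'I_m.+1 -> 'I_(nvtx M)) S :
  enumerates tau S -> enumerates tau' S ->
  exists2 pi, injective pi & tau' = tau \o pi.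
Proof.
move=> [it St] [it' St'].
have /choice[pi piE] : forall j, exists i, tau i = tau' j.
  move=> j; have : tau' j \in (tau @: [set: 'I_m.+1])%SET by rewrite -St St' imset_f ?inE.
  by move=> /imsetP[i _ ->]; exists i.
exists pi; last by apply/funext => j /=; rewrite piE.
by move=> i j ij; apply: it'; rewrite -!piE ij.
Qed.

Lemma sum_enumerates m (tau : 'I_m.+1 -> 'I_(nvtx M)) S (V : nmodType)
    (f : 'I_(nvtx M) -> V) : enumerates tau S ->
  \sum_(i in S) f i = \sum_j f (tau j).
Proof.
move=> [it ->]; rewrite big_imset/=; last by move=> i j _ _; exact: it.
by apply: eq_bigl => i; rewrite finset.in_setT.
Qed.

Lemma cell_amap m (tau : 'I_m.+1 -> 'I_(nvtx M)) S x : enumerates tau S ->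
  cell M S x <-> exists2 s, refsimplex s & x = amap (vtx M \o tau) s.
Proof.
move=> tauS; have [it St] := tauS.
split=> [[b [b0 b1 ->]]|[s /refsimplexE s0 ->]].
  have b1' : \sum_i b (tau i) = 1 by rewrite -b1 (sum_enumerates _ tauS).
  exists (\row_j b (tau (lift ord0 j))).
    apply/refsimplexE => i; rewrite (bar_row b1'); apply: b0.
    by rewrite St imset_f ?inE.
  rewrite amap_bar (sum_enumerates _ tauS).
  by apply: eq_bigr => i _; rewrite (bar_row b1').
(* The weights [bar s] carried over to mesh indices by inverting the injective [tau]; indices
   outside S receive 0. *)
pose b i := if [pick j | tau j == i] is Some j then bar s j else 0.
have bE j : b (tau j) = bar s j.
  by rewrite /b; case: pickP => [k /eqP/it -> //|/(_ j)]; rewrite eqxx.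
exists b; split.
- by move=> i; rewrite St => /imsetP[j _ ->]; rewrite bE.
- by rewrite (sum_enumerates _ tauS) -(sum_bar s); apply: eq_bigr => j _.
- rewrite amap_bar (sum_enumerates _ tauS).
  by apply: eq_bigr => j _; rewrite bE.
Qed.

Lemma edges_sedges m (tau : 'I_m.+1 -> 'I_(nvtx M)) S :
  (forall j : 'I_m.+1, vpt S j = vtx M (tau j)) ->
  edges S m = sedges (vtx M \o tau).
Proof.
move=> h; apply/row_matrixP => j; rewrite !rowK/=.
by rewrite -(h (lift ord0 j)) -(h ord0).
Qed.

Lemma cell_bounded S : bounded_set (cell M S).
Proof.
exists (\sum_(i in S) `|vtx M i|); split; first exact: num_real.
move=> y hy x [b [b0 b1 ->]]; apply: le_trans (ltW hy).
apply: le_trans (ler_norm_sum _ _ _) _; apply: ler_sum => i iS.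
rewrite normrZ ler_piMl// ger0_norm; last exact/ltW/b0.
by rewrite -b1 (bigD1 i)//= lerDl sumr_ge0// => j /andP[jS _]; exact/ltW/b0.
Qed.

Section Element.
Context (K : {set 'I_(nvtx M)}) (tau : 'I_d.+1 -> 'I_(nvtx M)).
Hypothesis tauK : enumerates tau K.
Local Notation E := (sedges (vtx M \o tau)).
Hypothesis dE : \det E != 0.

Let uE : E \in unitmx. Proof. by rewrite unitmxE unitfE. Qed.

Lemma cellE x : cell M K x <-> refsimplex ((x - vtx M (tau ord0)) *m invmx E).
Proof.
rewrite (cell_amap x tauK); split=> [[s rs ->]|rs].
  by rewrite /amap addrAC subrr add0r mulmxK.
by eexists; [exact: rs|rewrite /amap mulmxKV// addrC subrK].
Qed.

Lemma cell_open : open (cell M K).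
Proof.
rewrite (_ : cell M K = (fun x => x *m invmx E - vtx M (tau ord0) *m invmx E) @^-1`
    (@refsimplex R d)).
  apply: open_comp; last by case: (@open_bounded_refsimplex R d).
  by move=> x _; exact: affine_continuous.
by apply/seteqP; split=> x; rewrite /= -mulmxBl; move/cellE.
Qed.

Lemma cell_open_bounded : open_bounded (cell M K).
Proof. by split; [exact: cell_open|exact: cell_bounded]. Qed.

Lemma vol_int_cell f : bcont (cell M K) f ->
  vol_int (cell M K) f =
  `|\det E| * vol_int (@refsimplex R d) (fun s => f (amap (vtx M \o tau) s)).
Proof.
move=> [cf _]; rewrite (vol_int_affine (vtx M (tau ord0)) dE).
- congr (_ * _); rewrite (_ : [set s | _] = @refsimplex R d).
    by apply: eq_vol_int => s _; rewrite /amap addrC.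
  apply/seteqP; split=> s /=; rewrite addrC.
    by rewrite cellE addrAC subrr add0r mulmxK.
  by move=> rs; apply/(cell_amap _ tauK); exists s.
- by apply: measurable_vec_open; exact: cell_open.
- by apply: measurable_vec_fun => //; exact: cell_open.
Qed.

End Element.

Lemma det_enumerates K tau : #|K| = d.+1 -> \det (edges K d) != 0 ->
  enumerates tau K -> \det (sedges (vtx M \o tau)) != 0.
Proof.
move=> cK; have [tau0 [t0K /edges_sedges ->]] := enumerates_vpt cK.
move=> dE /(enumerates_perm t0K)[pi ipi ->].
rewrite compA sedges_perm det_mulmx mulf_neq0//; exact: det_sedges_perm.
Qed.

End MeshSimplex.

Section FacetInt.
Context {R : realType} {n : nat} (M : mesh R n.+1).
Implicit Types (F : {set 'I_(nvtx M)}).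

Lemma fmap_amap (tau : 'I_n.+1 -> 'I_(nvtx M)) F :
  (forall j : 'I_n.+1, vpt F j = vtx M (tau j)) ->
  Defs.fmap F = amap (vtx M \o tau).
Proof.
move=> h; apply/funext => s; rewrite /Defs.fmap /= (edges_sedges h) /amap.
by rewrite (h ord0).
Qed.

Lemma facet_int_surf (tau : 'I_n.+1 -> 'I_(nvtx M)) F f : enumerates tau F ->
  bcont (@refsimplex R n) (fun s => f (amap (vtx M \o tau) s)) ->
  facet_int F setT f = surf (vtx M \o tau) f.
Proof.
move=> tF bf; have cF : #|F| = n.+1.
  by have [it ->] := tF; rewrite card_imset// cardsT card_ord.
have [tau0 [t0F h]] := enumerates_vpt cF.
have [pi ipi tE] := enumerates_perm tF t0F.
transitivity (surf (vtx M \o tau0) f).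
  rewrite /facet_int /= (edges_sedges h) (fmap_amap h) /surf /vol_int.
  congr (_ * Rintegral _ _ _).
  by apply/seteqP; split=> [t []|t].
by rewrite tE compA surf_perm.
Qed.

End FacetInt.

(** * Outward normals *)

Section Dot.
Context {R : realType} {d : nat}.
Implicit Types (a b c x w : 'rV[R]_d).

Lemma dotE a b : dot a b = (a *m b^T) 0 0.
Proof. by rewrite mxE; apply: eq_bigr => i _; rewrite mxE. Qed.

Lemma dotC a b : dot a b = dot b a.
Proof. by apply: eq_bigr => i _; rewrite mulrC. Qed.

Lemma dotDl a b c : dot (a + b) c = dot a c + dot b c.
Proof. by rewrite !dotE mulmxDl mxE. Qed.

Lemma dotNl a b : dot (- a) b = - dot a b.
Proof. by rewrite !dotE mulNmx mxE. Qed.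

Lemma dotBl a b c : dot (a - b) c = dot a c - dot b c.
Proof. by rewrite dotDl dotNl. Qed.

Lemma dotZl (k : R) a b : dot (k *: a) b = k * dot a b.
Proof. by rewrite !dotE -scalemxAl mxE. Qed.

Lemma dotBr a b c : dot c (a - b) = dot c a - dot c b.
Proof. by rewrite dotC dotBl !(dotC c). Qed.

Lemma dotZr (k : R) a b : dot a (k *: b) = k * dot a b.
Proof. by rewrite dotC dotZl dotC. Qed.

Lemma dotNr a b : dot a (- b) = - dot a b.
Proof. by rewrite dotC dotNl dotC. Qed.

Lemma dot_ge0 a : 0 <= dot a a.
Proof. by apply: sumr_ge0 => i _; rewrite -expr2 sqr_ge0. Qed.

Lemma dot_eq0 a : dot a a = 0 -> a = 0.
Proof.
move=> /eqP; rewrite psumr_eq0 => [/allP h|i _]; last by rewrite -expr2 sqr_ge0.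
apply/rowP => i; rewrite mxE; have := h i (mem_index_enum i).
by rewrite /= mulf_eq0 orbb => /eqP.
Qed.

(* Test w = n' - c n - e n with c = n.n' and let e -> 0. *)
Lemma halfspace_unique n n' : dot n n = 1 -> dot n' n' = 1 ->
  (forall w, dot w n < 0 -> dot w n' <= 0) -> n = n'.
Proof.
move=> nn nn' key.
pose c := dot n n'.
have h e : 0 < e -> 1 - c ^+ 2 <= e * c.
  move=> e0; have := key (n' - c *: n - e *: n).
  rewrite !dotBl !dotZl (dotC n') -/c nn nn' => h.
  by have := h ltac:(lra); lra.
have c1 : 1 - c ^+ 2 <= 0.
  rewrite leNgt; apply/negP => c2.
  (* For this e the bound [c / (1 + |c|) <= 1] yields [e * c <= (1 - c ^+ 2) / 2], which contradicts
     [h] when [1 - c ^+ 2] is positive. *)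
  have := h ((1 - c ^+ 2) / (2 * (1 + `|c|))).
  have c0 : 0 < 1 + `|c| by rewrite ltr_pwDl.
  rewrite divr_gt0 ?mulr_gt0// => /(_ isT).
  have cc : c / (1 + `|c|) <= 1.
    by rewrite ler_pdivrMr// mul1r; have := ler_norm c; lra.
  rewrite [X in _ <= X](_ : _ = (1 - c ^+ 2) / 2 * (c / (1 + `|c|))).
    have : (1 - c ^+ 2) / 2 * (c / (1 + `|c|)) <= (1 - c ^+ 2) / 2 * 1.
      by rewrite ler_wpM2l// divr_ge0// ltW.
    lra.
  by field; rewrite gt_eqF.
have d0 : dot (n' - c *: n) (n' - c *: n) = 1 - c ^+ 2.
  by rewrite !dotBl !dotBr !dotZl !dotZr (dotC n') -/c nn nn'; ring.
have d1 : n' = c *: n.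
  apply/eqP; rewrite -subr_eq0; apply/eqP/dot_eq0/eqP.
  by rewrite eq_le dot_ge0 d0 c1.
have : c ^+ 2 = 1.
  by have := dot_ge0 (n' - c *: n); rewrite d0 => ?; apply/eqP; rewrite eq_le; lra.
move=> /eqP; rewrite sqrf_eq1 => /orP[] /eqP c1'.
  by rewrite d1 c1' scale1r.
(* The remaining case n' = - n is excluded by testing w = - n. *)
have := key (- n); rewrite !dotNl nn -/c c1' opprK ltrN10 => /(_ isT).
by rewrite leNgt ltr01.
Qed.

(** A direction entering A cannot leave B. The case A = B is uniqueness of the normal; with an
    element for A and the domain for B it identifies the normal of the domain with that of a
    facet. *)
Lemma outward_normal_unique (A B : set 'rV[R]_d) x n n' : A `<=` B ->
  outward_normal A x n -> outward_normal B x n' -> n = n'.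
Proof.
move=> AB [nn inA _] [nn' _ outB]; apply: halfspace_unique => // w wn.
rewrite leNgt; apply/negP => wn'.
have [t [/AB Bt nBt]] := filter_ex (filterI (inA w wn) (outB w wn')).
exact: nBt.
Qed.

Lemma normal_atP (A : set 'rV[R]_d) x n : outward_normal A x n -> normal_at A x = n.
Proof.
move=> An; apply: (@outward_normal_unique A A x) => //.
by apply: getPex; exists n.
Qed.

End Dot.

Section SimplexNormal.
Context {R : realType} {n : nat}.
Local Notation d := n.+1.
Context (p : 'I_d.+1 -> 'rV[R]_d).
Local Notation E := (sedges p).
Hypothesis dE : \det E != 0.

Let uE : E \in unitmx. Proof. by rewrite unitmxE unitfE. Qed.

(** The vector [v] is the gradient of the sum of the affine coordinates based at [p ord0]. That sum
    is 1 on the face opposite to [p ord0], so [v] is orthogonal to this face; after normalization,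
    [c] is the height of the simplex over it. *)
Lemma exists_normal : exists m c, [/\ dot m m = 1, 0 < c &
  forall j, dot (p (lift ord0 j) - p ord0) m = c].
Proof.
pose v := (invmx E *m const_mx 1 : 'cV[R]_d)^T.
have Ev j : dot (p (lift ord0 j) - p ord0) v = 1.
  rewrite dotE trmxK -(rowK (fun j => p (lift ord0 j) - p ord0)) -row_mul.
  by rewrite mulmxA mulmxV// mul1mx !mxE.
have v0 : 0 < dot v v.
  rewrite lt_neqAle dot_ge0 andbT eq_sym; apply: contraTN (oner_neq0 R).
  by move=> /eqP/dot_eq0 v0; rewrite negbK -(Ev ord0) v0 dotE trmx0 mulmx0 mxE.
pose N := Num.sqrt (dot v v); have N0 : 0 < N by rewrite sqrtr_gt0.
exists (N^-1 *: v), N^-1; split; last 2 first.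
- by rewrite invr_gt0.
- by move=> j; rewrite dotZr Ev mulr1.
rewrite dotZl dotZr mulrA -invfM -expr2 sqr_sqrtr ?dot_ge0//.
by rewrite mulVf// gt_eqF.
Qed.

Context (m : 'rV[R]_d) (c : R).
Hypotheses (mm : dot m m = 1) (c0 : 0 < c).
Hypothesis pm : forall j, dot (p (lift ord0 j) - p ord0) m = c.

Lemma normal_invmx w : c * \sum_j (w *m invmx E) 0 j = dot w m.
Proof.
rewrite -[in RHS](mulmxKV uE w) dotE -(mulmxA (w *m invmx E)).
rewrite (_ : E *m m^T = const_mx c); last first.
  apply/colP => j; rewrite [RHS]mxE -(pm j) dotE.
  rewrite -(rowK (fun j => p (lift ord0 j) - p ord0)) -row_mul.
  by rewrite [RHS]mxE.
rewrite mxE mulr_sumr; apply: eq_bigr => j _.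
by rewrite [const_mx _ _ _]mxE mulrC.
Qed.

Lemma face_coord s :
  (amap (p \o lift ord0) s - p ord0) *m invmx E = \row_j bar s j.
Proof.
apply: (canLR (mulmxK uE)); rewrite mulmx_sum_row amap_bar.
under [in RHS]eq_bigr do rewrite mxE rowK scalerBr.
by rewrite sumrB -scaler_suml sum_bar scale1r.
Qed.

(** Along a ray from a face point, the barycentric coordinate of the opposite vertex [p ord0] is
    [- (t * (dot w m / c))], whose sign decides the side. All other coordinates are positive at t =
    0 and remain so for small t. *)
Lemma outward_normal_simplex (C : set 'rV[R]_d) :
  (forall x, C x <-> refsimplex ((x - p ord0) *m invmx E)) ->
  forall s, refsimplex s -> outward_normal C (amap (p \o lift ord0) s) m.
Proof.
move=> CE s /refsimplexE s0; set x := amap _ _.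
have xtw t w : (x + t *: w - p ord0) *m invmx E =
    (\row_j bar s j) + t *: (w *m invmx E).
  by rewrite addrAC mulmxDl face_coord -scalemxAl.
have sv w : \sum_j (w *m invmx E) 0 j = dot w m / c.
  by rewrite -normal_invmx mulrC mulKf// gt_eqF.
have bar0E t w : bar ((x + t *: w - p ord0) *m invmx E) ord0 = - (t * (dot w m / c)).
  rewrite xtw bar0 (eq_bigr (fun j => bar s j + t * (w *m invmx E) 0 j)).
    by rewrite big_split/= sum_bar -mulr_sumr sv opprD addNKr.
  by move=> j _; rewrite !mxE.
split => // w wm; last first.
  near=> t; rewrite CE => /refsimplexE/(_ ord0); rewrite bar0E oppr_gt0 ltNge.
  by rewrite mulr_ge0// divr_ge0// ltW.
have : \forall t \near (0 : R)^'+, forall j, 0 < bar s j + t * (w *m invmx E) 0 j.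
  apply: (@filter_forall _ _ (fun j t => 0 < bar s j + t * (w *m invmx E) 0 j)
    (0^'+) _) => j.
  apply: (cvgr_gt (bar s j)); last exact: s0.
  rewrite -[X in _ --> X]addr0 -[X in _ --> _ + X](mul0r ((w *m invmx E) 0 j)).
  apply: (cvgD (cvg_cst _)); apply: (cvgM _ (cvg_cst _)).
  exact: cvg_at_right_filter.
move=> h; near=> t; apply/CE/refsimplexE => i.
have [j ->|->] := unliftP ord0 i.
  rewrite bar_lift xtw !mxE; move: j; near: t; apply: filterS h => t h j.
  by have := h j; rewrite !mxE.
rewrite bar0E -mulrN -mulNr mulr_gt0// -?mulNr ?divr_gt0// ?oppr_gt0//.
Unshelve. all: by end_near. Qed.

End SimplexNormal.

(** * The divergence formula on a simplex *)

Section Fubini.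
Context {R : realType}.
Local Notation mu := (@lebesgue_measure R).

(** The version for functions of either sign: [leb_succE] treats nonnegative functions, so the
    product integral is reached through positive and negative parts. *)
Lemma leb_succ_fubini n (f : 'rV[R]_n.+1 -> \bar R) :
  (leb n.+1).-integrable [set: n.+1.-tuple R] (f \o vec) ->
  (\int[leb n.+1]_t f (vec t) = \int[leb n]_t \int[mu]_x f (vcons x (vec t)))%E.
Proof.
move=> /integrableP[mf foo].
have intf : (mu \x leb n)%E.-integrable [set: R * n.-tuple R]
    (fun z => f (vcons z.1 (vec z.2))).
  apply/integrableP; split; first exact: vmeas_vcons.
  have := leb_succE (measurableT_comp (@abse_measurable R setT) mf) (fun v => abse_ge0 (f v)).
  by move=> <-.
rewrite (integral21_prod_meas1 intf).
have mfp : vmeas (f^\+)%E.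
  by rewrite /vmeas -funepos_comp; exact: measurable_funepos.
have mfn : vmeas (f^\-)%E.
  by rewrite /vmeas -funeneg_comp; exact: measurable_funeneg.
rewrite integralE [RHS]integralE; congr (_ - _)%E.
- transitivity (\int[leb n.+1]_t (f^\+)%E (vec t))%E.
    by apply: eq_integral => t _; rewrite !funeposE.
  rewrite (leb_succE mfp (funepos_ge0 _)).
  by apply: eq_integral => z _; rewrite !funeposE.
- transitivity (\int[leb n.+1]_t (f^\-)%E (vec t))%E.
    by apply: eq_integral => t _; rewrite !funenegE.
  rewrite (leb_succE mfn (funeneg_ge0 _)).
  by apply: eq_integral => z _; rewrite !funenegE.
Qed.

End Fubini.

Section Gram.
Context {R : realType} {n : nat}.

(* W Q^T is block triangular for W = (w; F) and Q = (m; F), which relates their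
   determinants. *)
Lemma gram (F : 'M[R]_(n, n.+1)) (w m : 'rV[R]_n.+1) :
  dot m m = 1 -> F *m m^T = 0 -> \det (col_mx w F : 'M[R]_(1 + n)) != 0 ->
  Num.sqrt (\det (F *m F^T)) * `|dot w m| = `|\det (col_mx w F : 'M[R]_(1 + n))|.
Proof.
move=> mm Fm; set W : 'M[R]_(1 + n) := col_mx w F => dW.
pose Q : 'M[R]_(1 + n) := col_mx m F.
have uW : W \in unitmx by rewrite unitmxE unitfE.
have QT : Q^T = row_mx m^T F^T by rewrite /Q tr_col_mx.
have QQ : \det Q ^+ 2 = \det (F *m F^T).
  rewrite expr2 -[X in _ * X]det_tr -det_mulmx QT mul_col_row Fm.
  rewrite det_ublock (mx11_scalar (m *m m^T)) det_scalar1 -dotE mm mul1r//.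
have WQ : \det W * \det Q = dot w m * \det Q ^+ 2.
  rewrite QQ -[X in _ * X]det_tr -det_mulmx QT mul_col_row Fm.
  by rewrite det_ublock (mx11_scalar (w *m m^T)) det_scalar1 -dotE.
(* Expand m in the rows of W. Pairing with m kills the rows of F and shows that the coefficient of w
   is nonzero, and Q is W times a block triangular matrix with that coefficient as its
   determinant. *)
have dQ : \det Q != 0.
  pose a := m *m invmx W : 'rV[R]_(1 + n).
  have mE : m = lsubmx a *m w + rsubmx a *m F.
    by rewrite -mul_row_col hsubmxK /a mulmxKV.
  have QE : Q = block_mx (lsubmx a) (rsubmx a) 0 1%:M *m W.
    by rewrite mul_block_col mul0mx mul1mx add0r -mE.
  have la : lsubmx a 0 0 * dot w m = 1.
    have : dot m m = dot (lsubmx a *m w + rsubmx a *m F) m by rewrite -mE.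
    rewrite mm dotDl {1}(mx11_scalar (lsubmx a)) mul_scalar_mx dotZl.
    by rewrite [X in _ + X]dotE -mulmxA Fm mulmx0 [X in _ + X]mxE addr0.
  rewrite QE det_mulmx mulf_neq0// det_ublock (mx11_scalar (lsubmx a)).
  rewrite det_scalar1 det1 mulr1; apply: contra_eq_neq la => ->.
  by rewrite mul0r eq_sym oner_neq0.
rewrite -QQ sqrtr_sqr mulrC -normrM; congr `|_|.
by apply: (mulIf dQ); rewrite WQ expr2 mulrA.
Qed.

End Gram.

Section Directional.
Context {R : realType} {d : nat}.
Implicit Types (A : set 'rV[R]_d) (g : 'rV[R]_d -> R).

(** Written with partial derivatives because these are what [C1_closure] extends to the boundary;
    inside A it equals the derivative along v, by [dirderE]. *)
Definition dirder g (v : 'rV[R]_d) x := \sum_i v 0 i * pd i g x.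

Lemma dirderE A g v x : C1_closure A g -> A x -> 'D_v g x = dirder g v x.
Proof.
move=> [dg _ _] Ax; rewrite deriveE; last exact: dg.
rewrite [v in LHS]row_sum_delta linear_sum/=.
by apply: eq_bigr => i _; rewrite linearZ/= /pd deriveE//; exact: dg.
Qed.

Lemma extendable_dirder A g v : C1_closure A g -> extendable A (dirder g v).
Proof.
move=> Cg; apply: extendable_sum => i _; apply: (extendableM (f := cst (v 0 i))).
  exact: extendable_cst.
exact: C1_pd_extendable.
Qed.

End Directional.

Section SimplexClosure.
Context {R : realType}.

Lemma bar_segment m (s s' : 'rV[R]_m) t i :
  bar (s + t *: (s' - s)) i = (1 - t) * bar s i + t * bar s' i.
Proof.
have [j ->|->] := unliftP ord0 i; first by rewrite !bar_lift !mxE; ring.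
rewrite !bar0; under eq_bigr do rewrite !mxE.
by rewrite big_split/= -mulr_sumr sumrB; ring.
Qed.

Lemma refsimplex_nonempty m : exists s : 'rV[R]_m, refsimplex s.
Proof.
have b1 : \sum_(i < m.+1) (m.+1%:R^-1 : R) = 1.
  by rewrite sumr_const card_ord -[LHS]mulr_natr mulVf.
exists (\row_j m.+1%:R^-1); apply/refsimplexE => i.
by rewrite (bar_row b1) invr_gt0.
Qed.

(** Moving s slightly towards an interior point of the reference simplex makes all its barycentric
    coordinates positive. *)
Lemma amap_closure d m (p : 'I_m.+1 -> 'rV[R]_d) (C : set 'rV[R]_d) s :
  (forall s, refsimplex s -> C (amap p s)) -> (forall i, 0 <= bar s i) ->
  closure C (amap p s).
Proof.
move=> pC s0; have [s' rs'] := refsimplex_nonempty m.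
pose psi (t : R) := s + t *: (s' - s).
pose phi := amap p \o psi.
have phi0 : phi @ 0^'+ --> amap p s.
  rewrite (_ : amap p s = phi 0); last by rewrite /phi /psi/= scale0r addr0.
  apply: cvg_at_right_filter.
  have h : psi @ nbhs (0 : R) --> psi 0.
    exact: (cvgD (cvg_cst s) (cvgZr_tmp (a := s' - s) (@cvg_id _ (nbhs (0 : R))))).
  exact: (cvg_comp psi (amap p) h (@amap_continuous _ _ _ p (psi 0))).
have Cphi : \forall t \near (0 : R)^'+, C (phi t).
  near=> t; apply: pC; apply/refsimplexE => i; rewrite bar_segment.
  apply: ltr_wpDl; last by rewrite mulr_gt0//; move/refsimplexE : rs'; exact.
  by rewrite mulr_ge0// subr_ge0; near: t; apply: nbhs_right_le.
move=> B /phi0 Bphi.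
by have [t [Bt Ct]] := filter_ex (filterI Bphi Cphi); exists t.
Unshelve. all: by end_near. Qed.

End SimplexClosure.

Section Vcons.
Context {R : realType} {n : nat}.
Implicit Types (x : R) (v : 'rV[R]_n).

Lemma vcons0 x v : vcons x v 0 ord0 = x.
Proof.
rewrite /vcons mxE; case: splitP => j; last by [].
by rewrite ord1 mxE eqxx mulr1n.
Qed.

Lemma vcons_lift x v j : vcons x v 0 (lift ord0 j) = v 0 j.
Proof.
rewrite /vcons mxE; case: splitP => k /=; first by rewrite ord1.
by move=> jk; congr (v 0 _); apply: val_inj; case: jk.
Qed.

Lemma bar_vcons0 x v : bar (vcons x v) ord0 = bar v ord0 - x.
Proof.
rewrite !bar0 big_ord_recl vcons0; under eq_bigr do rewrite vcons_lift.
by rewrite opprD addrCA addrC.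
Qed.

(** Slices the reference simplex into segments along the first coordinate. The end x = 0 lies on the
    face opposite to vertex 1, the end [x = bar v ord0] on the face opposite to vertex 0. *)
Lemma refsimplex_vcons x v :
  refsimplex (vcons x v) <-> 0 < x < bar v ord0 /\ refsimplex v.
Proof.
rewrite !refsimplexE; split=> [h|[/andP[x0 xv] h] i].
  have hx : 0 < x < bar v ord0.
    have := h (lift ord0 ord0); rewrite bar_lift vcons0 => -> /=.
    by have := h ord0; rewrite bar_vcons0 subr_gt0.
  split=> // i; have [j ->|->] := unliftP ord0 i.
    by have := h (lift ord0 (lift ord0 j)); rewrite !bar_lift vcons_lift.
  by case/andP: hx; exact: lt_trans.
have [j ->|->] := unliftP ord0 i; last by rewrite bar_vcons0 subr_gt0.
rewrite bar_lift; have [k ->|->] := unliftP ord0 j; last by rewrite vcons0.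
by rewrite vcons_lift; have := h (lift ord0 k); rewrite bar_lift.
Qed.

Lemma bar_vcons_ge0 x v i : 0 <= x <= bar v ord0 -> refsimplex v ->
  0 <= bar (vcons x v) i.
Proof.
move=> /andP[x0 xv] /refsimplexE h.
have [j ->|->] := unliftP ord0 i; last by rewrite bar_vcons0 subr_ge0.
rewrite bar_lift; have [k ->|->] := unliftP ord0 j; first last.
  by rewrite vcons0.
by rewrite vcons_lift; have := h (lift ord0 k); rewrite bar_lift => /ltW.
Qed.

Context {d : nat} (p : 'I_n.+2 -> 'rV[R]_d).
Local Notation one := (lift ord0 ord0 : 'I_n.+2).

Lemma sedges_vcons : sedges p =
  col_mx (p one - p ord0) (sedges (p \o lift one)) :> 'M[R]_(1 + n, d).
Proof.
have l0 : lift one ord0 = ord0 by apply: val_inj.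
have l1 j : lift one (lift ord0 j) = lift ord0 (lift ord0 j) by apply: val_inj.
apply/row_matrixP => i; rewrite rowK.
have [j ->|->] := unliftP ord0 i.
  rewrite (_ : lift ord0 j = rshift 1 j); last exact: val_inj.
  by rewrite rowKd rowK/= l0 l1; congr (p (lift _ _) - _); exact: val_inj.
rewrite [X in row X](_ : _ = lshift n (ord0 : 'I_1)); last exact: val_inj.
by rewrite rowKu; apply/rowP => k; rewrite !mxE.
Qed.

Lemma amap_vcons x v :
  amap p (vcons x v) = x *: (p one - p ord0) + amap (p \o lift one) v.
Proof.
rewrite /amap sedges_vcons /vcons [X in _ + X](@mul_row_col _ 1 1 n d).
rewrite mul_scalar_mx addrCA.
by rewrite /= (_ : lift one ord0 = ord0)//; apply: val_inj.
Qed.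

(** Together with [amap_face1]: equal parameters on the two faces mark the two ends of one segment
    parallel to the edge, so both boundary terms are integrals over the same reference simplex. *)
Lemma amap_face0 v :
  amap (p \o lift ord0) v = amap p (vcons (bar v ord0) v).
Proof.
rewrite !amap_bar [in RHS]big_ord_recl bar_vcons0 subrr scale0r add0r.
rewrite !big_ord_recl /= bar_lift vcons0; congr (_ + _).
by apply: eq_bigr => j _; rewrite !bar_lift vcons_lift.
Qed.

Lemma amap_face1 v : amap (p \o lift one) v = amap p (vcons 0 v).
Proof. by rewrite amap_vcons scale0r add0r. Qed.

End Vcons.

(** * Integration along the segments parallel to an edge *)

Section Edge.
Context {R : realType} {d n : nat} (p : 'I_n.+2 -> 'rV[R]_d).
Context (C : set 'rV[R]_d) (g : 'rV[R]_d -> R).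
Local Notation mu := (@lebesgue_measure R).
Local Notation one := (lift ord0 ord0 : 'I_n.+2).
Local Notation e := (p one - p ord0).
Hypothesis gC : open_bounded C.
Hypothesis pC : forall s, refsimplex s -> C (amap p s).
Hypothesis Cg : C1_closure C g.

Let eg : extendable C g. Proof. exact: C1_extendable. Qed.
Let edg : extendable C (dirder g e). Proof. exact: extendable_dirder. Qed.

Let gam v (x : R) := amap p (vcons x v).

Let gamE v x : gam v x = x *: e + gam v 0.
Proof. by rewrite /gam !amap_vcons scale0r add0r. Qed.

Let gam_continuous v : continuous (gam v).
Proof.
move=> x; rewrite (funext (gamE v)).
exact: (cvgD (cvgZr_tmp (a := e) (@cvg_id _ (nbhs x))) (cvg_cst (gam v 0))).
Qed.

Let gam_closure v x : refsimplex v -> 0 <= x <= bar v ord0 -> closure C (gam v x).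
Proof. by move=> rv xv; apply: amap_closure => // i; exact: bar_vcons_ge0. Qed.

Let gam_in v x : refsimplex v -> 0 < x < bar v ord0 -> C (gam v x).
Proof. by move=> rv xv; apply/pC/refsimplex_vcons. Qed.

Let is_derive_gam (v : 'rV[R]_n) (x : R) : refsimplex v -> 0 < x < bar v ord0 ->
  derivable (g \o gam v) x 1 /\ 'D_1 (g \o gam v) x = 'D_e g (gam v x).
Proof.
move=> rv xv.
have E : (fun h : R => h^-1 *: (((g \o gam v) \o shift x) (h *: 1) - (g \o gam v) x))
   = (fun h => h^-1 *: ((g \o shift (gam v x)) (h *: e) - g (gam v x))).
  apply/funext => h /=; congr (_ *: (g _ - _)).
  by rewrite gamE [in RHS]gamE scalerDl -addrA /= -scalerA scale1r.
have dg := C1_derivable (v := e) Cg (gam_in rv xv).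
by split; rewrite /derivable /derive E.
Qed.

Let trace_gam (F : set_system R) (FF : Filter F) v x : refsimplex v ->
  0 <= x <= bar v ord0 -> F --> x -> (\forall y \near F, 0 <= y <= bar v ord0) ->
  forall f : 'rV[R]_d -> R, extendable C f ->
  (fun y => trace C f (gam v y)) @ F --> trace C f (gam v x).
Proof.
move=> rv xv Fx Fv f ef; apply: (trace_comp_cvg _ ef).
- exact: gam_closure.
- exact: (cvg_comp _ (gam v) Fx (@gam_continuous v x)).
- by apply: filterS Fv => y; exact: gam_closure.
Qed.

(** The ends of the segment may lie outside C. Replacing g and its derivative along the edge by
    their traces gives functions continuous on the closed segment, as the fundamental theorem
    requires, and unchanged in its interior. *)
Lemma edge_ftc (v : 'rV[R]_n) : refsimplex v ->
  (\int[mu]_(x in `]0%R, bar v ord0[) (dirder g e (gam v x))%:E =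
   (trace C g (gam v (bar v ord0)))%:E - (trace C g (gam v 0%R))%:E)%E.
Proof.
move=> rv; set c := bar v ord0; have c0 : 0 < c by move/refsimplexE : rv; exact.
pose f x := trace C (dirder g e) (gam v x).
have cf : {within `[0, c], continuous f}.
  apply/subspace_continuousP => x; rewrite /= in_itv/= => xc.
  apply: trace_gam => //; first exact: cvg_within.
  by rewrite near_withinE; apply: filterE => y; rewrite /= in_itv.
have dF : derivable_oo_LRcontinuous (fun x => trace C g (gam v x)) 0 c.
  split.
  - move=> x; rewrite in_itv/= => xc; have [dg _] := is_derive_gam rv xc.
    apply: near_eq_derivable dg.
    have : \forall y \near x, y \in `]0, c[ by apply: near_in_itvoo; rewrite in_itv.
    by apply: filterS => y; rewrite in_itv/= => yc; rewrite trace_in//; exact: gam_in.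
  - apply: (@trace_gam (0^'+) _ v 0 rv) => //; first by rewrite lexx ltW.
      by apply: (@cvg_at_right_filter _ _ id); exact: cvg_id.
    by near=> y; apply/andP; split => //; near: y; exact: nbhs_right_le.
  - apply: (@trace_gam (c^'-) _ v c rv) => //; first by rewrite lexx ltW.
      by apply: (@cvg_at_left_filter _ _ id); exact: cvg_id.
    by near=> y; apply/andP; split => //; near: y; exact: nbhs_left_ge.
have FE : {in `]0, c[, derive1 (fun x => trace C g (gam v x)) =1 f}.
  move=> x; rewrite in_itv/= => xc; rewrite derive1E.
  have [_ dE] := is_derive_gam rv xc.
  rewrite /f trace_in//; last exact: gam_in.
  rewrite -(dirderE _ Cg (gam_in rv xc)) -dE; apply: near_eq_derive.
  have : \forall y \near x, y \in `]0, c[ by apply: near_in_itvoo; rewrite in_itv.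
  by apply: filterS => y; rewrite in_itv/= => yc; rewrite trace_in//; exact: gam_in.
rewrite -(continuous_FTC2 c0 cf dF FE) integral_itv_bndoo//.
  apply: eq_integral => x; rewrite inE/= in_itv/= => xc.
  by rewrite /f trace_in//; exact: gam_in.
apply/measurable_EFinP; apply: (@measurable_funS _ _ _ _ `[0, c]%classic).
- exact: measurable_itv.
- exact: subset_itv_oo_cc.
- by apply: subspace_continuous_measurable_fun => //; exact: measurable_itv.
Unshelve. all: by end_near. Qed.

Let bcont_face (q : 'I_n.+1 -> 'rV[R]_d) :
  (forall v, refsimplex v -> closure C (amap q v)) ->
  bcont (@refsimplex R n) (fun v => trace C g (amap q v)).
Proof.
move=> qC; have [_ bC] := gC; have [oS _] := @open_bounded_refsimplex R n.
by apply: bcont_trace_comp => //; exact: amap_continuous.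
Qed.

Lemma edge_formula :
  vol_int (@refsimplex R n.+1) (fun s => dirder g e (amap p s)) =
  vol_int (@refsimplex R n) (fun v => trace C g (amap (p \o lift ord0) v)) -
  vol_int (@refsimplex R n) (fun v => trace C g (amap (p \o lift one) v)).
Proof.
have gS m := @open_bounded_refsimplex R m.
have mS m : measurable (@vec R m @^-1` @refsimplex R m).
  by apply: measurable_vec_open; case: (gS m).
pose H s := dirder g e (amap p s).
have bH : bcont (@refsimplex R n.+1) H.
  apply: (@bcont_comp R d n.+1 C (@refsimplex R n.+1) (dirder g e) (amap p)) => //; [exact: amap_continuous|].
  exact: extendable_bcont.
(* Extension by zero puts the integrand on a product space. Its section over v lives on the segment
   [0 < x < bar v ord0] if v is in the smaller simplex, and vanishes otherwise. *)
pose Hr s : \bar R := if s \in @refsimplex R n.+1 then (H s)%:E else 0%E.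
have iH : (leb n.+1).-integrable [set: n.+1.-tuple R] (Hr \o vec).
  by have := bcont_integrable (gS n.+1) bH; rewrite (integrable_mkcond _ (mS n.+1)).
have Hr_int : (\int[leb n.+1]_(t in @vec R n.+1 @^-1` @refsimplex R n.+1)
    (H (vec t))%:E = \int[leb n.+1]_t Hr (vec t))%E by rewrite integral_mkcond.
pose gb v := trace C g (amap (p \o lift ord0) v).
pose ga v := trace C g (amap (p \o lift one) v).
have inner v : (\int[mu]_x Hr (vcons x v) =
    if v \in @refsimplex R n then (gb v - ga v)%:E else 0)%E.
  case: ifPn => [/set_mem rv|/negP rv]; last first.
    rewrite integral0_eq// => x _; rewrite /Hr ifN//.
    by apply/negP => /set_mem/refsimplex_vcons[_ ?]; apply: rv; exact/mem_set.
  have := edge_ftc rv; rewrite /gam -amap_face0 -amap_face1 -EFinB => <-.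
  rewrite [RHS]integral_mkcond; apply: eq_integral => x _.
  rewrite /Hr patchE; congr (if _ then _ else _).
  apply/idP/idP => /set_mem; first by case/refsimplex_vcons => xv _; rewrite inE/= in_itv.
  by rewrite /= in_itv/= => xv; apply/mem_set/refsimplex_vcons.
have K_int : (\int[leb n]_(t in @vec R n @^-1` @refsimplex R n)
    (gb (vec t) - ga (vec t))%:E =
    \int[leb n]_t if vec t \in @refsimplex R n
                  then (gb (vec t) - ga (vec t))%:E else 0)%E.
  by rewrite integral_mkcond.
have bb : bcont (@refsimplex R n) gb.
  apply: bcont_face => v rv; rewrite amap_face0; apply: gam_closure => //.
  by rewrite lexx andbT ltW//; move/refsimplexE : rv; exact.
have ba : bcont (@refsimplex R n) ga.
  apply: bcont_face => v rv; rewrite amap_face1; apply: gam_closure => //.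
  by rewrite lexx/= ltW//; move/refsimplexE : rv; exact.
transitivity (vol_int (@refsimplex R n) (fun v => gb v + -1 * ga v)).
  rewrite /vol_int /Rintegral Hr_int leb_succ_fubini//.
  transitivity (fine (\int[leb n]_(t in @vec R n @^-1` @refsimplex R n)
    (gb (vec t) - ga (vec t))%:E)%E); last by congr fine; apply: eq_integral => t _; rewrite mulN1r.
  by rewrite K_int; congr fine; apply: eq_integral => t _; rewrite inner.
have bN : bcont (@refsimplex R n) (fun v => -1 * ga v).
  by apply: (bcontM (f := cst (-1))) => //; exact: bcont_cst.
by rewrite (vol_intD (gS n) bb bN) (vol_intZ _ (gS n) ba) mulN1r.
Qed.

End Edge.

(** * Facets of an element and their normals *)

Section Element.
Context {R : realType} {n : nat} (M : mesh R n.+1).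
Implicit Types (K F : {set 'I_(nvtx M)}) (a b : 'I_(nvtx M)).
Local Notation one := (lift ord0 ord0 : 'I_n.+2).

Definition simplicial K := #|K| = n.+2 /\ \det (edges K n.+1) != 0.

Lemma simplicial_enum K b : simplicial K -> b \in K ->
  exists tau : 'I_n.+2 -> 'I_(nvtx M), [/\ enumerates tau K, tau ord0 = b &
    \det (sedges (vtx M \o tau)) != 0].
Proof.
move=> [cK dK] bK; have [tau [tK _]] := enumerates_vpt cK.
have [it Kt] := tK.
have /imsetP[j _ bj] : b \in (tau @: [set: 'I_n.+2])%SET by rewrite -Kt.
have tK' : enumerates (tau \o tperm ord0 j) K.
  split; first by apply: inj_comp => //; exact: perm_inj.
  rewrite Kt; apply/setP => i; apply/imsetP/imsetP => -[k _ ->].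
    by exists (tperm ord0 j k); rewrite ?inE//= tpermK.
  by exists (tperm ord0 j k); rewrite ?inE.
exists (tau \o tperm ord0 j); split => //; first by rewrite /= tpermL bj.
exact: det_enumerates tK'.
Qed.

(** A second transposition brings a to position 1; since a differs from b, it leaves position 0
    alone. *)
Lemma simplicial_enum2 K a b : simplicial K -> a \in K -> b \in K -> a != b ->
  exists tau : 'I_n.+2 -> 'I_(nvtx M), [/\ enumerates tau K, tau ord0 = b,
    tau one = a & \det (sedges (vtx M \o tau)) != 0].
Proof.
move=> sK aK bK ab; have [cK dK] := sK.
have [tau [tK t0 _]] := simplicial_enum sK bK; have [it Kt] := tK.
have /imsetP[j _ aj] : a \in (tau @: [set: 'I_n.+2])%SET by rewrite -Kt.
have tK' : enumerates (tau \o tperm one j) K.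
  split; first by apply: inj_comp => //; exact: perm_inj.
  rewrite Kt; apply/setP => i; apply/imsetP/imsetP => -[k _ ->].
    by exists (tperm one j k); rewrite ?inE//= tpermK.
  by exists (tperm one j k); rewrite ?inE.
exists (tau \o tperm one j); split => //.
- rewrite /= tpermD// eq_sym; apply: contra_neq ab => j0.
  by rewrite aj -j0 t0.
- by rewrite /= tpermL aj.
- exact: det_enumerates tK'.
Qed.

Lemma enumerates_lift K (tau : 'I_n.+2 -> 'I_(nvtx M)) (h : 'I_n.+2) :
  enumerates tau K -> enumerates (tau \o lift h) (K :\ tau h).
Proof.
move=> [it Kt]; split; first by apply: inj_comp => //; exact: lift_inj.
rewrite Kt; apply/setP => i; rewrite !inE; apply/andP/imsetP.
  move=> [ih /imsetP[k _ ik]].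
  have [j kj|kh] := unliftP h k; first by exists j; rewrite ?inE//= ik kj.
  by rewrite ik kh eqxx in ih.
move=> [j _ ->]; split; last by apply/imsetP; exists (lift h j); rewrite ?inE.
by rewrite (inj_eq it) eq_sym neq_lift.
Qed.

Lemma simplicial_open_bounded K : simplicial K -> open_bounded (cell M K).
Proof.
move=> sK; have [b bK] : exists b, b \in K.
  by apply/set0Pn; rewrite -card_gt0; case: sK => ->.
have [tau [tK _ dE]] := simplicial_enum sK bK.
exact: cell_open_bounded tK dE.
Qed.

Lemma facetP K F : simplicial K -> facet K F -> exists2 b, b \in K & F = K :\ b.
Proof.
move=> [cK _] /andP[FK /eqP cF].
have /cards1P[b KF] : #|K :\: F| == 1%N.
  by rewrite cardsD (finset.setIidPr FK) cK cF subSnn.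
have bK : b \in K by have := set11 b; rewrite -KF inE => /andP[].
exists b => //; apply/setP => i; rewrite !inE.
have := congr1 (fun A : {set _} => i \in A) KF; rewrite !inE.
case: (boolP (i \in F)) => /= [/(fintype.subsetP FK) -> <- //|_ ->].
by case: eqP.
Qed.

Lemma facet_setD1 K b : simplicial K -> b \in K -> facet K (K :\ b).
Proof.
move=> [cK _] bK; rewrite /facet subD1set/=.
by have := cardsD1 b K; rewrite bK cK => -[e]; apply/eqP.
Qed.

Lemma sum_facet K (V : nmodType) (f : {set 'I_(nvtx M)} -> V) : simplicial K ->
  \sum_(F | facet K F) f F = \sum_(b in K) f (K :\ b).
Proof.
move=> sK; rewrite -(big_imset (h := fun b => K :\ b))/=; last first.
  move=> b b' bK b'K /setP/(_ b); rewrite !inE eqxx bK andbT/=.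
  by case: (b =P b').
apply: eq_bigl => F; apply/idP/imsetP => [/(facetP sK)[b]|[b bK ->]].
  by exists b.
exact: facet_setD1.
Qed.

Lemma cell_facet_closure K F x : simplicial K -> facet K F -> cell M F x ->
  closure (cell M K) x.
Proof.
move=> sK /(facetP sK)[b bK ->] Fx; have [tau [tK tb dE]] := simplicial_enum sK bK.
have tF := enumerates_lift ord0 tK; rewrite tb in tF.
have [s rs ->] := (cell_amap x tF).1 Fx.
have -> : amap (vtx M \o (tau \o lift ord0)) s =
    amap (vtx M \o tau) (\row_j bar s j).
  rewrite [RHS]amap_bar big_ord_recl [LHS]amap_bar.
  rewrite bar0 (eq_bigr (bar s)); last by move=> j _; rewrite mxE.
  rewrite sum_bar subrr scale0r add0r; apply: eq_bigr => j _.
  by rewrite bar_lift mxE.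
apply: amap_closure => [s' rs'|i]; first by apply/(cell_amap _ tK); exists s'.
have [j ->|->] := unliftP ord0 i.
  by rewrite bar_lift mxE ltW//; move/refsimplexE : rs; exact.
rewrite bar0 (eq_bigr (bar s)); last by move=> j _; rewrite mxE.
by rewrite sum_bar subrr.
Qed.

Lemma cell_nonempty m F : #|F| = m.+1 -> exists x, cell M F x.
Proof.
move=> cF; have [tau [tF _]] := enumerates_vpt cF.
have [s rs] := @refsimplex_nonempty R m.
by exists (amap (vtx M \o tau) s); apply/(cell_amap _ tF); exists s.
Qed.

(** A choice independent of the point, so that it comes out of facet integrals and can be compared
    between two elements sharing the facet. *)
Definition fnormal K F : 'rV[R]_n.+1 :=
  get [set m | forall x, cell M F x -> outward_normal (cell M K) x m].

(** In the last clause c is the height of b over the facet. Differences of two such equations show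
    that the edges of the facet are orthogonal to the normal. *)
Lemma fnormalP K b : simplicial K -> b \in K ->
  [/\ dot (fnormal K (K :\ b)) (fnormal K (K :\ b)) = 1,
      forall x, cell M (K :\ b) x ->
        outward_normal (cell M K) x (fnormal K (K :\ b)) &
      exists2 c, 0 < c & forall a, a \in K :\ b ->
        dot (vtx M a - vtx M b) (fnormal K (K :\ b)) = c].
Proof.
move=> sK bK; have [tau [tK tb dE]] := simplicial_enum sK bK.
have tF := enumerates_lift ord0 tK; rewrite tb in tF.
have [m [c [mm c0 mc]]] := exists_normal dE.
have mx x : cell M (K :\ b) x -> outward_normal (cell M K) x m.
  move=> /(cell_amap _ tF)[s rs ->].
  exact: (outward_normal_simplex dE mm c0 mc (fun x => cellE tK dE x) rs).
have gP : forall x, cell M (K :\ b) x ->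
    outward_normal (cell M K) x (fnormal K (K :\ b)).
  by apply: (@getPex _ [set m | forall x, cell M (K :\ b) x ->
    outward_normal (cell M K) x m]); exists m.
have cF : #|K :\ b| = n.+1 by have /andP[_ /eqP] := facet_setD1 sK bK.
have [x Fx] := cell_nonempty cF.
have -> : fnormal K (K :\ b) = m.
  exact: (outward_normal_unique (@subset_refl _ _) (gP x Fx) (mx x Fx)).
split => //; exists c => // a aF.
have [_ Ft] := tF; move: aF; rewrite Ft => /imsetP[j _ ->].
by rewrite -(mc j) /= tb.
Qed.

Lemma normal_at_facet K F x : simplicial K -> facet K F -> cell M F x ->
  normal_at (cell M K) x = fnormal K F.
Proof.
move=> sK /(facetP sK)[b bK ->] Fx; apply: normal_atP.
by have [_ + _] := fnormalP sK bK; exact.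
Qed.

End Element.

Section Divergence.
Context {R : realType} {n : nat} (M : mesh R n.+1).
Implicit Types (K F : {set 'I_(nvtx M)}) (a b : 'I_(nvtx M)).
Implicit Types (g : 'rV[R]_n.+1 -> R) (v : 'rV[R]_n.+1).
Local Notation one := (lift ord0 ord0 : 'I_n.+2).

Lemma facet_card K F : facet K F -> #|F| = n.+1.
Proof. by move=> /andP[_ /eqP]. Qed.

Lemma fmap_cell F s : #|F| = n.+1 -> refsimplex s -> cell M F (Defs.fmap F s).
Proof.
move=> cF rs; have [tau [tF /fmap_amap ->]] := enumerates_vpt cF.
by apply/(cell_amap _ tF); exists s.
Qed.

Lemma fmap_continuous F : #|F| = n.+1 -> continuous (@Defs.fmap R n.+1 M F).
Proof.
move=> cF; have [tau [tF /fmap_amap ->]] := enumerates_vpt cF.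
exact: amap_continuous.
Qed.

Lemma bcont_facet K F g : simplicial K -> facet K F ->
  extendable (cell M K) g ->
  bcont (@refsimplex R n) (fun s => trace (cell M K) g (Defs.fmap F s)).
Proof.
move=> sK KF eg; have [_ bK] := simplicial_open_bounded sK.
have [oS _] := @open_bounded_refsimplex R n.
apply: bcont_trace_comp => //; first exact/fmap_continuous/(facet_card KF).
move=> s rs; apply: (cell_facet_closure sK KF); apply: fmap_cell => //.
exact: facet_card KF.
Qed.

Lemma facet_intT F f : facet_int F setT f =
  Num.sqrt (\det (edges F n *m (edges F n)^T)) *
  vol_int (@refsimplex R n) (fun s => f (@Defs.fmap R n.+1 M F s)).
Proof.
rewrite /facet_int /vol_int; congr (_ * Rintegral _ _ _).
by apply/seteqP; split=> [t []|t].
Qed.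

Lemma facet_int_trace K F g (tau : 'I_n.+1 -> 'I_(nvtx M)) :
  simplicial K -> facet K F -> extendable (cell M K) g -> enumerates tau F ->
  facet_int F setT (trace (cell M K) g) = surf (vtx M \o tau) (trace (cell M K) g).
Proof.
move=> sK KF eg tF; apply: facet_int_surf => //.
have [_ bK] := simplicial_open_bounded sK; have [oS _] := @open_bounded_refsimplex R n.
apply: bcont_trace_comp => //; first exact: amap_continuous.
move=> s rs; apply: (cell_facet_closure sK KF).
by apply/(cell_amap _ tF); exists s.
Qed.

(** [edge_formula] carries the volume Jacobian [|\det E|] where facet integrals carry the Gram
    surface element. By [gram] the two differ, on either facet, by the normal component of the edge,
    which is positive on the facet opposite to b and negative on the one opposite to a. *)
Lemma edge_divergence K a b g : simplicial K -> a \in K -> b \in K -> a != b ->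
  C1_closure (cell M K) g ->
  vol_int (cell M K) (dirder g (vtx M a - vtx M b)) =
  dot (vtx M a - vtx M b) (fnormal K (K :\ b)) *
    facet_int (K :\ b) setT (trace (cell M K) g) +
  dot (vtx M a - vtx M b) (fnormal K (K :\ a)) *
    facet_int (K :\ a) setT (trace (cell M K) g).
Proof.
move=> sK aK bK ab Cg.
have [tau [tK tb ta dE]] := simplicial_enum2 sK aK bK ab.
have eg := C1_extendable Cg; have gK := simplicial_open_bounded sK.
have tFb := enumerates_lift ord0 tK; rewrite tb in tFb.
have tFa := enumerates_lift one tK; rewrite ta in tFa.
rewrite (facet_int_trace sK (facet_setD1 sK bK) eg tFb).
rewrite (facet_int_trace sK (facet_setD1 sK aK) eg tFa).
have bd : bcont (cell M K) (dirder g (vtx M a - vtx M b)).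
  by apply: (extendable_bcont gK); apply: extendable_dirder; exact: Cg.
rewrite (vol_int_cell tK dE bd).
have pC s : refsimplex s -> cell M K (amap (vtx M \o tau) s).
  by move=> rs; apply/(cell_amap _ tK); exists s.
have := edge_formula gK pC Cg; rewrite /= ta tb => ->.
rewrite mulrBr /surf !mulrA.
set p := vtx M \o tau in dE *; set e := vtx M a - vtx M b.
have pe : e = p one - p ord0 by rewrite /p /= ta tb.
have [mb1 _ [cb cb0 cbE]] := fnormalP sK bK.
have [ma1 _ [ca ca0 caE]] := fnormalP sK aK.
have ab' : a \in K :\ b by rewrite !inE ab.
have ba' : b \in K :\ a by rewrite !inE eq_sym ab.
have inFb j : tau (lift ord0 j) \in K :\ b.
  by case: tFb => _ ->; apply/imsetP; exists j; rewrite ?inE.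
have inFa j : tau (lift one j) \in K :\ a.
  by case: tFa => _ ->; apply/imsetP; exists j; rewrite ?inE.
have dd (x y z m : 'rV[R]_n.+1) : dot (x - y) m = dot (x - z) m - dot (y - z) m :> R.
  by rewrite !dotBl; ring.
have Fb0 : sedges (p \o lift ord0) *m (fnormal K (K :\ b))^T = 0.
  apply/colP => j; rewrite [RHS]mxE -[LHS]/((_ *m _) j 0).
  transitivity ((row j (sedges (p \o lift ord0)) *m (fnormal K (K :\ b))^T) 0 0).
    by rewrite -row_mul [RHS]mxE.
  by rewrite rowK -dotE /p/= (dd _ _ (vtx M b)) !cbE ?inFb// subrr.
have Fa0 : sedges (p \o lift one) *m (fnormal K (K :\ a))^T = 0.
  apply/colP => j; rewrite [RHS]mxE -[LHS]/((_ *m _) j 0).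
  transitivity ((row j (sedges (p \o lift one)) *m (fnormal K (K :\ a))^T) 0 0).
    by rewrite -row_mul [RHS]mxE.
  by rewrite rowK -dotE /p/= (dd _ _ (vtx M a)) !caE ?inFa// subrr.
(* Completed by the row e, the edge matrix of either face has the determinant of [sedges p]:
   directly for the face based at [p ord0], and after adding e to every other row for the face based
   at [p one]. *)
have E1 := sedges_vcons p; rewrite -pe in E1.
have E0 : sedges p = block_mx 1%:M 0 (const_mx 1) 1%:M *m
    col_mx e (sedges (p \o lift ord0)) :> 'M[R]_(1 + n).
  rewrite mul_block_col mul1mx mul0mx addr0 mul1mx E1; congr col_mx.
  apply/row_matrixP => j; rewrite [RHS]raddfD/= row_mul !rowK/=.
  rewrite (_ : row j (const_mx 1) = 1%:M) ?mul1mx; last first.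
    by apply/rowP => i; rewrite !mxE ord1 eqxx.
  rewrite (_ : lift one (lift ord0 j) = lift ord0 (lift ord0 j)); last exact: val_inj.
  rewrite (_ : lift one ord0 = ord0); last exact: val_inj.
  by rewrite pe [RHS]addrC subrKA.
have dE0 : \det (sedges p) = \det (col_mx e (sedges (p \o lift ord0)) : 'M[R]_(1 + n)).
  by rewrite [LHS](congr1 determinant E0) det_mulmx det_lblock !det1 !mul1r.
have dE1 : \det (sedges p) = \det (col_mx e (sedges (p \o lift one)) : 'M[R]_(1 + n)).
  exact: (congr1 determinant E1).
have gb := gram mb1 Fb0 (w := e); rewrite -dE0 in gb.
have ga := gram ma1 Fa0 (w := e); rewrite -dE1 in ga.
have ea : dot e (fnormal K (K :\ a)) = - ca.
  by rewrite /e -opprB dotNl (caE _ ba').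
rewrite (cbE _ ab') gtr0_norm// in gb.
rewrite ea normrN gtr0_norm// in ga.
rewrite (cbE _ ab') ea -/e !mulNr; congr (_ - _).
  by rewrite -(gb dE) [Num.sqrt _ * cb]mulrC.
by rewrite -(ga dE) [Num.sqrt _ * ca]mulrC.
Qed.

End Divergence.

Section Divergence.
Context {R : realType} {n : nat} (M : mesh R n.+1).
Implicit Types (K F : {set 'I_(nvtx M)}) (a b : 'I_(nvtx M)).
Implicit Types (g : 'rV[R]_n.+1 -> R) (v : 'rV[R]_n.+1).

Lemma edge_sum K a b (I : {set 'I_(nvtx M)} -> R) : simplicial K ->
  a \in K -> b \in K -> a != b ->
  \sum_(F | facet K F) dot (vtx M a - vtx M b) (fnormal K F) * I F =
  dot (vtx M a - vtx M b) (fnormal K (K :\ b)) * I (K :\ b) +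
  dot (vtx M a - vtx M b) (fnormal K (K :\ a)) * I (K :\ a).
Proof.
move=> sK aK bK ab.
rewrite (sum_facet (fun F => dot (vtx M a - vtx M b) (fnormal K F) * I F) sK).
rewrite (bigD1 b)//= (bigD1 a) ?aK//= big1 ?addr0// => c /andP[/andP[cK cb] ca].
have [_ _ [k _ kE]] := fnormalP sK cK.
rewrite (_ : dot _ _ = 0) ?mul0r//.
rewrite -(subrKA (vtx M c)) -[vtx M c - vtx M b]opprB dotBl.
by rewrite !kE ?subrr// !inE eq_sym ?ca ?cb.
Qed.

Lemma dir_divergence K g v : simplicial K -> C1_closure (cell M K) g ->
  vol_int (cell M K) (dirder g v) =
  \sum_(F | facet K F)
    dot v (fnormal K F) * facet_int F setT (trace (cell M K) g).
Proof.
move=> sK Cg; have gK := simplicial_open_bounded sK.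
have [b bK] : exists b, b \in K.
  by apply/set0Pn; rewrite -card_gt0; case: sK => ->.
have [tau [tK tb dE]] := simplicial_enum sK bK.
set p := vtx M \o tau in dE; pose c := v *m invmx (sedges p).
have vE : v = \sum_j c 0 j *: (p (lift ord0 j) - p ord0).
  have uE : sedges p \in unitmx by rewrite unitmxE unitfE.
  rewrite -[LHS](mulmxKV uE).
  by rewrite mulmx_sum_row; apply: eq_bigr => j _; rewrite rowK.
have bd w : bcont (cell M K) (dirder g w).
  by apply: (extendable_bcont gK); apply: extendable_dirder; exact: Cg.
have tauK j : tau j \in K by case: tK => _ ->; rewrite imset_f ?inE.
have tauD j : tau (lift ord0 j) != b.
  by rewrite -tb; case: tK => it _; rewrite (inj_eq it) eq_sym neq_lift.
transitivity (vol_int (cell M K)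
    (fun x => \sum_j c 0 j * dirder g (p (lift ord0 j) - p ord0) x)).
  apply: eq_vol_int => x _; rewrite /dirder [in LHS]vE.
  under eq_bigr do rewrite summxE mulr_suml.
  rewrite exchange_big/=; apply: eq_bigr => j _; rewrite mulr_sumr.
  by apply: eq_bigr => i _; rewrite mxE mulrA.
rewrite (vol_int_sum (f := fun j x => c 0 j * dirder g (p (lift ord0 j) - p ord0) x) _ gK).
  under eq_bigr do rewrite (vol_intZ _ gK (bd _)).
  rewrite [in RHS]vE.
  transitivity (\sum_(F | facet K F) \sum_j c 0 j *
    (dot (p (lift ord0 j) - p ord0) (fnormal K F) *
      facet_int F setT (trace (cell M K) g))).
    rewrite exchange_big/=; apply: eq_bigr => j _; rewrite -mulr_sumr /p/= tb.
    congr (_ * _); rewrite (edge_divergence sK _ bK)//.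
    by rewrite (edge_sum (fun F => facet_int F setT (trace (cell M K) g))).
  apply: eq_bigr => F _; rewrite dotE mulmx_suml summxE mulr_suml.
  by apply: eq_bigr => j _; rewrite -dotE dotZl mulrA.
move=> j _; apply: (bcontM (f := cst (c 0 j))); [exact: bcont_cst|exact: bd].
Qed.

Theorem divergence K (G : 'I_n.+1 -> 'rV[R]_n.+1 -> R) : simplicial K ->
  (forall i, C1_closure (cell M K) (G i)) ->
  vol_int (cell M K) (fun x => \sum_i pd i (G i) x) =
  \sum_(F | facet K F) facet_int F setT
    (fun x => \sum_i fnormal K F 0 i * trace (cell M K) (G i) x).
Proof.
move=> sK CG; have gK := simplicial_open_bounded sK.
have gS := @open_bounded_refsimplex R n.
rewrite (vol_int_sum (f := fun i x => pd i (G i) x) _ gK); last first.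
  by move=> i _; apply: (extendable_bcont gK); exact: C1_pd_extendable.
transitivity (\sum_i \sum_(F | facet K F) fnormal K F 0 i *
    facet_int F setT (trace (cell M K) (G i))).
  apply: eq_bigr => i _.
  rewrite (_ : vol_int _ _ = vol_int (cell M K) (dirder (G i) (delta_mx 0 i))).
    rewrite (dir_divergence _ sK (CG i)); apply: eq_bigr => F _; congr (_ * _).
    rewrite /dot (bigD1 i)//= big1 ?addr0; first by rewrite mxE !eqxx mul1r.
    by move=> j ji; rewrite mxE eqxx (negbTE ji) mul0r.
  apply: eq_vol_int => x _; rewrite /dirder (bigD1 i)//= big1 ?addr0.
    by rewrite mxE !eqxx mul1r.
  by move=> j ji; rewrite mxE eqxx (negbTE ji) mul0r.
rewrite exchange_big/=; apply: eq_bigr => F KF; rewrite facet_intT.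
have bF i := bcont_facet sK KF (C1_extendable (CG i)).
rewrite (vol_int_sum (f := fun i s => fnormal K F 0 i *
    trace (cell M K) (G i) (Defs.fmap F s)) _ gS).
  rewrite mulr_sumr; apply: eq_bigr => i _.
  by rewrite (vol_intZ _ gS (bF i)) facet_intT mulrCA.
move=> i _; apply: (bcontM (f := cst (fnormal K F 0 i))); last exact: bF.
exact: bcont_cst.
Qed.

End Divergence.

(** * Fluxes on the skeleton *)

Section AeIntegral.
Context d (T : measurableType d) (R : realType).
Context (mu : {measure set T -> \bar R}).
Local Open Scope ereal_scope.
Import HBNNSimple.

(* Measurability is not assumed: the hatted data [h] of the facet terms are only
   known through (E6) and (E8). *)
Lemma ge0_ae_le_integralT (f g : T -> \bar R) :
  (forall x, 0 <= f x) -> (forall x, 0 <= g x) ->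
  {ae mu, forall x, f x <= g x} -> \int[mu]_x f x <= \int[mu]_x g x.
Proof.
move=> f0 g0 [N [mN N0 fgN]]; rewrite !ge0_integralTE//.
apply: ge_ereal_sup => _ [h /= hf] <-.
have mCN : measurable (~` N) by exact: measurableC.
(* Simple functions are measurable, so h may be set to zero on the null set N without changing its
   integral; the result lies below g everywhere. *)
pose h' := mul_nnsfun h (indic_nnsfun R mCN).
have h'E x : h' x = (h x * \1_(~` N) x)%R by [].
apply: le_ereal_sup_tmp; exists (sintegral mu h').
  exists h'; [move=> x; rewrite h'E indicE|by []].
  have [xN|xN] := boolP (x \in ~` N); last by rewrite mulr0.
  rewrite mulr1 (le_trans (hf x))//; apply: contrapT => fg.
  by move: xN; rewrite inE; apply; exact: fgN.
have hE (k : {nnsfun T >-> R}) : sintegral mu k = \int[mu]_x (k x)%:E.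
  by rewrite integral_nnsfun// patch_setT.
rewrite !hE (ge0_ae_eq_integral (g := fun x => (h' x)%:E))//.
- exact/measurable_EFinP.
- exact/measurable_EFinP.
- by move=> x _; rewrite lee_fin.
- by move=> x _; rewrite lee_fin.
exists N; split => // x; apply: contra_notP => xN _.
by congr EFin; rewrite h'E indicE mem_set ?mulr1.
Qed.

Lemma ge0_ae_eq_integralT (D : set T) (f g : T -> \bar R) :
  (forall x, 0 <= f x) -> (forall x, 0 <= g x) ->
  {ae mu, forall x, D x -> f x = g x} ->
  \int[mu]_(x in D) f x = \int[mu]_(x in D) g x.
Proof.
move=> f0 g0 fg; rewrite integral_mkcond [RHS]integral_mkcond.
have r0 (k : T -> \bar R) : (forall x, 0 <= k x) -> forall x, 0 <= (k \_ D) x.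
  by move=> k0 x; rewrite patchE; case: ifP.
apply/eqP; rewrite eq_le; apply/andP; split;
  (apply: ge0_ae_le_integralT; [exact: r0|exact: r0|]);
  apply: filterS fg => x fgx; rewrite !patchE;
  by case: ifPn => // /set_mem Dx; rewrite fgx.
Qed.

Lemma ae_eq_Rintegral (D : set T) (f g : T -> R) :
  {ae mu, forall x, D x -> f x = g x} ->
  Rintegral mu D f = Rintegral mu D g.
Proof.
move=> fg; rewrite /Rintegral integralE [in RHS]integralE.
congr (fine (_ - _)); apply: ge0_ae_eq_integralT => //;
  by apply: filterS fg => x fgx /fgx; rewrite ?funeposE ?funenegE => ->.
Qed.

End AeIntegral.

Section Balance.
Context {R : realType} {n : nat}.
Implicit Types (A S G : set 'rV[R]_n) (a b c f : 'rV[R]_n -> R).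

Lemma bcont_eq A f g : open A -> (forall x, A x -> f x = g x) ->
  bcont A f -> bcont A g.
Proof.
move=> oA fg [cf [M fM]]; split=> [x Ax|]; last first.
  by exists M => x Ax; rewrite -fg//; exact: fM.
suff : g @ nbhs x --> g x by [].
rewrite -(fg x Ax); apply: cvg_trans (cf x Ax); apply: near_eq_cvg.
have nA : nbhs x A by exact: open_nbhs_nbhs.
by apply: filterS nA => y Ay; rewrite fg.
Qed.

Lemma bcont_max0 A f : bcont A f -> bcont A (fun x => Num.max (f x) 0).
Proof.
move=> [cf [M fM]]; split=> [x Ax|].
  suff : (fun y => Num.max (f y) 0) @ nbhs x --> Num.max (f x) 0 by [].
  under eq_fun do rewrite maxr_absE; rewrite maxr_absE.
  apply: (@cvgM _ _ _ _ (fun y => f y + 0 + `|f y - 0|)); last exact: cvg_cst.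
  apply: (@cvgD _ _ _ _ _ (fun y => f y + 0)).
    by under eq_fun do rewrite addr0; rewrite addr0; exact: cf.
  by apply: cvg_norm; under eq_fun do rewrite subr0; rewrite subr0; exact: cf.
exists M => x Ax; have := fM x Ax; rewrite !ler_norml => /andP[h1 h2].
by rewrite /Num.max; case: ifP => // _; lra.
Qed.

(** All that is known of c is the relation to a and b almost everywhere on G, so its integral is
    that of b - a, and linearity is applied to the integrable a and b alone. As a vanishes almost
    everywhere off G, its integral over S is one over S and G. *)
Lemma vol_int_balance S G a b c : open_bounded S -> measurable (@vec R n @^-1` G) ->
  bcont S a -> bcont S b ->
  {ae leb n, forall t, S (vec t) ->
    (~ G (vec t) -> a (vec t) = 0) /\
    (G (vec t) -> a (vec t) - b (vec t) + c (vec t) = 0)} ->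
  vol_int S a - vol_int [set s | S s /\ G s] b
    + vol_int [set s | S s /\ G s] c = 0.
Proof.
move=> gS mG ba bb abc; have mS : measurable (@vec R n @^-1` S).
  by apply: measurable_vec_open; case: gS.
pose SG := @vec R n @^-1` S `&` @vec R n @^-1` G.
have mSG : measurable SG by exact: measurableI.
have iSG f : bcont S f -> (leb n).-integrable SG (EFin \o (f \o vec)).
  move=> bf; apply: (integrableS mS mSG); first by move=> t [].
  exact: bcont_integrable.
have -> : vol_int S a = vol_int [set s | S s /\ G s] a.
  rewrite /vol_int [RHS]Rintegral_mkcondr; apply: ae_eq_Rintegral.
  apply: filterS abc => t h St; have [h1 _] := h St; rewrite patchE.
  by case: ifPn => // /negP Gt; apply: h1 => Gt'; apply: Gt; exact/mem_set.
have -> : vol_int [set s | S s /\ G s] c =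
    vol_int [set s | S s /\ G s] b - vol_int [set s | S s /\ G s] a.
  rewrite /vol_int -(RintegralB mSG (iSG b bb) (iSG a ba)).
  apply: ae_eq_Rintegral; apply: filterS abc => t h [St Gt].
  by have [_ /(_ Gt) e] := h St; rewrite /=; lra.
by ring.
Qed.

Lemma vol_int_null S G f : {ae leb n, forall t, S (vec t) -> ~ G (vec t)} ->
  vol_int [set s | S s /\ G s] f = 0.
Proof.
move=> SG; rewrite /vol_int (ae_eq_Rintegral (g := cst 0)).
  by rewrite /Rintegral integral0_eq.
by apply: filterS SG => t h [St Gt]; case: (h St).
Qed.

End Balance.

Section DotMatrix.
Context {R : realType} {d : nat}.
Implicit Types (C D : 'M[R]_d) (a b : 'rV[R]_d).

Lemma ddot_tens C a b : ddot C (tens a b) = dot (a *m C) b.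
Proof.
rewrite /ddot /dot exchange_big/=; apply: eq_bigr => j _.
by rewrite mxE mulr_suml; apply: eq_bigr => i _; rewrite !mxE; ring.
Qed.

Lemma mul_tens a b m : m *m tens a b = dot a m *: b.
Proof.
apply/rowP => j; rewrite !mxE mulr_suml.
by apply: eq_bigr => i _; rewrite mxE; ring.
Qed.

End DotMatrix.

(** * Facets inside the domain and on its boundary *)

Section Skeleton.
Context {R : realType} {n : nat} (M : mesh R n.+1) (Om : set 'rV[R]_n.+1).
Implicit Types (K F : {set 'I_(nvtx M)}).

Lemma within_extendable (V : normedModType R) (f : 'rV[R]_n.+1 -> V) :
  {within closure Om, continuous f} -> extendable Om f.
Proof.
move=> /subspace_continuousP cf x Ox; apply/cvg_ex; exists (f x).
apply: cvg_trans (cf x Ox); apply: cvg_app; apply: within_subset.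
exact: subset_closure.
Qed.

Hypothesis tM : triangulation M Om.

Lemma elts_simplicial K : K \in elts M -> simplicial K.
Proof. by case: tM => _ h _ _ _; exact: h. Qed.

Lemma elts_subset K : K \in elts M -> cell M K `<=` Om.
Proof. by case: tM => _ _ [h _] _ _; exact: h. Qed.

Lemma fmap_closure K F s : K \in elts M -> facet K F -> refsimplex s ->
  closure Om (Defs.fmap F s).
Proof.
move=> KM KF rs; apply: (closureS (elts_subset KM)).
apply: (cell_facet_closure (elts_simplicial KM) KF); apply: fmap_cell => //.
exact: facet_card KF.
Qed.

Lemma outward_normal_facet K F x m : K \in elts M -> facet K F -> cell M F x ->
  outward_normal Om x m -> m = fnormal K F.
Proof.
move=> KM KF Fx Om_m; have sK := elts_simplicial KM.
have [b bK Fb] := facetP sK KF; rewrite Fb in Fx *.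
have [_ /(_ x Fx) h _] := fnormalP sK bK.
exact/esym/(outward_normal_unique (elts_subset KM) h Om_m).
Qed.

(** A direction pointing into both elements would put a short piece of ray in their empty
    intersection. Directions entering K therefore do not enter K', and [halfspace_unique] turns this
    into an equality of normals. *)
Lemma fnormal_opp K K' F : K \in elts M -> K' \in elts M -> K != K' ->
  facet K F -> facet K' F -> fnormal K' F = - fnormal K F.
Proof.
move=> KM K'M KK' KF K'F.
have sK := elts_simplicial KM; have sK' := elts_simplicial K'M.
have [b bK Fb] := facetP sK KF; have [b' bK' Fb'] := facetP sK' K'F.
have [x Fx] := cell_nonempty (facet_card KF).
have [m1 /(_ x) h1 _] := fnormalP sK bK; have [m1' /(_ x) h1' _] := fnormalP sK' bK'.
rewrite -Fb in m1 h1; rewrite -Fb' in m1' h1'.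
have [_ inK _] := h1 Fx; have [_ inK' _] := h1' Fx.
suff e : fnormal K F = - fnormal K' F by rewrite e opprK.
apply: halfspace_unique => //; first by rewrite dotNl dotNr opprK.
move=> w wK; rewrite dotNr oppr_le0 leNgt; apply/negP => wK'.
have [t [Kt K't]] := filter_ex (filterI (inK w wK) (inK' w wK')).
have [_ _ [_ /(_ K K' KM K'M KK') K0] _ _] := tM.
by have : (cell M K `&` cell M K') (x + t *: w) by []; rewrite K0.
Qed.

(** An outward normal of the domain would coincide with both facet normals, which are opposite unit
    vectors. *)
Lemma no_outward_normal K K' F x m : K \in elts M -> K' \in elts M -> K != K' ->
  facet K F -> facet K' F -> cell M F x -> ~ outward_normal Om x m.
Proof.
move=> KM K'M KK' KF K'F Fx xm.
have e := outward_normal_facet KM KF Fx xm.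
have := outward_normal_facet K'M K'F Fx xm.
rewrite (fnormal_opp KM K'M KK' KF K'F) -e => /eqP.
rewrite -addr_eq0 -mulr2n -scaler_nat scaler_eq0 pnatr_eq0/= => /eqP m0.
by have [mm _ _] := xm; move: mm; rewrite m0 dotE mul0mx mxE => /eqP; rewrite eq_sym oner_eq0.
Qed.

Lemma bcont_poly K F q k : K \in elts M -> facet K F -> polyfun k q ->
  bcont (@refsimplex R n) (fun s => q (Defs.fmap F s)).
Proof.
move=> KM KF qk; have [oS _] := @open_bounded_refsimplex R n.
have sK := elts_simplicial KM.
have eq1 A : extendable A q by exact/C1_extendable/(C1_polyfun _ qk).
have cq : continuous q.
  by move=> x; apply: (@extendable_continuous _ _ _ setT) => //; exact: openT.
apply: (bcont_eq oS _ (bcont_facet sK KF (eq1 (cell M K)))) => s rs.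
apply: (@trace_within_continuous _ _ _ _ (cell M K)) => //.
  exact: continuous_subspaceT.
apply: (cell_facet_closure sK KF); apply: fmap_cell => //.
exact: facet_card KF.
Qed.

Lemma bcont_test K F v k j : K \in elts M -> facet K F -> Vhhat M k v ->
  bcont (@refsimplex R n) (fun s => v (Defs.fmap F s) 0 j).
Proof.
move=> KM KF /(_ K F j KM KF)[q qk vq]; have [oS _] := @open_bounded_refsimplex R n.
apply: (bcont_eq oS _ (bcont_poly KM KF qk)) => s rs.
by rewrite vq//; apply: fmap_cell => //; exact: facet_card KF.
Qed.

Hypothesis bOm : bounded_set Om.

Lemma bcont_field K F (f : 'rV[R]_n.+1 -> 'rV[R]_n.+1) i :
  K \in elts M -> facet K F -> {within closure Om, continuous f} ->
  bcont (@refsimplex R n) (fun s => f (Defs.fmap F s) 0 i).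
Proof.
move=> KM KF cf; have [oS _] := @open_bounded_refsimplex R n.
have ef := within_extendable cf.
have b1 : bcont (@refsimplex R n)
    (fun s => trace Om (fun x => f x 0 i) (Defs.fmap F s)).
  apply: bcont_trace_comp => //.
  - exact/fmap_continuous/(facet_card KF).
  - by move=> s; exact: fmap_closure KM KF.
  - exact: extendable_entry.
apply: (bcont_eq oS _ b1) => s rs.
rewrite (trace_entry _ _ ef (fmap_closure KM KF rs)).
by rewrite (trace_within_continuous cf (@subset_refl _ _) (fmap_closure KM KF rs)).
Qed.

Lemma bcont_traceOm K F (f : 'rV[R]_n.+1 -> R) :
  K \in elts M -> facet K F -> extendable Om f ->
  bcont (@refsimplex R n) (fun s => trace Om f (Defs.fmap F s)).
Proof.
move=> KM KF ef; have [oS _] := @open_bounded_refsimplex R n.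
apply: bcont_trace_comp => //; first exact/fmap_continuous/(facet_card KF).
by move=> s; exact: fmap_closure KM KF.
Qed.

End Skeleton.

Section SkeletonBalance.
Context {R : realType} {n : nat} (M : mesh R n.+1) (Om : set 'rV[R]_n.+1).
Context (GamD GamN : set 'rV[R]_n.+1).
Implicit Types (K F : {set 'I_(nvtx M)}).
Hypothesis tM : triangulation M Om.
Hypothesis bOm : bounded_set Om.
Hypothesis mGamN : measurable (@vec R n.+1 @^-1` GamN).
Hypothesis GamN_bdry : GamN `<=` bdry Om.
Hypothesis bdry_cover :
  ae_skeleton M (fun x => bdry Om x -> GamD x \/ GamN x).
Hypothesis bdry_normal :
  ae_skeleton M (fun x => bdry Om x -> exists m, outward_normal Om x m).

Context (T : 'I_n.+1 -> 'I_n.+1 -> 'rV[R]_n.+1 -> R).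
Context (u z h v : 'rV[R]_n.+1 -> 'rV[R]_n.+1) (k : nat).
Definition trace_mx x : 'M[R]_n.+1 := \matrix_(i, j) trace Om (T i j) x.
Hypothesis eT : forall i j, extendable Om (T i j).
Hypothesis cu : {within closure Om, continuous u}.
Hypothesis cz : {within closure Om, continuous z}.
Hypothesis vk : Vhhat M k v.
Hypothesis v0 : ae_skeleton M (fun x => GamD x -> v x = 0).
(** Common form of (E6) and (E8), solved for the datum h: T is the total flux, convection included,
    and z is the transported field, velocity or magnetic field. *)
Hypothesis hE : forall x m, GamN x -> outward_normal Om x m ->
  h x = Num.max (dot (u x) m) 0 *: z x - m *m trace_mx x.

Let a K F x := ddot (trace_mx x) (tens (fnormal K F) (v x)).
Let b K F x := Num.max (dot (u x) (fnormal K F)) 0 * dot (z x) (v x).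
Let c x := dot (h x) (v x).

Let measurable_fmap F : #|F| = n.+1 ->
  measurable (@vec R n @^-1` (@Defs.fmap R n.+1 M F @^-1` GamN)).
Proof.
move=> cF; have [tau [tF /fmap_amap ->]] := enumerates_vpt cF.
set p := vtx M \o tau.
have := measurable_affine (sedges p) (p ord0) measurableT mGamN.
rewrite setTI; congr measurable; apply/seteqP; split => t /=;
  by rewrite tupK addrC.
Qed.

Let bcont_a K F : K \in elts M -> facet K F ->
  bcont (@refsimplex R n) (fun s => a K F (Defs.fmap F s)).
Proof.
move=> KM KF; have [oS _] := @open_bounded_refsimplex R n.
have b1 : bcont (@refsimplex R n) (fun s => \sum_i \sum_j
    (trace Om (T i j) (Defs.fmap F s) *
      (fnormal K F 0 i * v (Defs.fmap F s) 0 j))).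
  apply: bcont_sum => i _; apply: bcont_sum => j _; apply: bcontM.
    exact: (bcont_traceOm tM bOm KM KF (@eT i j)).
  apply: (bcontM (f := cst (fnormal K F 0 i))); first exact: bcont_cst.
  exact: (bcont_test tM _ KM KF vk).
apply: (bcont_eq oS _ b1) => s rs; rewrite /a /ddot.
by apply: eq_bigr => i _; apply: eq_bigr => j _; rewrite !mxE.
Qed.

Let bcont_b K F : K \in elts M -> facet K F ->
  bcont (@refsimplex R n) (fun s => b K F (Defs.fmap F s)).
Proof.
move=> KM KF; rewrite /b /dot; apply: bcontM; last first.
  apply: bcont_sum => i _; apply: bcontM.
    exact: (bcont_field tM bOm _ KM KF cz).
  exact: (bcont_test tM _ KM KF vk).
apply: bcont_max0; apply: bcont_sum => i _.
apply: (bcontM (g := cst (fnormal K F 0 i))); last exact: bcont_cst.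
exact: (bcont_field tM bOm _ KM KF cu).
Qed.

Let facet_intE F (A : set 'rV[R]_n.+1) f : facet_int F A f =
  Num.sqrt (\det (edges F n *m (edges F n)^T)) *
  vol_int [set s | refsimplex s /\ A (Defs.fmap F s)]
    (fun s => f (@Defs.fmap R n.+1 M F s)).
Proof. by []. Qed.

Let term K F := facet_int F setT (a K F) - facet_int F GamN (b K F) +
  facet_int F GamN c.

Let term_boundary K F : K \in elts M -> facet K F -> cell M F `<=` bdry Om ->
  term K F = 0.
Proof.
move=> KM KF Fb; have gS := @open_bounded_refsimplex R n.
rewrite /term facet_intT !facet_intE -mulrBr -mulrDr.
rewrite (@vol_int_balance _ _ _ (Defs.fmap F @^-1` GamN)
  (fun s => a K F (Defs.fmap F s))) ?mulr0//.
- by apply: measurable_fmap; exact: facet_card KF.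
- exact: bcont_a.
- exact: bcont_b.
move: (v0 KM KF) (bdry_cover KM KF) (bdry_normal KM KF); rewrite /ae_facet /=.
move=> h1 h2 h3.
apply: filterS (filterI h1 (filterI h2 h3)) => t [v0t [bct bnt]] rt.
have Ft : cell M F (Defs.fmap F (vec t)) by apply: fmap_cell => //; exact: facet_card KF.
(* Off Gamma_N the covering hypothesis puts the point in Gamma_D, where the test function vanishes;
   on Gamma_N the domain normal is the facet normal and [hE] applies. *)
have bt := Fb _ Ft; split => [nN|Nt].
  have [Dt|//] := bct rt bt; rewrite /a ddot_tens (v0t rt Dt).
  by rewrite dotE trmx0 mulmx0 mxE.
have [m xm] := bnt rt bt; have mE := outward_normal_facet tM KM KF Ft xm.
rewrite /a /b /c (hE Nt xm) -mE ddot_tens dotBl dotZl; ring.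
Qed.

(** Gamma_N lies in the boundary, where a domain normal exists almost everywhere; a facet without
    such normals meets Gamma_N in a null set. *)
Let facet_null F f : (forall x m, cell M F x -> ~ outward_normal Om x m) ->
  (exists2 K, K \in elts M & facet K F) -> facet_int F GamN f = 0.
Proof.
move=> noF [K KM KF]; rewrite facet_intE vol_int_null ?mulr0//.
move: (bdry_normal KM KF); rewrite /ae_facet /=; apply: filterS => t ht rt Nt.
have [m] := ht rt (GamN_bdry Nt).
by apply: noF; apply: fmap_cell => //; exact: facet_card KF.
Qed.

Lemma skeleton_balance :
  \sum_(K in elts M) \sum_(F | facet K F) term K F = 0.
Proof.
rewrite (exchange_big_dep xpredT)//= big1// => F _.
have [[K0 K0M K0F]|noK] := pselect (exists2 K, K \in elts M & facet K F); last first.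
  by rewrite big1// => K /andP[KM KF]; case: noK; exists K.
have [Fb|nFb] := pselect (cell M F `<=` bdry Om).
  by rewrite big1// => K /andP[KM KF]; exact: term_boundary.
have [_ _ _ _ /(_ K0 F K0M K0F nFb) c2] := tM.
have cS : #|[set K in elts M | facet K F]| == 2.
  rewrite -[X in _ == X]c2; apply/eqP/eq_card => K; rewrite !inE /facet.
  by rewrite (facet_card K0F) eqxx andbT.
have /cards2P[K [K' [KK' SE]]] := cS.
have [KM KF] : K \in elts M /\ facet K F.
  by have := set21 K K'; rewrite -SE inE => /andP.
have [K'M K'F] : K' \in elts M /\ facet K' F.
  by have := set22 K K'; rewrite -SE inE => /andP.
transitivity (\sum_(L in [set K; K']%SET) term L F).
  by apply: eq_bigl => L; rewrite -SE inE.
rewrite big_setU1 ?inE//= big_set1.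
have noF x m : cell M F x -> ~ outward_normal Om x m.
  exact: (no_outward_normal tM KM K'M KK' KF K'F).
have nul f : facet_int F GamN f = 0 by apply: facet_null => //; exists K.
have tE L : term L F = facet_int F setT (a L F).
  by rewrite /term (nul (b L F)) (nul c) subr0 addr0.
(* Neither [trace_mx] nor [fmap] depends on the element, so the two integrands differ only in the
   sign of the normal. *)
rewrite (tE K) (tE K') (facet_intT _ (a K F)) (facet_intT _ (a K' F)) -mulrDr.
rewrite -vol_intD; [|exact: open_bounded_refsimplex|exact: bcont_a|exact: bcont_a].
rewrite vol_int0 ?mulr0// => s _; rewrite /a.
by rewrite (fnormal_opp tM KM K'M KK' KF K'F) !ddot_tens mulNmx dotNl subrr.
Qed.

End SkeletonBalance.

(** * Consistency *)

Section Weak.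
Context {R : realType}.

Lemma cvg_entries (T : Type) (F : set_system T) m d (f : T -> 'M[R]_(m, d))
    (l : 'M[R]_(m, d)) :
  Filter F -> (forall i j, (fun y => f y i j) @ F --> l i j) -> f @ F --> l.
Proof.
move=> FF fl; apply/cvgrPdist_le => e e0; near=> y.
rewrite [leLHS]/Num.Def.normr/= mx_normrE (bigmax_le _ (ltW e0))//= => i _.
rewrite !mxE/=; move: i; near: y; apply: filter_forall => /= i.
exact: ((cvgrPdist_le _ _).1 (fl i.1 i.2)).
Unshelve. all: by end_near. Qed.

Context {n : nat} (M : mesh R n.+1) (Om : set 'rV[R]_n.+1).
Implicit Types (K F : {set 'I_(nvtx M)}).
Hypothesis tM : triangulation M Om.
Context (T : 'I_n.+1 -> 'I_n.+1 -> 'rV[R]_n.+1 -> R).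
Hypothesis CT : forall i j, C1_closure Om (T i j).

Lemma eq_facet_int F A (f g : 'rV[R]_n.+1 -> R) : #|F| = n.+1 ->
  (forall x, cell M F x -> A x -> f x = g x) ->
  facet_int F A f = facet_int F A g.
Proof.
move=> cF fg; rewrite /facet_int; congr (_ * _); apply: eq_Rintegral.
by move=> t /set_mem[rt At]; apply: fg => //; exact: fmap_cell.
Qed.

Lemma facet_int0 F A (f : 'rV[R]_n.+1 -> R) : #|F| = n.+1 ->
  (forall x, cell M F x -> f x = 0) -> facet_int F A f = 0.
Proof.
move=> cF f0; rewrite (eq_facet_int (g := cst 0) cF); last by move=> x /f0.
by rewrite /facet_int /Rintegral integral0_eq// mulr0.
Qed.

(** [divergence] applied to [G i], the sum over j of [T i j] times a polynomial [q j]. The test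
    function equals these polynomials only on the open cell: its gradient is compared there, and its
    facet values are recovered as limits. *)
Lemma weak_divergence K k v : K \in elts M -> Vh M k v ->
  vol_int (cell M K) (fun x =>
    - (dot (\row_j \sum_i pd i (T i j) x) (v x) +
       ddot (\matrix_(i, j) T i j x) (grad v x))) +
  \sum_(F | facet K F) facet_int F setT (fun x =>
    ddot (trace_mx Om T x) (tens (normal_at (cell M K) x) (trace (cell M K) v x))) = 0.
Proof.
move=> KM vk; have sK := elts_simplicial tM KM; have gK := simplicial_open_bounded sK.
have KOm := elts_subset tM KM.
have /choice[q qP] : forall j, exists q, polyfun k q /\
    forall x, cell M K x -> v x 0 j = q x.
  by move=> j; have [q] := vk K j KM; exists q.
have Cq j : C1_closure (cell M K) (q j) := C1_polyfun _ (qP j).1.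
have CK i j : C1_closure (cell M K) (T i j) := C1_subset KOm (@CT i j).
pose G i x := \sum_j T i j x * q j x.
have CG i : C1_closure (cell M K) (G i) by apply: C1_sum => j _; exact: C1M.
have divE x : cell M K x -> dot (\row_j \sum_i pd i (T i j) x) (v x) +
    ddot (\matrix_(i, j) T i j x) (grad v x) = \sum_i pd i (G i) x.
  move=> Kx; rewrite /dot /ddot.
  under eq_bigr do rewrite mxE mulr_suml.
  rewrite exchange_big/= -big_split/=; apply: eq_bigr => i _.
  rewrite (pd_sum _ i (fun j _ => C1M (CK i j) (Cq j)) Kx) -big_split/=.
  apply: eq_bigr => j _; rewrite (pdM i (CK i j) (Cq j) Kx) !mxE.
  have [oK _] := gK.
  by rewrite (pd_eq i oK (qP j).2 Kx) (qP j).2// addrC [in RHS]mulrC; ring.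
have bG : bcont (cell M K) (fun x => \sum_i pd i (G i) x).
  apply: bcont_sum => i _; apply: (extendable_bcont gK).
  exact: C1_pd_extendable.
rewrite (_ : vol_int _ _ =
    vol_int (cell M K) (fun x => -1 * \sum_i pd i (G i) x)); last first.
  by apply: eq_vol_int => x Kx; rewrite divE// mulN1r.
rewrite (vol_intZ _ gK bG) mulN1r (divergence sK CG) addrC.
apply/eqP; rewrite subr_eq0; apply/eqP; apply: eq_bigr => F KF.
apply: (eq_facet_int (facet_card KF)) => x Fx _.
have Kx := cell_facet_closure sK KF Fx.
rewrite (normal_at_facet sK KF Fx) ddot_tens /dot.
have trv j : trace (cell M K) v x 0 j = trace (cell M K) (q j) x.
  rewrite (trace_lim (l := \row_j trace (cell M K) (q j) x) Kx) ?mxE//.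
  have pf : ProperFilter (within (cell M K) (nbhs x)) := within_nbhs_proper Kx.
  apply: cvg_entries => i j'; rewrite ord1 mxE.
  apply: cvg_trans (trace_cvg (C1_extendable (Cq j')) Kx); apply: near_eq_cvg.
  by rewrite near_withinE; apply: filterE => y Ky; rewrite (qP j').2.
under eq_bigr do rewrite mxE mulr_suml trv.
rewrite exchange_big/=; apply: eq_bigr => i _.
rewrite (trace_sum _ Kx) => [|j _]; last by apply: C1_extendable; exact: C1M.
rewrite mulr_sumr; apply: eq_bigr => j _.
rewrite (traceM Kx (C1_extendable (CK i j)) (C1_extendable (Cq j))).
rewrite (trace_subset KOm Kx (C1_extendable (@CT i j))).
by rewrite mxE mulrA.
Qed.

End Weak.

(** * Linear and tensor calculus of fields and their traces *)

Section FieldCalculus.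
Context {R : realType} {d : nat}.
Implicit Types (A : set 'rV[R]_d) (f g : 'rV[R]_d -> R) (a b : 'rV[R]_d -> 'rV[R]_d).

Lemma C1Z A (c : R) f : C1_closure A f -> C1_closure A (fun x => c * f x).
Proof. exact: (C1M (C1_cst A c)). Qed.

Lemma C1B A f g : C1_closure A f -> C1_closure A g ->
  C1_closure A (fun x => f x - g x).
Proof.
move=> Cf Cg; under eq_fun do rewrite -mulN1r.
exact: (C1D Cf (C1Z (-1) Cg)).
Qed.

Lemma pdZ A (c : R) f i x : C1_closure A f -> A x ->
  pd i (fun y => c * f y) x = c * pd i f x.
Proof.
move=> Cf Ax; have -> := pdM i (C1_cst A c) Cf Ax.
by rewrite /pd derive_cst mulr0 addr0.
Qed.

Lemma pdB A f g i x : C1_closure A f -> C1_closure A g -> A x ->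
  pd i (fun y => f y - g y) x = pd i f x - pd i g x.
Proof.
move=> Cf Cg Ax; have h := pdD i Cf (C1Z (-1) Cg) Ax.
rewrite (pdZ (-1) i Cg Ax) mulN1r in h; rewrite -h; congr (pd i _ x).
by apply/funext => y; rewrite mulN1r.
Qed.

Lemma traceZ A (c : R) f x : closure A x -> extendable A f ->
  trace A (fun y => c * f y) x = c * trace A f x.
Proof.
move=> Ax ef; have -> := traceM Ax (@extendable_cst _ _ _ A c) ef.
by rewrite trace_cst.
Qed.

Lemma extendableZ A (c : R) f : extendable A f -> extendable A (fun y => c * f y).
Proof. exact: (extendableM (@extendable_cst _ _ _ A c)). Qed.

Lemma traceB A f g x : closure A x -> extendable A f -> extendable A g ->
  trace A (fun y => f y - g y) x = trace A f x - trace A g x.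
Proof.
move=> Ax ef eg; have h := traceD Ax ef (extendableZ (c := -1) eg).
rewrite traceZ// mulN1r in h; rewrite -h; congr (trace A _ x).
by apply/funext => y; rewrite mulN1r.
Qed.

Lemma C1_tens A a b i j : C1_closure A a -> C1_closure A b ->
  C1_closure A (fun x => tens (a x) (b x) i j).
Proof.
move=> Ca Cb; under eq_fun do rewrite mxE.
exact: (C1M (C1_entry 0 i Ca) (C1_entry 0 j Cb)).
Qed.

Lemma trace_tens A a b i j x : C1_closure A a -> C1_closure A b ->
  {within closure A, continuous a} -> {within closure A, continuous b} ->
  closure A x -> trace A (fun x => tens (a x) (b x) i j) x = tens (a x) (b x) i j.
Proof.
move=> Ca Cb ca cb Ax; under eq_fun do rewrite mxE.
have ea := C1_extendable Ca; have eb := C1_extendable Cb.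
rewrite (traceM Ax (@extendable_entry _ _ _ _ _ _ 0 i ea) (@extendable_entry _ _ _ _ _ _ 0 j eb)).
rewrite !trace_entry// mxE.
by rewrite (trace_within_continuous ca) ?(trace_within_continuous cb).
Qed.

Lemma C1_dot A a b : C1_closure A a -> C1_closure A b ->
  C1_closure A (fun x => dot (a x) (b x)).
Proof.
move=> Ca Cb; apply: C1_sum => i _.
exact: (C1M (C1_entry 0 i Ca) (C1_entry 0 i Cb)).
Qed.

Lemma trace_dot A a b x : C1_closure A a -> C1_closure A b ->
  {within closure A, continuous a} -> {within closure A, continuous b} ->
  closure A x -> trace A (fun x => dot (a x) (b x)) x = dot (a x) (b x).
Proof.
move=> Ca Cb ca cb Ax.
have ea := C1_extendable Ca; have eb := C1_extendable Cb.
rewrite (trace_sum _ Ax) => [|i _]; last first.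
  exact: (extendableM (@extendable_entry _ _ _ _ _ _ 0 i ea) (@extendable_entry _ _ _ _ _ _ 0 i eb)).
apply: eq_bigr => i _.
rewrite (traceM Ax (@extendable_entry _ _ _ _ _ _ 0 i ea) (@extendable_entry _ _ _ _ _ _ 0 i eb)).
by rewrite !trace_entry// (trace_within_continuous ca) ?(trace_within_continuous cb).
Qed.

Lemma ddotDl (C C' G : 'M[R]_d) : ddot (C + C') G = ddot C G + ddot C' G.
Proof.
rewrite /ddot -big_split/=; apply: eq_bigr => i _; rewrite -big_split/=.
by apply: eq_bigr => j _; rewrite mxE mulrDl.
Qed.

Lemma ddotNl (C G : 'M[R]_d) : ddot (- C) G = - ddot C G.
Proof.
rewrite /ddot -sumrN; apply: eq_bigr => i _; rewrite -sumrN.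
by apply: eq_bigr => j _; rewrite mxE mulNr.
Qed.

Lemma ddot_tr (C G : 'M[R]_d) : ddot C G^T = ddot C^T G.
Proof.
rewrite /ddot exchange_big/=; apply: eq_bigr => i _; apply: eq_bigr => j _.
by rewrite !mxE.
Qed.

Lemma ddotDr (C G G' : 'M[R]_d) : ddot C (G + G') = ddot C G + ddot C G'.
Proof.
rewrite /ddot -big_split/=; apply: eq_bigr => i _; rewrite -big_split/=.
by apply: eq_bigr => j _; rewrite mxE mulrDr.
Qed.

Lemma ddotZr (C G : 'M[R]_d) (c : R) : ddot C (c *: G) = c * ddot C G.
Proof.
rewrite /ddot mulr_sumr; apply: eq_bigr => i _; rewrite mulr_sumr.
by apply: eq_bigr => j _; rewrite mxE; ring.
Qed.

(** A symmetric flux sees only the symmetric part of a gradient, so the viscous term of (S1) can be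
    written with the full gradient like the rest of the flux; [ddot_antisym] does the same for the
    resistive term of (S5). *)
Lemma ddot_sym (C G : 'M[R]_d) : C^T = C -> ddot C (2^-1 *: (G + G^T)) = ddot C G.
Proof. by move=> CT; rewrite ddotZr ddotDr ddot_tr CT; field. Qed.

Lemma ddot_antisym (C G : 'M[R]_d) : C^T = - C ->
  ddot C (2^-1 *: (G - G^T)) = ddot C G.
Proof.
move=> CT; rewrite ddotZr ddotDr -[- G^T]scaleN1r ddotZr ddot_tr CT ddotNl.
by field.
Qed.

End FieldCalculus.

Section MatrixFields.
Context {R : realType} {n : nat}.
Local Notation d := n.+1.
Implicit Types (A : set 'rV[R]_d) (T : 'rV[R]_d -> 'M[R]_d) (f : 'rV[R]_d -> R).

Definition C1_mx A T := forall i j, C1_closure A (fun x => T x i j).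
(** Traces entry by entry, the form used by [weak_divergence] and [skeleton_balance];
    [mtrace_closure] identifies them with the limits of matrix fields that occur in the scheme. *)
Definition mtrace A T x : 'M[R]_d := trace_mx A (fun i j y => T y i j) x.

Lemma C1_mx_closure A T : C1_closure A T -> C1_mx A T.
Proof. by move=> CT i j; exact: C1_entry. Qed.

Lemma C1_mxD A T T' : C1_mx A T -> C1_mx A T' -> C1_mx A (fun x => T x + T' x).
Proof. by move=> h h' i j; under eq_fun do rewrite mxE; exact: C1D. Qed.

Lemma C1_mxB A T T' : C1_mx A T -> C1_mx A T' -> C1_mx A (fun x => T x - T' x).
Proof. by move=> h h' i j; under eq_fun do rewrite !mxE; exact: C1B. Qed.

Lemma C1_mxZ A c T : C1_mx A T -> C1_mx A (fun x => c *: T x).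
Proof. by move=> h i j; under eq_fun do rewrite mxE; exact: C1Z. Qed.

Lemma C1_scalar_mx A f : C1_closure A f -> C1_mx A (fun x => (f x)%:M).
Proof.
move=> Cf i j; under eq_fun do rewrite mxE.
by case: (i == j); [under eq_fun do rewrite mulr1n | exact: C1_cst].
Qed.

Lemma mtraceD A T T' x : closure A x -> C1_mx A T -> C1_mx A T' ->
  mtrace A (fun y => T y + T' y) x = mtrace A T x + mtrace A T' x.
Proof.
move=> Ax h h'; apply/matrixP => i j; rewrite !mxE -traceD//.
- by congr (trace A _ x); apply/funext => y; rewrite mxE.
- exact: C1_extendable.
- exact: C1_extendable.
Qed.

Lemma mtraceB A T T' x : closure A x -> C1_mx A T -> C1_mx A T' ->
  mtrace A (fun y => T y - T' y) x = mtrace A T x - mtrace A T' x.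
Proof.
move=> Ax h h'; apply/matrixP => i j; rewrite !mxE -traceB//.
- by congr (trace A _ x); apply/funext => y; rewrite !mxE.
- exact: C1_extendable.
- exact: C1_extendable.
Qed.

Lemma mtraceZ A c T x : closure A x -> C1_mx A T ->
  mtrace A (fun y => c *: T y) x = c *: mtrace A T x.
Proof.
move=> Ax h; apply/matrixP => i j; rewrite !mxE -traceZ//.
- by congr (trace A _ x); apply/funext => y; rewrite mxE.
- exact: C1_extendable.
Qed.

Lemma mtrace_scalar A f x : closure A x ->
  mtrace A (fun y => (f y)%:M) x = (trace A f x)%:M.
Proof.
move=> Ax; apply/matrixP => i j; rewrite !mxE; under eq_fun do rewrite mxE.
by case: (i == j); [under eq_fun do rewrite mulr1n | exact: trace_cst].
Qed.

Lemma mtrace_closure A B T x : A `<=` B -> closure A x -> C1_closure B T ->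
  trace A T x = mtrace B T x.
Proof.
move=> AB Ax CT; have eT := C1_extendable CT.
rewrite (trace_subset AB Ax eT); apply/matrixP => i j.
by rewrite mxE trace_entry//; exact: (closureS AB).
Qed.

Lemma divmD A T T' x : C1_mx A T -> C1_mx A T' -> A x ->
  divm (fun y => T y + T' y) x = divm T x + divm T' x.
Proof.
move=> h h' Ax; apply/rowP => j; rewrite !mxE -big_split/=.
apply: eq_bigr => i _; rewrite -(pdD i (h i j) (h' i j) Ax).
by congr (pd i _ x); apply/funext => y; rewrite mxE.
Qed.

Lemma divmB A T T' x : C1_mx A T -> C1_mx A T' -> A x ->
  divm (fun y => T y - T' y) x = divm T x - divm T' x.
Proof.
move=> h h' Ax; apply/rowP => j; rewrite !mxE -sumrB.
apply: eq_bigr => i _; rewrite -(pdB i (h i j) (h' i j) Ax).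
by congr (pd i _ x); apply/funext => y; rewrite !mxE.
Qed.

Lemma divm_scalar f x : divm (fun y => (f y)%:M) x = sgrad f x.
Proof.
apply/rowP => j; rewrite !mxE (bigD1 j)//= big1 => [|i ij].
  by rewrite addr0; congr (pd j _ x); apply/funext => y; rewrite mxE eqxx.
under eq_fun do rewrite mxE (negPf ij); exact: derive_cst.
Qed.

Lemma sgradZ A c f x : C1_closure A f -> A x ->
  sgrad (fun y => c * f y) x = c *: sgrad f x.
Proof. by move=> Cf Ax; apply/rowP => j; rewrite !mxE (pdZ c j Cf Ax). Qed.

(** In the product rule the part with [divv a] drops out. With a the magnetic field and b the
    velocity, this is how (E4) produces the volume term of (S5) that contains the gradient of the
    velocity. *)
Lemma divm_tens A (a b : 'rV[R]_d -> 'rV[R]_d) x w :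
  C1_closure A a -> C1_closure A b -> A x -> divv a x = 0 ->
  dot (divm (fun y => tens (a y) (b y)) x) w = ddot (tens (a x) w) (grad b x).
Proof.
move=> Ca Cb Ax a0; rewrite /dot.
have E j : divm (fun y => tens (a y) (b y)) x 0 j =
    \sum_i a x 0 i * pd i (fun y => b y 0 j) x.
  rewrite mxE; transitivity (\sum_i (a x 0 i * pd i (fun y => b y 0 j) x +
      b x 0 j * pd i (fun y => a y 0 i) x)).
    apply: eq_bigr => i _; under eq_fun do rewrite mxE.
    exact: (pdM i (@C1_entry _ _ _ _ _ _ 0 i Ca) (@C1_entry _ _ _ _ _ _ 0 j Cb) Ax).
  by rewrite big_split/= -mulr_sumr -/(divv a x) a0 mulr0 addr0.
under eq_bigr do rewrite E mulr_suml.
rewrite exchange_big/=; apply: eq_bigr => i _; apply: eq_bigr => j _.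
by rewrite !mxE; ring.
Qed.

Lemma tensr0 (a : 'rV[R]_d) : tens a 0 = 0.
Proof. by apply/matrixP => i j; rewrite !mxE mulr0. Qed.

Lemma ddot0r (G : 'M[R]_d) : ddot G 0 = 0.
Proof. by rewrite /ddot big1// => i _; rewrite big1// => j _; rewrite mxE mulr0. Qed.

Lemma ddot0l (G : 'M[R]_d) : ddot 0 G = 0.
Proof. by rewrite /ddot big1// => i _; rewrite big1// => j _; rewrite mxE mul0r. Qed.

End MatrixFields.

(** * The equations of the scheme at a fixed positive time *)

Section Consistency.
Context {R : realType} {n : nat}.
Local Notation d := n.+1.
Context (D : mhd_data R d) (M : mesh R d) (Cpen : R) (k : nat).
Context (u : 'rV[R]_d -> R -> 'rV[R]_d) (p : 'rV[R]_d -> R -> R).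
Context (B : 'rV[R]_d -> R -> 'rV[R]_d) (r : 'rV[R]_d -> R -> R).
Hypothesis hD : admissible_data D.
Hypothesis tM : triangulation M (Omega D).
Hypothesis hDM : admissible_boundary D M.
Hypothesis hsol : strong_form D u p B r.
Hypothesis hreg : smooth_solution D u p B r.
Implicit Types (K F : {set 'I_(nvtx M)}) (x : 'rV[R]_d).
Local Notation Om := (Omega D).
Local Notation X := (exact_fields D u p B r).

Context (t : R).
Hypothesis t0 : 0 < t.

Let Cu := u_C1 hreg t0.
Let CB := B_C1 hreg t0.
Let Cp := p_C1 hreg t0.
Let Cr := r_C1 hreg t0.
Let cu := u_continuous hreg t0.
Let cB := B_continuous hreg t0.
Let Cvisc : C1_mx Om (visc D u ^~ t) := C1_mx_closure (visc_C1 hreg t0).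
Let Cresist : C1_mx Om (resist D B ^~ t) := C1_mx_closure (resist_C1 hreg t0).

Let Ctens_uu : C1_mx Om (fun y => tens (u y t) (u y t)).
Proof. by move=> i j; exact: C1_tens. Qed.
Let Ctens_uB : C1_mx Om (fun y => tens (u y t) (B y t)).
Proof. by move=> i j; exact: C1_tens. Qed.
Let Ctens_BB : C1_mx Om (fun y => tens (B y t) (B y t)).
Proof. by move=> i j; exact: C1_tens. Qed.
Let Cdot_BB : C1_closure Om (fun y => 2^-1 * dot (B y t) (B y t)).
Proof. exact/C1Z/C1_dot. Qed.
Let CMaxwell : C1_mx Om (fun y => Maxwell D (B y t)).
Proof. exact: (C1_mxZ _ (C1_mxB Ctens_BB (C1_scalar_mx Cdot_BB))). Qed.
Let Crhop : C1_closure Om (fun y => (rho D)^-1 * p y t) := C1Z _ Cp.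

Definition momentum_flux x : 'M[R]_d :=
  tens (u x t) (u x t) + ((rho D)^-1 * p x t)%:M - visc D u x t
  - Maxwell D (B x t).

(** The term [tens B u] of (E3) is left out: (S5) keeps it as a volume term without integrating by
    parts, and correspondingly it is absent from the boundary condition (E8). *)
Definition induction_flux x : 'M[R]_d :=
  tens (u x t) (B x t) + (r x t)%:M - resist D B x t.

Let Cup : C1_mx Om (fun y => tens (u y t) (u y t) + ((rho D)^-1 * p y t)%:M).
Proof. exact: (C1_mxD Ctens_uu (C1_scalar_mx Crhop)). Qed.
Let Cupv : C1_mx Om (fun y => tens (u y t) (u y t) + ((rho D)^-1 * p y t)%:M
  - visc D u y t).
Proof. exact: (C1_mxB Cup Cvisc). Qed.
Let CBr : C1_mx Om (fun y => tens (u y t) (B y t) + (r y t)%:M).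
Proof. exact: (C1_mxD Ctens_uB (C1_scalar_mx Cr)). Qed.

Let Cmomentum : C1_mx Om momentum_flux.
Proof. exact: (C1_mxB Cupv CMaxwell). Qed.

Let Cinduction : C1_mx Om induction_flux.
Proof. exact: (C1_mxB CBr Cresist). Qed.

Lemma divm_momentum_flux x : Om x ->
  divm momentum_flux x = fv D x t - derive1 (u x) t.
Proof.
move=> Ox; rewrite /momentum_flux (divmB Cupv CMaxwell Ox) (divmB Cup Cvisc Ox).
rewrite (divmD Ctens_uu (C1_scalar_mx Crhop) Ox) divm_scalar (sgradZ _ Cp Ox).
by rewrite -(E1 hsol Ox t0); apply/rowP => j; rewrite !mxE; ring.
Qed.

Lemma divm_induction_flux x : Om x -> divm induction_flux x =
  fm D x t - derive1 (B x) t + divm (fun y => tens (B y t) (u y t)) x.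
Proof.
move=> Ox; rewrite /induction_flux (divmB CBr Cresist Ox).
rewrite (divmD Ctens_uB (C1_scalar_mx Cr) Ox) divm_scalar.
by rewrite -(E3 hsol Ox t0); apply/rowP => j; rewrite !mxE; ring.
Qed.

Let mtrace_tens (a b : 'rV[R]_d -> 'rV[R]_d) x :
  C1_closure Om a -> C1_closure Om b ->
  {within closure Om, continuous a} -> {within closure Om, continuous b} ->
  closure Om x -> mtrace Om (fun y => tens (a y) (b y)) x = tens (a x) (b x).
Proof.
by move=> Ca Cb ca cb Ox; apply/matrixP => i j; rewrite mxE; exact: trace_tens.
Qed.

Lemma mtrace_momentum_flux x : closure Om x -> mtrace Om momentum_flux x =
  tens (u x t) (u x t) + ((rho D)^-1 * trace Om (p ^~ t) x)%:M
  - trace Om (visc D u ^~ t) x - Maxwell D (B x t).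
Proof.
move=> Ox; rewrite /momentum_flux (mtraceB Ox Cupv CMaxwell).
rewrite (mtraceB Ox Cup Cvisc) (mtraceD Ox Ctens_uu (C1_scalar_mx Crhop)).
rewrite (mtrace_tens Cu Cu cu cu Ox) (mtrace_scalar _ Ox).
rewrite (traceZ _ Ox (C1_extendable Cp)).
rewrite -(mtrace_closure (@subset_refl _ _) Ox (visc_C1 hreg t0)).
rewrite /Maxwell (mtraceZ _ Ox (C1_mxB Ctens_BB (C1_scalar_mx Cdot_BB))).
rewrite (mtraceB Ox Ctens_BB (C1_scalar_mx Cdot_BB)).
rewrite (mtrace_tens CB CB cB cB Ox) (mtrace_scalar _ Ox).
by rewrite (traceZ _ Ox (C1_extendable (C1_dot CB CB))) (trace_dot CB CB cB cB Ox).
Qed.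

Lemma mtrace_induction_flux x : closure Om x -> mtrace Om induction_flux x =
  tens (u x t) (B x t) + (trace Om (r ^~ t) x)%:M - trace Om (resist D B ^~ t) x.
Proof.
move=> Ox; rewrite /induction_flux (mtraceB Ox CBr Cresist).
rewrite (mtraceD Ox Ctens_uB (C1_scalar_mx Cr)).
rewrite (mtrace_tens Cu CB cu cB Ox) (mtrace_scalar _ Ox).
by rewrite -(mtrace_closure (@subset_refl _ _) Ox (resist_C1 hreg t0)).
Qed.

Section Facet.
Context (K F : {set 'I_(nvtx M)}).
Hypotheses (KM : K \in elts M) (KF : facet K F).
Context (x : 'rV[R]_d).
Hypothesis Fx : cell M F x.

Let Kx : closure (cell M K) x :=
  cell_facet_closure (elts_simplicial tM KM) KF Fx.
Let KOm := elts_subset tM KM.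

Lemma closure_facet : closure Om x.
Proof. exact: (closureS KOm). Qed.

Lemma trace_u : trace (cell M K) (u ^~ t) x = u x t.
Proof. exact: (trace_within_continuous cu KOm Kx). Qed.

Lemma trace_B : trace (cell M K) (B ^~ t) x = B x t.
Proof. exact: (trace_within_continuous cB KOm Kx). Qed.

Lemma flux_vE : flux_v D Cpen X K x t = mtrace Om momentum_flux x.
Proof.
rewrite /flux_v/= trace_u subrr tensr0 scaler0 addr0.
rewrite (mtrace_momentum_flux closure_facet) -scalerDl subrK scale1r.
by rewrite (trace_subset KOm Kx (C1_extendable (visc_C1 hreg t0))).
Qed.

Lemma flux_mE : flux_m D Cpen X K x t = mtrace Om induction_flux x.
Proof.
rewrite /flux_m/= trace_u trace_B subrr tensr0 scaler0 addr0.
rewrite (mtrace_induction_flux closure_facet) -scalerDl subrK scale1r.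
by rewrite (trace_subset KOm Kx (C1_extendable (resist_C1 hreg t0))).
Qed.

(** The weight [1 - inflow] may jump where u.n changes sign, but its product with u.n is the
    positive part of u.n, which is continuous on the facet. In this form the outflow term is an
    admissible integrand. *)
Lemma outflowE z w : (1 - inflow X K x t) *
    ddot (tens (trace (cell M K) (u ^~ t) x) z) (tens (normal_at (cell M K) x) w) =
  Num.max (dot (u x t) (fnormal K F)) 0 * dot z w.
Proof.
rewrite /inflow/= trace_u (normal_at_facet (elts_simplicial tM KM) KF Fx).
rewrite ddot_tens mul_tens dotZl /Num.max.
by case: ifP => _; rewrite ?subrr ?mul0r ?subr0 ?mul1r.
Qed.

End Facet.

Lemma sum_facets0 (A : set 'rV[R]_d) (f : {set 'I_(nvtx M)} -> 'rV[R]_d -> R) :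
  (forall K F x, K \in elts M -> facet K F -> cell M F x -> f K x = 0) ->
  sum_facets M A f = 0.
Proof.
move=> f0; rewrite /sum_facets big1// => K KM; rewrite big1// => F KF.
by apply: (facet_int0 _ (facet_card KF)) => x Fx; exact: (f0 K F).
Qed.

Lemma sum_vol0 (f : 'rV[R]_d -> R) : (forall x, Om x -> f x = 0) ->
  sum_vol M f = 0.
Proof.
move=> f0; rewrite /sum_vol big1// => K KM; apply: vol_int0 => x Kx.
by apply: f0; exact: (elts_subset tM KM).
Qed.

Lemma consistency_S1 : S1 D M Cpen k X t.
Proof.
move=> v vk; rewrite [X in _ - X]sum_facets0 => [|K F x KM KF Fx]; last first.
  by rewrite /= (trace_u KM KF Fx) subrr tensr0 scaler0 ddot0l.
rewrite subr0 /sum_vol /sum_facets -big_split/= big1// => K KM.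
have h := weak_divergence tM Cmomentum KM vk.
rewrite -[RHS]h; congr (_ + _).
  apply: eq_vol_int => x Kx; have Ox := elts_subset tM KM Kx.
  have -> : (\matrix_(i, j) momentum_flux x i j) = momentum_flux x.
    by apply/matrixP => i j; rewrite mxE.
  rewrite -/(divm momentum_flux x) (divm_momentum_flux Ox) dotBl.
  rewrite {1}/visc [grads v x]/grads ddot_sym; last first.
    by apply/matrixP => i j; rewrite !mxE addrC.
  by rewrite /momentum_flux !ddotDl !ddotNl; ring.
apply: eq_bigr => F KF; apply: (eq_facet_int (facet_card KF)) => x Fx _.
by rewrite (flux_vE KM KF Fx).
Qed.

Lemma consistency_S5 : S5 D M Cpen k X t.
Proof.
move=> w wk; rewrite [X in _ - X]sum_facets0 => [|K F x KM KF Fx]; last first.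
  by rewrite /= (trace_B KM KF Fx) subrr tensr0 scaler0 ddot0l.
rewrite subr0 /sum_vol /sum_facets -big_split/= big1// => K KM.
have h := weak_divergence tM Cinduction KM wk.
rewrite -[RHS]h; congr (_ + _).
  apply: eq_vol_int => x Kx; have Ox := elts_subset tM KM Kx.
  have -> : (\matrix_(i, j) induction_flux x i j) = induction_flux x.
    by apply/matrixP => i j; rewrite mxE.
  rewrite -/(divm induction_flux x) (divm_induction_flux Ox) dotDl dotBl.
  rewrite (divm_tens _ CB Cu Ox (E4 hsol Ox t0)).
  rewrite {1}/resist [grada w x]/grada ddot_antisym; last first.
    by apply/matrixP => i j; rewrite !mxE; ring.
  by rewrite /induction_flux !ddotDl !ddotNl; ring.
apply: eq_bigr => F KF; apply: (eq_facet_int (facet_card KF)) => x Fx _.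
by rewrite (flux_mE KM KF Fx).
Qed.

Let bOm : bounded_set Om. Proof. by case: hD => -[]. Qed.

Let GamN_bdry : GammaN D `<=` bdry Om.
Proof.
case: hD => _ [-> _] _ _ _ x Nx; apply: subset_closure; right; exact: Nx.
Qed.

(** The shape shared by (S2), with z the velocity, and (S6), with z the magnetic field, once the
    jump terms are gone. The elementwise fluxes and normals are replaced on each open facet by the
    objects of [skeleton_balance]. *)
Lemma conormal_balance (T : 'rV[R]_d -> 'M[R]_d) (z h : 'rV[R]_d -> 'rV[R]_d)
    (flux : {set 'I_(nvtx M)} -> 'rV[R]_d -> 'M[R]_d) v :
  C1_mx Om T -> {within closure Om, continuous z} ->
  Vhhat0 M k (GammaD D) v ->
  (forall x m, GammaN D x -> outward_normal Om x m ->
    h x = Num.max (dot (u x t) m) 0 *: z x - m *m mtrace Om T x) ->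
  (forall K F x, K \in elts M -> facet K F -> cell M F x ->
    flux K x = mtrace Om T x) ->
  sum_facets M setT (fun K x =>
    ddot (flux K x) (tens (normal_at (cell M K) x) (v x)))
  - sum_facets M (GammaN D) (fun K x => (1 - inflow X K x t) *
      ddot (tens (trace (cell M K) (u ^~ t) x) (z x))
           (tens (normal_at (cell M K) x) (v x)))
  + sum_facets M (GammaN D) (fun=> fun x => dot (h x) (v x)) = 0.
Proof.
move=> CT cz [vk v0] hE fluxE.
have [_ mN cover normal] := hDM.
have := skeleton_balance tM bOm mN GamN_bdry cover normal
  (fun i j => C1_extendable (CT i j)) cu cz vk v0 hE.
move=> bal; rewrite /sum_facets -sumrB -big_split/= -[RHS]bal.
apply: eq_bigr => K KM; rewrite -sumrB -big_split/=.
apply: eq_bigr => F KF; have cF := facet_card KF.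
have sK := elts_simplicial tM KM.
congr (_ - _ + _); apply: (eq_facet_int cF) => x Fx _.
  by rewrite (fluxE K F) // (normal_at_facet sK KF Fx).
exact: outflowE.
Qed.

Let max0E (a : R) : Num.max a 0 = a - Num.min a 0.
Proof. by apply/eqP; rewrite eq_sym subr_eq addr_max_min addr0. Qed.

Lemma consistency_S2 : S2 D M Cpen k X t.
Proof.
move=> v v0; apply: (conormal_balance Cmomentum cu v0) => [x m Nx xm|]; last first.
  by move=> K F x KM KF Fx; exact: (flux_vE KM KF Fx).
have Ox : closure Om x by case: (GamN_bdry Nx).
rewrite -(E6 hsol Nx t0 xm) (mtrace_momentum_flux Ox) max0E.
rewrite !mulmxDr !mulmxN mul_tens.
by apply/rowP => j; rewrite !mxE; ring.
Qed.

Lemma consistency_S6 : S6 D M Cpen k X t.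
Proof.
move=> w w0; rewrite [X in _ - X - _]sum_facets0 => [|K F x KM KF Fx]; last first.
  by rewrite /= (trace_u KM KF Fx) subrr tensr0 ddot0r.
rewrite subr0.
apply: (conormal_balance Cinduction cB w0) => [x m Nx xm|]; last first.
  by move=> K F x KM KF Fx; exact: (flux_mE KM KF Fx).
have Ox : closure Om x by case: (GamN_bdry Nx).
rewrite -(E8 hsol Nx t0 xm) (mtrace_induction_flux Ox) max0E.
rewrite !mulmxDr !mulmxN mul_tens.
by apply/rowP => j; rewrite !mxE; ring.
Qed.

End Consistency.

Theorem proposition1 (R : realType) (d : nat) (hd : d = 2%N \/ d = 3%N)
    (D : mhd_data R d) (hD : admissible_data D)
    (M : mesh R d) (hM : triangulation M (Omega D))
    (hDM : admissible_boundary D M)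
    (Cpen : R) (k : nat) (hk : (1 <= k)%N)
    (u : 'rV[R]_d -> R -> 'rV[R]_d) (p : 'rV[R]_d -> R -> R)
    (B : 'rV[R]_d -> R -> 'rV[R]_d) (r : 'rV[R]_d -> R -> R)
    (hsol : strong_form D u p B r) (hreg : smooth_solution D u p B r) :
  hdg_equations D M Cpen k (exact_fields D u p B r).
Proof.
(* Facets are parametrized by a simplex of dimension n, so the dimension is put in the form
   [n.+1]. *)
have [n dn] : exists n, d = n.+1 by case: hd => ->; [exists 1%N|exists 2%N].
subst d; split=> [t t0|]; last split.
- split; split.
  + exact: consistency_S1 hsol hreg _ t0.
  + exact: consistency_S2 hsol hreg _ t0.
  + move=> q _; apply: (sum_vol0 hM) => x Ox.
    by rewrite /= (E2 hsol Ox t0) mulr0 mul0r.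
  + move=> q _; apply: sum_facets0 => K F x KM KF Fx.
    by rewrite /= (trace_u hM hreg t0 KM KF Fx) subrr dotE mul0mx mxE mulr0 mul0r.
  + exact: consistency_S5 hsol hreg _ t0.
  + exact: consistency_S6 hsol hreg _ t0.
  + move=> q _; apply: (sum_vol0 hM) => x Ox.
    by rewrite /= (E4 hsol Ox t0) mulr0.
  + move=> q _; apply: sum_facets0 => K F x KM KF Fx.
    by rewrite /= (trace_B hM hreg t0 KM KF Fx) subrr dotE mul0mx mxE mul0r.
- move=> v _; apply: (sum_vol0 hM) => x Ox.
  by rewrite /= (E9 hsol Ox) subrr dotE mul0mx mxE.
- move=> v _; apply: (sum_vol0 hM) => x Ox.
  by rewrite /= (E10 hsol Ox) subrr dotE mul0mx mxE.
Qed.
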